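(* Let $M$ be a $2$-dimensional smooth orientable manifold and let $S$ be a non-flat spray on $A$, where $A=T_0M$ (or, when conic pseudo-Finsler functions are allowed, $A\subseteq T_0M$ is an open cone). Let $\mathcal D=\operatorname{Im}(h)\oplus\operatorname{Im}(\Phi)$ be its Berwald distribution and $\mathcal D^{\ast}$ the annihilator of $\mathcal D$. The following conditions are equivalent: (i) $S$ is Finsler metrizable. (ii) $S$ is regular and the Berwald distribution $\mathcal D$ is integrable. (iii) There exists a closed $1$-form $\omega\in\mathcal D^{\ast}$ such that $\operatorname{rank}\left(d_J\omega+2\,\omega\wedge i_J\omega\right)=4$.
   Context: Setting. $TM$ is the tangent bundle of $M$ with induced coordinates $(x^i,y^i)$, and $T_0M=TM\setminus\{0\}$. An open cone is an open subset $A\subseteq T_0M$ with $(x,\lambda y)\in A$ for all $(x,y)\in A$, $\lambda>0$. The Liouville vector field is $\mathcal C=y^i\partial/\partial y^i$; the tangent structure is $J=\frac{\partial}{\partial y^i}\otimes dx^i$. Spray. A spray is a vector field $S$ with $JS=\mathcal C$ and $[\mathcal C,S]=S$; locally $S=y^i\frac{\partial}{\partial x^i}-2G^i\frac{\partial}{\partial y^i}$, with $G^i$ positively $2$-homogeneous in $y$. Put $N^i_j=\partial G^i/\partial y^j$, $\frac{\delta}{\delta x^i}=\frac{\partial}{\partial x^i}-N^j_i\frac{\partial}{\partial y^j}$, $\delta y^i=dy^i+N^i_jdx^j$. The horizontal and vertical projectors are $h=\frac{\delta}{\delta x^i}\otimes dx^i$, $v=\frac{\partial}{\partial y^i}\otimes\delta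 y^i$, and the almost complex structure is $\mathbb F=\frac{\delta}{\delta x^i}\otimes\delta y^i-\frac{\partial}{\partial y^i}\otimes dx^i$. The Jacobi endomorphism is $\Phi=v\circ[S,h]$, i.e. $\Phi(X)=v[S,hX]$; locally $\Phi=R^i_j\frac{\partial}{\partial y^i}\otimes dx^j$ with $R^i_j=2\frac{\partial G^i}{\partial x^j}-S(N^i_j)-N^i_kN^k_j$. In dimension $2$ every spray is isotropic: $\Phi=\rho J-\alpha\otimes\mathcal C$, where $\rho=R^1_1+R^2_2$ (the Ricci scalar) and $\alpha=\alpha_idx^i$ is a semi-basic $1$-form with $\alpha(S)=\rho$. Non-flat means that $\Phi$ (equivalently $\alpha$) vanishes nowhere on $A$, and $\rho$ is also taken to vanish nowhere on $A$. Then $\mathcal D=\operatorname{Im}(h)\oplus\operatorname{Im}(\Phi)$ is a regular $3$-dimensional distribution, called the Berwald distribution. $\mathcal D^{\ast}$ denotes the $1$-forms that vanish on $\mathcal D$. Integrable means integrable in the sense of Frobenius. Let $i_{\mathbb F}\theta=\theta\circ\mathbb F$ for $1$-forms $\theta$, and $\Omega=d\left(\frac{\alpha}{\rho}\right)+2\,i_{\mathbb F}\frac{\alpha}{\rho}\wedge\frac{\alpha}{\rho}$. The spray is regular if $\operatorname{rank}(\Omega)=4$. Here $i_J\omega=\omega\circ J$ for $1$-forms, $(i_J\beta)(X,Y)=\beta(JX,Y)+\beta(X,JY)$ for $2$-forms, $i_Jf=0$ for functions, and $d_J=i_J\circ d-d\circ i_J$; so $d_Jf=\frac{\partial f}{\partial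 y^i}dx^i$. Finsler functions. A Finsler function is a continuous function $F:TM\to\mathbb R$, smooth and strictly positive on $T_0M$, with $F(x,\lambda y)=\lambda F(x,y)$ for $\lambda\ge 0$, whose metric tensor $g_{ij}=\frac12\frac{\partial^2F^2}{\partial y^i\partial y^j}$ has maximal rank $2$ on $T_0M$ (no positive definiteness is required). If the domain of $F$ is restricted to an open cone, $F$ is called a conic pseudo-Finsler function. $S$ is Finsler metrizable if there exists a (conic pseudo-)Finsler function $F$ satisfying the Euler–Lagrange equation $i_Sdd_JF^2=-dF^2$, i.e. $S$ is the geodesic spray of $F$.
   Formalization: Finsler metrizability in (i) is read locally: each direction in A has an open conic neighbourhood in A with a conic pseudo-Finsler function whose geodesic spray is S; one global F on A can fail to exist under (ii) and (iii), since the closed 1-form d(log F) may have periods around the fibres. *)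

(* Defs.v *)
From HB Require Import structures.
From mathcomp Require Import all_boot all_order all_algebra.
From mathcomp Require Import all_classical all_reals all_analysis.

Set Implicit Arguments.
Unset Strict Implicit.
Unset Printing Implicit Defensive.

Import Order.TTheory GRing.Theory Num.Theory.
Import numFieldNormedType.Exports.

Local Open Scope classical_set_scope.
Local Open Scope ring_scope.

(* Conventions. Vectors are rows and covectors are columns, so theta(X) is
   X *m theta. An endomorphism E is the matrix with E(X) = X *m E, and a 2-form
   B the matrix with B(X, Y) = X *m B *m Y^T. The differential of f acts on
   tangent vectors by X |-> X *m 'J f z. *)

(* U is meant to be open. *)
Fixpoint Ck (R : realType) (k m : nat) (W : normedModType R)
    (U : set 'rV[R]_m) (f : 'rV[R]_m -> W) : Prop :=
  match k with
  | 0 => forall z, U z -> {for z, continuous f}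
  | k'.+1 => (forall z, U z -> differentiable f z) /\
             (forall v, Ck k' U (fun z => 'D_v f z))
  end.

Definition smooth (R : realType) (m : nat) (W : normedModType R)
  (U : set 'rV[R]_m) (f : 'rV[R]_m -> W) : Prop := forall k, Ck k U f.

(* A set with a family of R^m-valued charts; only the values of [coord a] on
   [dom a] are meaningful. The axioms of a manifold are in [manifold]. *)
Record atlas (R : realType) (m : nat) := Atlas {
  point :> Type;
  chart : Type;
  dom : chart -> set point;
  coord : chart -> point -> 'rV[R]_m
}.

Section Manifold.
Context {R : realType} {m : nat} (N : atlas R m).

Definition chart_image (A : set N) (a : chart N) : set 'rV[R]_m :=
  coord a @` (A `&` dom a).

(* The expression f o (coord a)^-1 of f in the chart a; junk off the image of
   the chart. *)
Definition local_expr (W : choiceType) (w0 : W) (f : N -> W) (a : chart N)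
  (z : 'rV[R]_m) : W := xget w0 (f @` [set p | dom a p /\ coord a p = z]).

Definition transition (a b : chart N) : 'rV[R]_m -> 'rV[R]_m :=
  local_expr 0 (coord b) a.

(* The topology of N is the one given by its charts. *)
Definition nopen (A : set N) : Prop := forall a, open (chart_image A a).

Definition manifold : Prop :=
  [/\ \bigcup_a dom (a : chart N) = setT,
      forall a p q, dom a p -> dom a q -> coord a p = coord a q -> p = q :> N,
      forall a b : chart N, open (chart_image (dom b) a) /\
        smooth (chart_image (dom b) a) (transition a b),
      forall p q : N, p <> q ->
        exists U V, [/\ nopen U, nopen V, U p, V q & U `&` V = set0] &
      exists2 C : set (chart N), countable C & \bigcup_(a in C) dom a = setT].

(* [o a p] tells whether the chart a is positively oriented at p. *)
Definition orientable : Prop :=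
  exists o : chart N -> N -> bool,
    (forall a c, nopen [set p | dom a p /\ o a p = c]) /\
    (forall a b p, dom a p -> dom b p ->
       (0 < \det ('J (transition a b) (coord a p))) = (o a p == o b p)).

(* A tangent vector at p is the family of its components in the charts around
   p; the components in the other charts are set to 0. *)
Record tangent_space (p : N) := Tangent {
  comp : chart N -> 'rV[R]_m;
  comp_out : forall a, ~ dom a p -> comp a = 0;
  comp_transition : forall a b, dom a p -> dom b p ->
    comp b = comp a *m 'J (transition a b) (coord a p)
}.

Lemma scale_out (p : N) (c : R) (v : tangent_space p) a :
  ~ dom a p -> c *: comp v a = 0.
Proof. by move=> ap; rewrite comp_out // scaler0. Qed.

Lemma scale_transition (p : N) (c : R) (v : tangent_space p) a b :
  dom a p -> dom b p ->
  c *: comp v b = c *: comp v a *m 'J (transition a b) (coord a p).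
Proof. by move=> ap bp; rewrite -scalemxAl -comp_transition. Qed.

Definition tscale (p : N) (c : R) (v : tangent_space p) : tangent_space p :=
  Tangent (@scale_out p c v) (@scale_transition p c v).

(* Tensor fields on an open set A are given by their components in each chart,
   subject to the transformation law. *)
Definition vector_field (A : set N) (X : chart N -> 'rV[R]_m -> 'rV[R]_m) :=
  (forall a, smooth (chart_image A a) (X a)) /\
  (forall a b p, A p -> dom a p -> dom b p ->
     X b (coord b p) = X a (coord a p) *m 'J (transition a b) (coord a p)).

Definition one_form (A : set N) (w : chart N -> 'rV[R]_m -> 'cV[R]_m) :=
  (forall a, smooth (chart_image A a) (w a)) /\
  (forall a b p, A p -> dom a p -> dom b p ->
     w a (coord a p) = 'J (transition a b) (coord a p) *m w b (coord b p)).

End Manifold.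

Section Calculus.
Context {R : realType} {m : nat}.
Implicit Types (f : 'rV[R]_m -> R) (X Y : 'rV[R]_m -> 'rV[R]_m)
  (w : 'rV[R]_m -> 'cV[R]_m).

Definition bracket X Y (z : 'rV[R]_m) : 'rV[R]_m :=
  'D_(X z) Y z - 'D_(Y z) X z.

Definition d0 f (z : 'rV[R]_m) : 'cV[R]_m := \col_i 'D_(delta_mx 0 i) f z.

Definition d1 w (z : 'rV[R]_m) : 'M[R]_m :=
  \matrix_(i, j) ('D_(delta_mx 0 i) w z j 0 - 'D_(delta_mx 0 j) w z i 0).

Definition wedge (u v : 'cV[R]_m) : 'M[R]_m := u *m v^T - v *m u^T.

(* Frobenius integrability of the distribution D (the row space of D z at z)
   on U: the sections of D are closed under the Lie bracket. *)
Definition involutive (U : set 'rV[R]_m) (D : 'rV[R]_m -> 'M[R]_m) : Prop :=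
  forall (W : set 'rV[R]_m) X Y, open W -> W `<=` U ->
    smooth W X -> smooth W Y ->
    (forall z, W z -> (X z <= D z)%MS) -> (forall z, W z -> (Y z <= D z)%MS) ->
    forall z, W z -> (bracket X Y z <= D z)%MS.

End Calculus.

Section TangentBundle.
Context {R : realType} {n : nat} (M : atlas R n).

Definition TM : atlas R (n + n) :=
  @Atlas R (n + n) {p : M & tangent_space p} (chart M)
    (fun a v => dom a (projT1 v))
    (fun a v => row_mx (coord a (projT1 v)) (comp (projT2 v) a)).

Definition T0M : set TM :=
  [set v | exists2 a, dom a (projT1 v) & comp (projT2 v) a != 0].

Definition dilate (c : R) (v : TM) : TM :=
  existT _ (projT1 v) (tscale c (projT2 v)).

Definition open_cone (A : set TM) : Prop :=
  [/\ A `<=` T0M, nopen A & forall v c, A v -> 0 < c -> A (dilate c v)].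

End TangentBundle.

(* A point z of R^(n + n) is the row (x, y) of induced coordinates. The coframes
   dx, delta y are given by columns and the frames d/dy, delta/delta x by rows,
   so a tensor e (x) theta is the product theta *m e. *)
Section Coordinates.
Context {R : realType} {n : nat}.
Implicit Types (S : 'rV[R]_(n + n) -> 'rV[R]_(n + n)) (z : 'rV[R]_(n + n)).

Definition dx : 'M[R]_(n + n, n) := col_mx 1%:M 0.
Definition ddy : 'M[R]_(n, n + n) := row_mx 0 1%:M.

Definition J : 'M[R]_(n + n) := dx *m ddy.

Definition liouville z : 'rV[R]_(n + n) := rsubmx z *m ddy.

Definition iJ2 (B : 'M[R]_(n + n)) : 'M[R]_(n + n) := J *m B + B *m J^T.

Definition dJ0 (f : 'rV[R]_(n + n) -> R) z : 'cV[R]_(n + n) := J *m d0 f z.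

Definition dJ1 (w : 'rV[R]_(n + n) -> 'cV[R]_(n + n)) z : 'M[R]_(n + n) :=
  iJ2 (d1 w z) - d1 (fun z => J *m w z) z.

Definition ey (i : 'I_n) : 'rV[R]_(n + n) := delta_mx 0 i *m ddy.

Section Spray.
Variable S : 'rV[R]_(n + n) -> 'rV[R]_(n + n).

(* S = y^i d/dx^i - 2 G^i d/dy^i *)
Definition G z : 'rV[R]_n := - 2^-1 *: rsubmx (S z).

(* The (i, j) entry is N^j_i. *)
Definition Nmx z : 'M[R]_n := \matrix_(i, j) 'D_(ey i) G z 0 j.

Definition deltax z : 'M[R]_(n, n + n) := row_mx 1%:M (- Nmx z).
Definition deltay z : 'M[R]_(n + n, n) := col_mx (Nmx z) 1%:M.

Definition hproj z : 'M[R]_(n + n) := dx *m deltax z.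
Definition vproj z : 'M[R]_(n + n) := deltay z *m ddy.
Definition almost_complex z : 'M[R]_(n + n) := deltay z *m deltax z - dx *m ddy.

(* Phi(X) = v [S, h X], for X running over the coordinate fields. *)
Definition jacobi z : 'M[R]_(n + n) :=
  \matrix_i (bracket S (fun z => row i (hproj z)) z *m vproj z).

(* The trace R^i_i, where Phi = R^i_j d/dy^i (x) dx^j. *)
Definition ricci z : R := \tr (ursubmx (jacobi z)).

Definition berwald z : 'M[R]_(n + n) := (hproj z + jacobi z)%MS.

Definition Omega (alpha : 'rV[R]_(n + n) -> 'cV[R]_(n + n)) z : 'M[R]_(n + n) :=
  let beta z := (ricci z)^-1 *: alpha z in
  d1 beta z + 2 *: wedge (almost_complex z *m beta z) (beta z).

End Spray.

(* g_ij = 1/2 d^2 (F^2) / dy^i dy^j *)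
Definition metric (F : 'rV[R]_(n + n) -> R) z : 'M[R]_n :=
  \matrix_(i, j) (2^-1 * 'D_(ey i) ('D_(ey j) (fun z => F z ^+ 2)) z).

End Coordinates.

Section Sprays.
Context {R : realType} {n : nat} {M : atlas R n}.
Implicit Types (A B : set (TM M))
  (S : chart (TM M) -> 'rV[R]_(n + n) -> 'rV[R]_(n + n))
  (w : chart (TM M) -> 'rV[R]_(n + n) -> 'cV[R]_(n + n)).

Definition spray A S : Prop :=
  vector_field A S /\
  (forall a z, chart_image A a z ->
     S a z *m J = liouville z /\ bracket liouville (S a) z = S a z).

Definition non_flat A S : Prop :=
  forall a z, chart_image A a z -> jacobi (S a) z != 0 /\ ricci (S a) z != 0.

Definition berwald_integrable A S : Prop :=
  forall a, involutive (chart_image A a) (berwald (S a)).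

(* The semi-basic 1-form alpha of the decomposition Phi = rho J - alpha (x) C;
   it is unique because the Liouville field vanishes nowhere on T_0 M. *)
Definition isotropy_form A S w : Prop :=
  one_form A w /\
  (forall a z, chart_image A a z ->
     [/\ J *m w a z = 0,
         jacobi (S a) z = ricci (S a) z *: J - w a z *m liouville z &
         (S a z *m w a z) 0 0 = ricci (S a) z]).

Definition regular A S : Prop :=
  exists2 alpha, isotropy_form A S alpha &
    forall a z, chart_image A a z -> \rank (Omega (S a) (alpha a) z) = (n + n)%N.

Definition in_berwald_annihilator A S w : Prop :=
  one_form A w /\
  (forall a z, chart_image A a z -> berwald (S a) z *m w a z = 0).

Definition closed_form A w : Prop :=
  forall a z, chart_image A a z -> d1 (w a) z = 0.

Definition conic_finsler B (F : TM M -> R) : Prop :=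
  [/\ forall a, smooth (chart_image B a) (local_expr 0 F a),
      forall v, B v -> 0 < F v,
      forall v c, B v -> 0 < c -> F (dilate c v) = c * F v &
      forall a z, chart_image B a z -> \rank (metric (local_expr 0 F a) z) = n].

(* i_S d d_J F^2 = - d F^2 *)
Definition geodesic_spray B S (F : TM M -> R) : Prop :=
  forall a z, chart_image B a z ->
    let L z := local_expr 0 F a z ^+ 2 in
    (S a z *m d1 (dJ0 L) z)^T = - d0 L z.

(* Existence of the Finsler function is understood near each direction, on a
   conic neighbourhood: even for A = T_0 M and M a disc, a function F which is
   only defined up to positive constants when continued around the circle of
   directions of a fibre has a well-defined geodesic spray on A. *)
Definition finsler_metrizable A S : Prop :=
  forall v, A v -> exists B, [/\ open_cone B, B v, B `<=` A &
    exists2 F, conic_finsler B F & geodesic_spray B S F].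

End Sprays.

(* Main.v *)
(* Write Phi = rho (J - (alpha / rho) (x) C), let b_i be the components of the
   semi-basic form alpha / rho and omega = i_F (alpha / rho) = b_i delta y^i. The
   annihilator of D is the line spanned by omega, and omega(C) = 1. Each of the
   three conditions amounts to: omega is closed and the matrix
   d b / d y + 2 b b^T is invertible.

   If F is a Finsler function with geodesic spray S, then d F^2 vanishes on
   horizontal vectors, hence, by differentiating along S, on the image of Phi, so
   that omega = d log F and F^2 (d b / d y + 2 b b^T) is the metric. Conversely, a
   closed omega has a primitive log F on a convex cone around any direction, by
   the Poincare lemma, and omega(C) = 1 makes F homogeneous.

   Since omega(C) = 1 and L_C omega = 0, i_C d omega = 0, so that D, the kernel of
   omega, is involutive if and only if omega is closed. The 2-form Omega has the
   block form [[*, -Q^T], [Q, 0]] with Q = d b / d y + 2 b b^T, so it has rank 4 if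
   and only if Q is invertible. The same holds in (iii), where a form in D* is
   f omega and Q is replaced by f (d b / d y + b b^T) + s b^T for some column s;
   there rank 4 forces f <> 0. *)

Require Import Defs.
From HB Require Import structures.
From mathcomp Require Import all_boot all_order all_algebra.
From mathcomp Require Import ring lra.
From mathcomp Require Import all_classical all_reals all_analysis.

Set Implicit Arguments.
Unset Strict Implicit.
Unset Printing Implicit Defensive.

Import Order.TTheory GRing.Theory Num.Theory.
Import numFieldNormedType.Exports.

Local Open Scope classical_set_scope.
Local Open Scope ring_scope.

(** * Calculus on open subsets of R^m *)

(** All homogeneity comes from [C, S] = S. Commuting C with derivatives gives G, N and the curvature
    the degrees 2, 1 and 2, hence b the degree -1, which is the source of L_C omega = 0. The
    identity Phi(S) = 0 reads y = (y b) y, and y is nonzero on a cone, whence omega(C) = 1. The form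
    f omega of (iii) is not assumed homogeneous and its factor f is not constant, so its closedness
    says nothing directly about d omega. What passes from one to the other is the common kernel: f
    omega closed makes D involutive, and that makes omega closed. For a Finsler function, the
    vanishing of d F^2 on horizontal vectors rests on S(F^2) = 0: differentiating this vertically
    and comparing with the classical Euler-Lagrange equations leaves twice the horizontal
    derivative. Conditions (ii) and (iii) ask for forms on A, whereas b is built chart by chart.
    Differentiating S' o T = S dT along a transition map T yields the laws for N, the adapted frames
    and the curvature; the law for b follows since b is determined by the curvature. *)

Section Differentiability.
Context {R : realType} {V : normedModType R}.

Lemma near_eq_open (T : Type) (U : set V) (f g : V -> T) z :
  open U -> U z -> (forall x, U x -> f x = g x) -> \near z, f z = g z.
Proof. by move=> oU Uz fg; apply: filterS (open_nbhs_nbhs (conj oU Uz)). Qed.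

Lemma derive_ext (W : normedModType R) (U : set V) (f g : V -> W) v z :
  open U -> U z -> (forall x, U x -> f x = g x) -> 'D_v f z = 'D_v g z.
Proof. by move=> oU Uz fg; apply: near_eq_derive; apply: near_eq_open oU Uz fg. Qed.

Lemma near0_shift (A : set V) z : nbhs z A -> \forall h \near 0, A (h + z).
Proof.
move=> Az; have : h + z @[h --> (0 : V)] --> 0 + z.
  by apply: cvgD; [exact: cvg_id|exact: cvg_cst].
by rewrite add0r; apply.
Qed.

(** Differentiability in epsilon form. In this form it can be moved between functions that agree
    only near z, and deduced from continuous partial derivatives. *)
Lemma is_diff_littleo (W : normedModType R) (f : V -> W) (L : {linear V -> W}) z :
  continuous L ->
  (forall e, 0 < e -> \forall h \near 0, `|f (h + z) - f z - L h| <= e * `|h|) ->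
  differentiable f z /\ 'd f z = L :> (V -> W).
Proof.
move=> cL fL.
have fo : f \o shift z = cst (f z) + L +o_ 0 id.
  apply/eqaddoP => e e0; near=> h.
  rewrite !fctE opprD addrA /=.
  by near: h; apply: fL.
have dL := diff_unique cL fo.
by split=> //; apply/diff_locallyP; rewrite dL.
Unshelve. all: by end_near. Qed.

Lemma diff_littleo (W : normedModType R) (f : V -> W) z e :
  differentiable f z -> 0 < e ->
  \forall h \near 0, `|f (h + z) - f z - 'd f z h| <= e * `|h|.
Proof.
move=> df e0; have /eqaddoP/(_ e e0) := diff_locally df.
by apply: filterS => h; rewrite !fctE opprD addrA.
Qed.

Lemma differentiable_ext (W : normedModType R) (U : set V) (f g : V -> W) z :
  open U -> U z -> (forall x, U x -> f x = g x) ->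
  differentiable f z -> differentiable g z.
Proof.
move=> oU Uz fg df.
suff /(is_diff_littleo (diff_continuous df))[] : forall e, 0 < e ->
  \forall h \near 0, `|g (h + z) - g z - 'd f z h| <= e * `|h| by [].
move=> e e0.
have Uh : \forall h \near 0, U (h + z) by apply/near0_shift/open_nbhs_nbhs.
near=> h; rewrite -!fg//; first by near: h; apply: diff_littleo.
by near: h; apply: Uh.
Unshelve. all: by end_near. Qed.

Lemma derive_coord p q (M : V -> 'M[R]_(p, q)) v z i j :
  differentiable M z -> ('D_v M z) i j = 'D_v (fun t => M t i j) z.
Proof. by move=> dM; rewrite derive_mx ?mxE//; apply: diff_derivable. Qed.

Lemma differentiable_entry p q (M : V -> 'M[R]_(p, q)) z i j :
  differentiable M z -> differentiable (fun t => M t i j) z.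
Proof. by move=> dM; apply: (differentiable_comp dM (differentiable_coord _ _ _)). Qed.

Lemma differentiable_mx p q (M : V -> 'M[R]_(p, q)) z :
  (forall i j, differentiable (fun t => M t i j) z) -> differentiable M z.
Proof.
move=> dM.
have -> : M = \sum_(i < p) (\sum_(j < q) (fun t => M t i j *: delta_mx i j)).
  apply/funext => t; rewrite {1}[M t]matrix_sum_delta fct_sumE.
  by apply: eq_bigr => i _; rewrite fct_sumE.
apply: differentiable_sum => i; apply: differentiable_sum => j.
by apply: differentiableZl.
Qed.

Lemma derive_comp (V' W : normedModType R) (g : V -> V') (f : V' -> W) v z :
  differentiable g z -> differentiable f (g z) ->
  'D_v (f \o g) z = 'D_('D_v g z) f (g z).
Proof.
by move=> dg df; rewrite !deriveE//; [rewrite diff_comp|apply: differentiable_comp].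
Qed.

End Differentiability.

(** * Closure properties of the classes C^k *)

Section Smooth.
Context {R : realType} {m : nat}.
Implicit Types (U : set 'rV[R]_m) (k : nat).

(** Derivative rules hold only at points of U, where differentiability is known. Each closure proof
    below therefore writes the derivative as a C^k expression on U and transfers regularity by this
    lemma. *)
Lemma Ck_ext k (W : normedModType R) U (f g : 'rV[R]_m -> W) :
  open U -> (forall z, U z -> f z = g z) -> Ck k U f -> Ck k U g.
Proof.
move=> oU; elim: k f g => [|k IH] f g fg /=.
  move=> cf z Uz.
  rewrite /prop_for /continuous_at -(fg z Uz); apply: cvg_trans (cf z Uz).
  apply: (@near_eq_cvg _ _ _ (nbhs_filter z)).
  exact: near_eq_open oU Uz fg.
move=> [df Df]; split=> [z Uz|v]; first exact: differentiable_ext oU Uz fg (df z Uz).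
apply: IH (Df v) => z Uz; exact: derive_ext oU Uz fg.
Qed.

Lemma CkW k (W : normedModType R) U (f : 'rV[R]_m -> W) : Ck k.+1 U f -> Ck k U f.
Proof.
elim: k f => [|k IH] f [df Df].
  by move=> z Uz; apply/differentiable_continuous/df.
by split=> // v; apply: IH.
Qed.

Lemma Ck_cst k (W : normedModType R) U (c : W) : Ck k U (fun=> c).
Proof.
elim: k c => [|k IH] c /=; first by move=> z _; exact: cst_continuous.
split=> [z _|v]; first exact: differentiable_cst.
by have -> : (fun z : 'rV[R]_m => 'D_v (fun=> c) z) = fun=> 0
  by apply/funext => z; rewrite derive_cst.
Qed.

Lemma Ck_id k U : Ck k U (fun z => z).
Proof.
case: k => [|k] /=; first by move=> z _; exact: cvg_id.
split=> [z _|v]; first exact: ex_diff.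
by have -> : (fun z : 'rV[R]_m => 'D_v (fun z => z) z) = fun=> v;
  [apply/funext => z; rewrite derive_id|exact: Ck_cst].
Qed.

Lemma CkD k (W : normedModType R) U (f g : 'rV[R]_m -> W) :
  open U -> Ck k U f -> Ck k U g -> Ck k U (fun z => f z + g z).
Proof.
move=> oU; elim: k f g => [|k IH] f g /=.
  by move=> cf cg z Uz; apply: continuousD; [exact: cf|exact: cg].
move=> [df Df] [dg Dg]; split=> [z Uz|v].
  by apply: differentiableD; [exact: df|exact: dg].
apply: Ck_ext oU _ (IH _ _ (Df v) (Dg v)) => z Uz.
by rewrite -deriveD//; apply/diff_derivable; [exact: df|exact: dg].
Qed.

Lemma CkM k U (f g : 'rV[R]_m -> R) :
  open U -> Ck k U f -> Ck k U g -> Ck k U (fun z => f z * g z).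
Proof.
move=> oU; elim: k f g => [|k IH] f g cf cg.
  by move=> z Uz; apply: continuousM; [exact: cf|exact: cg].
have cf' := CkW cf; have cg' := CkW cg.
move: cf cg => [df Df] [dg Dg]; split=> [z Uz|v].
  by apply: differentiableM; [exact: df|exact: dg].
apply: Ck_ext oU _ (CkD oU (IH _ _ cf' (Dg v)) (IH _ _ cg' (Df v))) => z Uz.
by rewrite deriveM//; apply/diff_derivable; [exact: df|exact: dg].
Qed.

Lemma Ck_mxP k p q U (f : 'rV[R]_m -> 'M[R]_(p, q)) : open U ->
  Ck k U f <-> forall i j, Ck k U (fun z => f z i j).
Proof.
move=> oU; elim: k f => [|k IH] f; split.
- move=> cf i j z Uz; exact: (@continuous_comp _ _ _ f (fun N : 'M[R]_(p, q) => N i j) z (cf z Uz)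
    (@coord_continuous _ _ _ _ _ _)).
- move=> cf z Uz.
  have -> : f = \sum_(i < p) (\sum_(j < q) (fun t => f t i j *: delta_mx i j)).
    apply/funext => t; rewrite {1}[f t]matrix_sum_delta fct_sumE.
    by apply: eq_bigr => i _; rewrite fct_sumE.
  apply: (@big_ind _ (fun h => {for z, continuous h})) => [|a b ca cb|i _].
  + exact: cst_continuous.
  + exact: continuousD.
  apply: (@big_ind _ (fun h => {for z, continuous h})) => [|a b ca cb|j _].
  + exact: cst_continuous.
  + exact: continuousD.
  exact: (@continuous_comp _ _ _ (fun z => f z i j)
    (fun x : R => x *: (delta_mx i j : 'M[R]_(p, q))) z (cf i j z Uz)
    (@scalel_continuous _ _ _ _)).
- move=> [df Df] i j; split=> [z Uz|v]; first exact/differentiable_entry/df.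
  apply: Ck_ext oU _ ((IH _).1 (Df v) i j) => z Uz.
  by rewrite derive_coord//; apply: df.
- move=> cf; have df z : U z -> differentiable f z.
    by move=> Uz; apply: differentiable_mx => i j; apply: (cf i j).1.
  split=> // v; apply/IH => i j; apply: Ck_ext oU _ ((cf i j).2 v) => z Uz.
  by rewrite derive_coord//; apply: df.
Qed.

Lemma Ck_sum k (W : normedModType R) (I : Type) (r : seq I) (P : pred I) U
    (f : I -> 'rV[R]_m -> W) : open U ->
  (forall i, P i -> Ck k U (f i)) -> Ck k U (fun z => \sum_(i <- r | P i) f i z).
Proof.
move=> oU cf; elim: r => [|i r IH].
  by have -> : (fun z => \sum_(i <- [::] | P i) f i z) = (fun=> 0);
    [apply/funext => z; rewrite big_nil|exact: Ck_cst].
case Pi: (P i).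
  have -> : (fun z => \sum_(i <- i :: r | P i) f i z) =
            (fun z => f i z + \sum_(i <- r | P i) f i z).
    by apply/funext => z; rewrite big_cons Pi.
  by apply: CkD => //; apply: cf.
have -> : (fun z => \sum_(i <- i :: r | P i) f i z) =
          (fun z => \sum_(i <- r | P i) f i z).
  by apply/funext => z; rewrite big_cons Pi.
exact: IH.
Qed.

Lemma Ck_mulmx k p q r U (f : 'rV[R]_m -> 'M[R]_(p, q)) (g : 'rV[R]_m -> 'M[R]_(q, r)) :
  open U -> Ck k U f -> Ck k U g -> Ck k U (fun z => f z *m g z).
Proof.
move=> oU /(Ck_mxP _ _ oU) cf /(Ck_mxP _ _ oU) cg; apply/(Ck_mxP _ _ oU) => i j.
have -> : (fun z => (f z *m g z) i j) = (fun z => \sum_k f z i k * g z k j).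
  by apply/funext => z; rewrite mxE.
by apply: Ck_sum => // l _; apply: CkM.
Qed.

Lemma CkV k U (f : 'rV[R]_m -> R) : open U -> (forall z, U z -> f z != 0) ->
  Ck k U f -> Ck k U (fun z => (f z)^-1).
Proof.
move=> oU f0; elim: k => [|k IH] cf.
  by move=> z Uz; apply: continuousV; [exact: f0|exact: cf].
have cV := IH (CkW cf); case: cf => df Df; split=> [z Uz|v].
  by apply: differentiableV; [exact: df|exact: f0].
(* The derivative of 1/f is - f^-2 f'; written with the product of two inverses, its first factor is
   covered by the induction hypothesis. *)
have cN : Ck k U (fun z => -1 * ((f z)^-1 * (f z)^-1)).
  by apply: CkM; [|exact: Ck_cst|exact: CkM].
apply: Ck_ext oU _ (CkM oU cN (Df v)) => z Uz.
rewrite deriveV; [|exact: f0|exact/diff_derivable/df].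
by rewrite /GRing.scale /= mulN1r expr2 invfM.
Qed.

Lemma Ck_comp k p U (O : set 'rV[R]_p) (g : 'rV[R]_m -> 'rV[R]_p) (f : 'rV[R]_p -> R) :
  open U -> open O -> (forall z, U z -> O (g z)) -> Ck k U g -> Ck k O f ->
  Ck k U (fun z => f (g z)).
Proof.
move=> oU oO gO; elim: k f => [|k IH] f cg cf.
  by move=> z Uz; apply: (continuous_comp (cg z Uz)); apply/cf/gO.
have cg' := CkW cg; case: cg cf => dg Dg [df Df].
split=> [z Uz|v].
  by apply: (differentiable_comp (dg z Uz)); apply/df/gO.
(* The chain rule gives a derivative of f in the moving direction ['D_v g z], while [Ck] speaks of
   fixed directions only; hence the expansion along the basis. *)
have cS : Ck k U (fun z => \sum_i 'D_v g z 0 i * 'D_(delta_mx 0 i) f (g z)).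
  apply: Ck_sum => // i _; apply: CkM => //; first exact: ((Ck_mxP _ _ oU).1 (Dg v) 0 i).
  by apply: IH cg' (Df _).
apply: Ck_ext oU _ cS => z Uz.
have dfg := df _ (gO _ Uz).
rewrite (derive_comp v (dg z Uz) dfg) (deriveE _ dfg) [in RHS](row_sum_delta ('D_v g z)).
rewrite linear_sum; apply: eq_bigr => i _.
by rewrite linearZ /= -deriveE.
Qed.

End Smooth.

Lemma is_derive_line (R : realType) (V W : normedModType R) (f : V -> W) x u (s : R) df :
  is_derive (x + s *: u) u f df -> is_derive s 1 (fun t : R => f (x + t *: u)) df.
Proof.
have E : (fun h : R => h^-1 *: (f (x + (h *: (1 : R) + s) *: u) - f (x + s *: u))) =
         (fun h : R => h^-1 *: (f (h *: u + (x + s *: u)) - f (x + s *: u))).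
  by apply/funext => h; rewrite [h *: _]mulr1 scalerDl addrCA.
by case=> dl <-; split; [rewrite /derivable /= E|rewrite /derive /= E].
Qed.

(** * Symmetry of second derivatives *)

Section Schwarz.
Context {R : realType} {m : nat}.
Implicit Types (U : set 'rV[R]_m) (f : 'rV[R]_m -> R).

Lemma is_derive_MVT (g dg : R -> R) (h : R) : 0 < h ->
  (forall s, 0 <= s <= h -> is_derive s 1 g (dg s)) ->
  exists2 c, 0 <= c <= h & g h - g 0 = h * dg c.
Proof.
move=> h0 dgE.
have [| |c] := @MVT R g dg 0 h h0.
- by move=> x; rewrite in_itv /= => /andP[x0 xh]; apply: dgE; rewrite !ltW.
- apply: derivable_within_continuous => x; rewrite in_itv /= => x0h.
  exact: (@ex_derive _ _ _ _ _ _ _ (dgE x x0h)).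
rewrite in_itv /= => /andP[c0 ch] gE; exists c; first by rewrite !ltW.
by rewrite gE subr0 mulrC.
Qed.

(** Two uses of the mean value theorem: in direction u for the increment of f along h v, then in
    direction v for the resulting value of ['D_u f]. *)
Lemma second_difference U f z u v (h : R) : 0 < h -> Ck 2 U f ->
  (forall s t, 0 <= s <= h -> 0 <= t <= h -> U (z + s *: u + t *: v)) ->
  exists s t, [/\ 0 <= s <= h, 0 <= t <= h &
    f (z + h *: u + h *: v) - f (z + h *: u) - (f (z + h *: v) - f z) =
    h ^+ 2 * 'D_v (fun x => 'D_u f x) (z + s *: u + t *: v)].
Proof.
move=> h0 [df Df] Uh; have [dDf _] := Df u.
have h00 : 0 <= (0 : R) <= h by apply/andP; split=> //; apply: ltW.
have hh : 0 <= h <= h by rewrite lexx andbT ltW.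
have [|s sh] := is_derive_MVT (g := fun s => f (z + h *: v + s *: u) - f (z + s *: u))
  (dg := fun s => 'D_u f (z + h *: v + s *: u) - 'D_u f (z + s *: u)) h0.
  move=> s sh; apply: is_deriveB; apply: is_derive_line; apply/derivableP/diff_derivable/df.
    by rewrite addrAC; apply: Uh.
  by have := Uh s 0 sh h00; rewrite scale0r addr0.
have [|t th] := is_derive_MVT (g := fun t => 'D_u f (z + s *: u + t *: v))
  (dg := fun t => 'D_v (fun x => 'D_u f x) (z + s *: u + t *: v)) h0.
  move=> t th; apply: (is_derive_line (f := fun x => 'D_u f x)).
  exact/derivableP/diff_derivable/dDf/Uh.
rewrite !scale0r !addr0 [z + h *: v + s *: u]addrAC [z + h *: v + h *: u]addrAC => E1 E2.
exists s, t; split=> //.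
by rewrite E2 E1 mulrA expr2.
Qed.

(** The double difference is symmetric in u and v, so both mixed derivatives agree at two nearby
    points; their continuity at z brings the values at z within any e. *)
Lemma derive_sym U f z u v : open U -> Ck 2 U f -> U z ->
  'D_u (fun x => 'D_v f x) z = 'D_v (fun x => 'D_u f x) z.
Proof.
move=> oU cf Uz; have [df Df] := cf.
have cD a b : {for z, continuous (fun x => 'D_a (fun y => 'D_b f y) x)}.
  by have [_ /(_ a)] := Df b; apply.
apply/eqP; rewrite -subr_eq0 -normr_eq0; apply/eqP/le_anti/andP; split=> //.
apply/ler_addgt0Pl => e e0; rewrite addr0.
have e2 : 0 < e / 2 by rewrite divr_gt0.
have /cvgrPdist_le/(_ _ e2) nuv := cD u v.
have /cvgrPdist_le/(_ _ e2) nvu := cD v u.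
have nU := open_nbhs_nbhs (conj oU Uz).
have Fz := nbhs_filter z.
have nB := @filterI _ _ Fz _ _ nU (@filterI _ _ Fz _ _ nuv nvu).
have [d /= d0 db] := (nbhs_ballP z _).1 nB.
pose c := `|u| + `|v| + 1.
have c0 : 0 < c by rewrite /c ltr_wpDl// addr_ge0.
(* With this h, h (|u| + |v|) < d, so the whole parallelogram stays in the ball of radius d. *)
pose h := d / (2 * c).
have h0 : 0 < h by rewrite /h divr_gt0// mulr_gt0.
have Bz s t : 0 <= s <= h -> 0 <= t <= h -> ball z d (z + s *: u + t *: v).
  move=> /andP[s0 sh] /andP[t0 th]; rewrite -ball_normE /= -addrA opprD addNKr normrN.
  rewrite (le_lt_trans (ler_normD _ _))// !normrZ !ger0_norm//.
  apply: (@le_lt_trans _ _ (h * c)).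
    by rewrite /c !mulrDr mulr1 -[leLHS]addr0 lerD ?lerD ?ler_wpM2r// ltW.
  rewrite /h invfM mulrA divfK ?gt_eqF//; lra.
have [s [t [sh th E1]]] := second_difference h0 cf (fun s t sh th => (db _ (Bz s t sh th)).1).
have Bz' s' t' : 0 <= s' <= h -> 0 <= t' <= h -> ball z d (z + s' *: v + t' *: u).
  by move=> ? ?; rewrite addrAC; apply: Bz.
have [s' [t' [sh' th' E2]]] := second_difference h0 cf (fun s t sh th => (db _ (Bz' s t sh th)).1).
have E : 'D_v (fun x => 'D_u f x) (z + s *: u + t *: v) =
         'D_u (fun x => 'D_v f x) (z + s' *: v + t' *: u).
  apply: (mulfI (lt0r_neq0 (exprn_gt0 2 h0))); apply: etrans (esym E1) (etrans _ E2).
  by rewrite [z + h *: v + h *: u]addrAC !opprB addrACA [RHS]addrACA [- _ - _]addrC.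
have [_ [_ n1]] := db _ (Bz s t sh th).
have [_ [n2 _]] := db _ (Bz' s' t' sh' th').
rewrite E in n1; apply: (le_trans (ler_distD _ _ _)); rewrite [leRHS](splitr e).
by apply: lerD n2 _; rewrite distrC.
Qed.

End Schwarz.

(** * Integrals over the unit interval with a parameter *)

Section UnitIntegral.
Context {R : realType}.
Let mu : {measure set (measurableTypeR R) -> \bar R} := @lebesgue_measure R.
Implicit Types (f g : R -> R).

Definition integral01 (f : R -> R) : R := (\int[@lebesgue_measure R]_(t in `[0%R, 1%R]) f t)%R.

Lemma integral01_derive f g :
  (forall t : R, 0 <= t <= 1 -> is_derive t 1 f (g t)) ->
  (forall t : R, 0 <= t <= 1 -> {for t, continuous g}) ->
  integral01 g = f 1 - f 0.
Proof.
move=> dfg cg.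
have cf t : 0 <= t <= 1 -> {for t, continuous f}.
  move=> t01; apply/differentiable_continuous/derivable1_diffP.
  exact: (@ex_derive _ _ _ _ _ _ _ (dfg t t01)).
rewrite /integral01 /Rintegral (@continuous_FTC2 _ g f 0 1) //=.
- apply: continuous_in_subspaceT => t; rewrite inE /= in_itv /=; exact: cg.
- split.
  + move=> t; rewrite in_itv /= => /andP[t0 t1].
    by apply: (@ex_derive _ _ _ _ _ _ _ (dfg t _)); rewrite !ltW.
  + by apply/cvg_at_right_filter/cf; rewrite lexx ler01.
  + by apply/cvg_at_left_filter/cf; rewrite lexx ler01.
- move=> t; rewrite in_itv /= => /andP[t0 t1].
  by rewrite derive1E; apply: (@derive_val _ _ _ _ _ _ _ (dfg t _)); rewrite !ltW.
Qed.

(** Differentiation under the integral sign; the dominating function is the constant maximum of |dg|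
    on the compact rectangle. *)
Lemma integral01_derive_param (g dg : R -> R -> R) (d : R) : 0 < d ->
  (forall s t : R, - d <= s <= d -> 0 <= t <= 1 ->
     is_derive s 1 (fun s => g s t) (dg s t)) ->
  (forall s t : R, - d <= s <= d -> 0 <= t <= 1 ->
     {for (s, t), continuous (fun p : R * R => dg p.1 p.2)}) ->
  (forall s t : R, - d <= s <= d -> 0 <= t <= 1 -> {for t, continuous (g s)}) ->
  is_derive (0 : R) (1 : R) (fun s : R => integral01 (g s)) (integral01 (dg 0)).
Proof.
move=> d0 gdg cdg cg.
pose K : set (R * R) := `[- d, d] `*` `[0, 1].
have cK : compact K by apply: compact_setX; apply: segment_compact.
have K0 : K !=set0.
  by exists (0, 0); split; rewrite /= in_itv /= ?lexx ?ler01 // oppr_le0 ltW ?ltW.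
have ck : {within K, continuous (fun p : R * R => `|dg p.1 p.2|)}.
  apply: continuous_in_subspaceT => -[s t]; rewrite inE /K /= !in_itv /= => -[sd t1].
  by apply: (@cvg_norm _ _ _ _ _ (fun p : R * R => dg p.1 p.2)); apply: cdg.
have [c _ cmax] := compact_EVT_max K0 cK ck.
pose G (t : measurableTypeR R) : R := `|dg c.1 c.2|.
have dI x : `]- d, d[%classic x -> - d <= x <= d.
  by rewrite /= in_itv /= => /andP[? ?]; rewrite !ltW.
have tI x : `[0, 1]%classic x -> 0 <= x <= 1 by rewrite /= in_itv.
have dg1 x y : `]- d, d[%classic x -> `[0, 1]%classic y -> partial1of2 g x y = dg x y.
  move=> /dI xd /tI y1; rewrite partial1of2E.
  exact: (@derive_val _ _ _ _ _ _ _ (gdg x y xd y1)).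
have I0 : `]- d, d[%classic 0 by rewrite /= in_itv /= oppr_lt0 d0.
have mB : measurable (`[0, 1]%classic : set (measurableTypeR R)) by exact: measurable_itv.
have H1 x : `]- d, d[%classic x -> mu.-integrable `[0, 1] (EFin \o g x).
  move=> /dI xd; apply: continuous_compact_integrable; first exact: segment_compact.
  by apply: continuous_in_subspaceT => t; rewrite inE /= in_itv /=; apply: cg.
have H2 x y : `]- d, d[%classic x -> `[0, 1]%classic y -> derivable (g ^~ y) x 1.
  by move=> /dI xd /tI y1; apply: (@ex_derive _ _ _ _ _ _ _ (gdg x y xd y1)).
have H3 y : 0 <= G y by exact: normr_ge0.
have H4 : mu.-integrable `[0, 1] (EFin \o G).
  apply: continuous_compact_integrable; first exact: segment_compact.
  by apply: continuous_subspaceT => t; exact: cst_continuous.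
have H5 x y : `]- d, d[%classic x -> `[0, 1]%classic y -> `|partial1of2 g x y| <= G y.
  move=> xd y1; rewrite dg1//; apply: (cmax (x, y)).
  by rewrite inE; split => //=; rewrite in_itv /=; apply: dI.
have D1 := derivable_under_integral mB I0 H1 H2 H3 H4 H5.
have D2 := differentiation_under_integral mB I0 H1 H2 H3 H4 H5.
apply: DeriveDef; first exact: D1.
rewrite derive1E in D2; apply: (etrans D2).
by apply: eq_Rintegral => y; rewrite inE => y1; apply: dg1.
Qed.

End UnitIntegral.

(** * Derivatives of matrix-valued maps *)

Section MatrixDerivatives.
Context {R : realType} {V : normedModType R}.
Implicit Types (z v : V).

Lemma is_derive_unique (W : normedModType R) (f : V -> W) z v a b :
  is_derive z v f a -> is_derive z v f b -> a = b.
Proof. by move=> [_ <-] [_ <-]. Qed.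

Lemma is_derive_ext (W : normedModType R) (U : set V) (f g : V -> W) z v df :
  open U -> U z -> (forall x, U x -> f x = g x) ->
  is_derive z v f df -> is_derive z v g df.
Proof. by move=> oU Uz fg; apply: near_eq_is_derive; exact: near_eq_open oU Uz fg. Qed.

Lemma is_derive_entry p q (f : V -> 'M[R]_(p, q)) z v (df : 'M[R]_(p, q)) i j :
  is_derive z v f df -> is_derive z v (fun x => f x i j) (df i j).
Proof.
case=> Df <-; split; first by move/derivable_mxP: Df; apply.
by rewrite (derive_mx Df) mxE.
Qed.

Lemma is_derive_mxP p q (f : V -> 'M[R]_(p, q)) z v (df : 'M[R]_(p, q)) :
  (forall i j, is_derive z v (fun x => f x i j) (df i j)) -> is_derive z v f df.
Proof.
move=> Df; have dM : derivable f z v.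
  by apply/derivable_mxP => i j; apply: (@ex_derive _ _ _ _ _ _ _ (Df i j)).
split=> //; rewrite (derive_mx dM); apply/matrixP => i j; rewrite mxE.
exact: (@derive_val _ _ _ _ _ _ _ (Df i j)).
Qed.

Lemma is_derive_add (W : normedModType R) (f g : V -> W) z v df dg :
  is_derive z v f df -> is_derive z v g dg ->
  is_derive z v (fun x => f x + g x) (df + dg).
Proof. exact: is_deriveD. Qed.

Lemma is_derive_sub (W : normedModType R) (f g : V -> W) z v df dg :
  is_derive z v f df -> is_derive z v g dg ->
  is_derive z v (fun x => f x - g x) (df - dg).
Proof. exact: is_deriveB. Qed.

Lemma is_derive_mul (f g : V -> R) z v df dg :
  is_derive z v f df -> is_derive z v g dg ->
  is_derive z v (fun x => f x * g x) (df * g z + f z * dg).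
Proof.
move=> Df Dg; apply: (is_derive_eq (is_deriveM Df Dg)).
by rewrite addrC [g z *: df]mulrC.
Qed.

Lemma is_derive_sumf (W : normedModType R) (I : Type) (r : seq I) (f : I -> V -> W) z v df :
  (forall i, is_derive z v (f i) (df i)) ->
  is_derive z v (fun x => \sum_(i <- r) f i x) (\sum_(i <- r) df i).
Proof.
move=> Df; elim: r => [|i r IH].
  have -> : (fun x => \sum_(i <- [::]) f i x) = cst 0 by apply/funext => x; rewrite big_nil.
  by rewrite big_nil; exact: is_derive_cst.
have -> : (fun x => \sum_(j <- i :: r) f j x) = (fun x => f i x + \sum_(j <- r) f j x).
  by apply/funext => x; rewrite big_cons.
by rewrite big_cons; apply: is_derive_add.
Qed.

Lemma is_derive_mulmx p q r (f : V -> 'M[R]_(p, q)) (g : V -> 'M[R]_(q, r)) z v df dg :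
  is_derive z v f df -> is_derive z v g dg ->
  is_derive z v (fun x => f x *m g x) (df *m g z + f z *m dg).
Proof.
move=> Df Dg; apply: is_derive_mxP => i j.
have -> : (fun x => (f x *m g x) i j) = (fun x => \sum_k f x i k * g x k j).
  by apply/funext => x; rewrite mxE.
rewrite !mxE -big_split /=; apply: is_derive_sumf => k.
by apply: is_derive_mul; apply: is_derive_entry.
Qed.

Lemma is_derive_mulmxr p q r (f : V -> 'M[R]_(p, q)) (A : 'M[R]_(q, r)) z v df :
  is_derive z v f df -> is_derive z v (fun x => f x *m A) (df *m A).
Proof.
move=> Df; apply: (is_derive_eq (is_derive_mulmx Df (is_derive_cst A z v))).
by rewrite mulmx0 addr0.
Qed.

Lemma is_derive_mulmxl p q r (f : V -> 'M[R]_(p, q)) (A : 'M[R]_(r, p)) z v df :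
  is_derive z v f df -> is_derive z v (fun x => A *m f x) (A *m df).
Proof.
move=> Df; apply: (is_derive_eq (is_derive_mulmx (is_derive_cst A z v) Df)).
by rewrite mul0mx add0r.
Qed.

Lemma is_derive_scale p q (c : V -> R) (f : V -> 'M[R]_(p, q)) z v dc df :
  is_derive z v c dc -> is_derive z v f df ->
  is_derive z v (fun x => c x *: f x) (dc *: f z + c z *: df).
Proof.
move=> Dc Df; apply: is_derive_mxP => i j.
have -> : (fun x => (c x *: f x) i j) = (fun x => c x * f x i j).
  by apply/funext => x; rewrite mxE.
by rewrite !mxE; apply: is_derive_mul => //; apply: is_derive_entry.
Qed.

Lemma is_derive_trace p (f : V -> 'M[R]_p) z v df :
  is_derive z v f df -> is_derive z v (fun x => \tr (f x)) (\tr df).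
Proof. by move=> D; apply: is_derive_sumf => i; apply: is_derive_entry. Qed.

Lemma is_derive_scalar1 (f : V -> R) z v df :
  is_derive z v f df -> is_derive z v (fun x => (f x)%:M : 'M[R]_1) df%:M.
Proof.
move=> D; apply: is_derive_mxP => i j; rewrite !ord1 mxE eqxx mulr1n.
by have -> : (fun x => ((f x)%:M : 'M[R]_1) 0 0) = f by apply/funext => x; rewrite mxE eqxx.
Qed.

End MatrixDerivatives.

Lemma trmx11 (T : Type) (A : 'M[T]_1) : A^T = A.
Proof. by apply/matrixP => i j; rewrite !ord1 mxE. Qed.

(** * The Poincare lemma on convex sets *)

Section Poincare.
Context {R : realType} {m : nat}.
Implicit Types (U : set 'rV[R]_m) (w : 'rV[R]_m -> 'cV[R]_m).

Lemma continuous_mulmx (T : topologicalType) p q r (f : T -> 'M[R]_(p, q))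
    (g : T -> 'M[R]_(q, r)) i j t :
  {for t, continuous f} -> {for t, continuous g} ->
  {for t, continuous (fun x => (f x *m g x) i j)}.
Proof.
move=> cf cg.
have -> : (fun x => (f x *m g x) i j) = (fun x => \sum_k f x i k * g x k j).
  by apply/funext => x; rewrite mxE.
have ce p' q' (h : T -> 'M[R]_(p', q')) i' j' : {for t, continuous h} ->
    {for t, continuous (fun x => h x i' j')}.
  move=> ch; exact: (@continuous_comp _ _ _ h (fun N : 'M[R]_(p', q') => N i' j') t ch
    (@coord_continuous _ _ _ _ _ _)).
have -> : (fun x => \sum_k f x i k * g x k j) = \sum_k (fun x => f x i k * g x k j).
  by apply/funext => x; rewrite fct_sumE.
apply: (@big_ind _ (fun h => {for t, continuous h})) => [|a b ca cb|k _].
- exact: cst_continuous.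
- exact: continuousD.
- by apply: continuousM; apply: ce.
Qed.

Lemma derive_rows p (w : 'rV[R]_m -> 'cV[R]_p) z u : differentiable w z ->
  'D_u w z = (u *m \matrix_(i, j) 'D_(delta_mx 0 i) w z j 0)^T.
Proof.
move=> dw; rewrite (deriveE _ dw) {1}(row_sum_delta u) linear_sum.
apply/matrixP => j k; rewrite (ord1 k) summxE !mxE; apply: eq_bigr => i _.
by rewrite linearZ /= !mxE -deriveE.
Qed.

(** The invariant formula for the exterior derivative, applied to the constant fields u and v, whose
    bracket vanishes. *)
Lemma d1E w z u v : differentiable w z ->
  u *m d1 w z *m v^T = v *m 'D_u w z - u *m 'D_v w z.
Proof.
move=> dw; rewrite !derive_rows//; set D := \matrix_(i, j) 'D_(delta_mx 0 i) w z j 0.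
have -> : d1 w z = D - D^T by apply/matrixP => i j; rewrite !mxE.
rewrite mulmxBr mulmxBl -[u *m D *m v^T]trmx11 !trmx_mul trmxK; congr (_ - _).
by rewrite mulmxA.
Qed.

Lemma closed_sym w z u v : differentiable w z -> d1 w z = 0 ->
  v *m 'D_u w z = u *m 'D_v w z.
Proof.
by move=> dw w0; apply/eqP; rewrite -subr_eq0 -d1E// w0 mulmx0 mul0mx.
Qed.

Lemma pairing_linear (c : 'cV[R]_m) : exists2 L : {linear 'rV[R]_m -> R},
  continuous L & forall v, L v = (v *m c) 0 0.
Proof.
pose f (v : 'rV[R]_m) : R := (v *m c) 0 0.
have lf : linear f by move=> a u v; rewrite /f mulmxDl -scalemxAl !mxE.
pose fL := GRing.isLinear.Build _ _ _ _ f lf.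
pose L : {linear 'rV[R]_m -> R} := HB.pack f fL.
exists L => // x; apply: continuous_mulmx; first exact: cvg_id.
exact: cst_continuous.
Qed.

(** The mean value theorem on the segment from z to z + h turns the remainder into h paired with an
    increment of w, which continuity of w makes small. *)
Lemma is_diff_gradient U (f : 'rV[R]_m -> R) w : open U ->
  (forall z v, U z -> is_derive z v f ((v *m w z) 0 0)) ->
  (forall z, U z -> {for z, continuous w}) ->
  forall z, U z -> differentiable f z.
Proof.
move=> oU fw cw z Uz; have [L cL LE] := pairing_linear (w z).
have /(is_diff_littleo cL)[] // : forall e : R, 0 < e ->
  \forall h \near (0 : 'rV[R]_m), `|f (h + z) - f z - L h| <= e * `|h|.
move=> e e0.
(* The sup norm bounds the pairing by m terms [|h| * e']; the added 1 keeps the quotient meaningful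
   for m = 0. *)
pose e' := e / (m%:R + 1).
have e'0 : 0 < e' by rewrite divr_gt0// ltr_wpDl.
have /cvgrPdist_le/(_ _ e'0) nw := cw z Uz.
have Fz := nbhs_filter z.
have nB := @filterI _ _ Fz _ _ (open_nbhs_nbhs (conj oU Uz)) nw.
have [d /= d0 db] := (nbhs_ballP z _).1 nB.
have Bz h c : `|h| < d -> 0 <= c <= 1 -> ball z d (z + c *: h).
  move=> hd /andP[c0 c1]; rewrite -ball_normE /= opprD addNKr normrN normrZ ger0_norm//.
  by apply: le_lt_trans hd; rewrite ler_piMl.
have nd : \forall h \near (0 : 'rV[R]_m), `|h| < d.
  by apply/nbhs_ballP; exists d => // h; rewrite -ball_normE /= sub0r normrN.
near=> h; have hd : `|h| < d by near: h.
have [|c c01] := @is_derive_MVT R (fun t => f (z + t *: h))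
  (fun t => (h *m w (z + t *: h)) 0 0) 1 ltr01.
  move=> s s01; have Us := (db _ (Bz h s hd s01)).1.
  exact/is_derive_line/fw.
rewrite scale1r scale0r addr0 mul1r [h + z]addrC => ->.
have nwc := (db _ (Bz h c hd c01)).2.
have -> : (h *m w (z + c *: h)) 0 0 - L h = \sum_i h 0 i * (w (z + c *: h) - w z) i 0.
  rewrite LE !mxE -sumrB; apply: eq_bigr => i _; rewrite !mxE; ring.
apply: le_trans (ler_norm_sum _ _ _) _.
apply: (@le_trans _ _ (\sum_(i < m) `|h| * e')).
  apply: ler_sum => i _; rewrite normrM; apply: ler_pM => //.
    by rewrite [leRHS]mx_normrE; apply: (le_bigmax _ _ (0, i)).
  apply: le_trans nwc; rewrite distrC [leRHS]mx_normrE.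
  by apply: (le_bigmax _ _ (i, 0)).
rewrite sumr_const card_ord -mulrnAr mulrC; apply: ler_wpM2r => //.
rewrite /e' -mulr_natr mulrAC ler_pdivrMr; first by rewrite ler_wpM2l ?lerDl ?ltW.
by rewrite ltr_wpDl.
Unshelve. all: by end_near. Qed.

Lemma is_derive_of_line (V W : normedModType R) (f : V -> W) x v df :
  is_derive (0 : R) 1 (fun t : R => f (t *: v + x)) df -> is_derive x v f df.
Proof.
have E : (fun h : R => h^-1 *: (f (h *: v + x) - f x)) =
    (fun h : R => h^-1 *: (f ((h *: (1 : R) + 0) *: v + x) - f (0 *: v + x))).
  by apply/funext => h; rewrite [h *: (1 : R)]mulr1 addr0 scale0r add0r.
by case=> dl <-; split; [rewrite /derivable /= E|rewrite /derive /= E].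
Qed.

Lemma is_derive1_affine (V : normedModType R) (x v : V) (s : R) :
  is_derive s 1 (fun t : R => x + t *: v) v.
Proof.
by apply: (is_derive_line (f := fun z => z)); apply: is_derive_id.
Qed.

Lemma poincare U w z0 : open U -> U z0 ->
  (forall x y (t : R), U x -> U y -> 0 <= t <= 1 -> U (x + t *: (y - x))) ->
  Ck 1 U w -> (forall z, U z -> d1 w z = 0) ->
  exists f : 'rV[R]_m -> R,
    forall z v, U z -> is_derive z v f ((v *m w z) 0 0).
Proof.
move=> oU Uz0 cU [dw Dw] w0.
have cw z : U z -> {for z, continuous w}.
  by move=> Uz; apply/differentiable_continuous/dw.
(* The integral of w along the segment from z0 to y. *)
pose f y := integral01 (fun t => ((y - z0) *m w (z0 + t *: (y - z0))) 0 0).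
exists f => y h Uy.
have Fy := nbhs_filter y.
have [d /= d0 db] := (nbhs_ballP y _).1 (open_nbhs_nbhs (conj oU Uy)).
(* For |s| <= e the point y + s h stays in the ball of radius d; the added 1 covers h = 0. *)
pose e := d / (`|h| + 1).
have e0 : 0 < e by rewrite divr_gt0// ltr_wpDl.
pose q (s : R) := y - z0 + s *: h.
have Uq s t : - e <= s <= e -> 0 <= t <= 1 -> U (z0 + t *: q s).
  move=> se t01; have -> : q s = y + s *: h - z0 by rewrite /q addrAC.
  apply: cU => //; apply: db; rewrite -ball_normE /= opprD addNKr normrN normrZ.
  have : `|s| <= e by rewrite ler_norml.
  move=> /(ler_wpM2r (normr_ge0 h))/le_lt_trans; apply.
  have h1 : 0 < `|h| + 1 by rewrite ltr_wpDl.
  by rewrite /e mulrAC ltr_pdivrMr// ltr_pM2l// ltrDl.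
pose g s t := (q s *m w (z0 + t *: q s)) 0 0.
pose dg s t := (h *m w (z0 + t *: q s)) 0 0 + t * (q s *m 'D_h w (z0 + t *: q s)) 0 0.
have dgE (s t : R) : - e <= s <= e -> 0 <= t <= 1 ->
    is_derive s 1 (fun s => g s t) (dg s t).
  move=> se t01; have Ust := Uq s t se t01.
  have qE x : z0 + t *: q x = z0 + t *: (y - z0) + x *: (t *: h).
    by rewrite /q scalerDr addrA !scalerA [x * t]mulrC.
  have dw' : is_derive s 1 (fun x => w (z0 + t *: q x)) (t *: 'D_h w (z0 + t *: q s)).
    have -> : (fun x => w (z0 + t *: q x)) =
              (fun x => w (z0 + t *: (y - z0) + x *: (t *: h))).
      by apply/funext => x; rewrite qE.
    apply: is_derive_line; rewrite -qE; split; first exact/diff_derivable/dw.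
    by rewrite !(deriveE _ (dw _ Ust)) linearZ.
  have -> : dg s t =
      (h *m w (z0 + t *: q s) + q s *m (t *: 'D_h w (z0 + t *: q s))) 0 0.
    by rewrite -scalemxAr [RHS]mxE [X in _ = _ + X]mxE.
  exact/is_derive_entry/(is_derive_mulmx (is_derive1_affine (y - z0) h s) dw').
have cdg (s t : R) : - e <= s <= e -> 0 <= t <= 1 ->
    {for (s, t), continuous (fun p : R * R => dg p.1 p.2)}.
  move=> se t01; have Ust := Uq s t se t01.
  have cq : {for (s, t), continuous (fun p : R * R => q p.1)}.
    by apply: cvgD; [exact: cvg_cst|apply: cvgZ; [exact: cvg_fst|exact: cvg_cst]].
  have cl : {for (s, t), continuous (fun p : R * R => z0 + p.2 *: q p.1)}.
    by apply: cvgD; [exact: cvg_cst|apply: cvgZ; [exact: cvg_snd|exact: cq]].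
  have cW (v : 'rV[R]_m -> 'cV[R]_m) : {for z0 + t *: q s, continuous v} ->
      {for (s, t), continuous (fun p : R * R => v (z0 + p.2 *: q p.1))}.
    by move=> cv; apply: (@continuous_comp _ _ _ (fun p : R * R => z0 + p.2 *: q p.1) v).
  have ch : {for (s, t), continuous (fun p : R * R => h : 'rV[R]_m)}.
    exact: cst_continuous.
  have c1 := @continuous_mulmx _ 1 m 1 _ _ 0 0 _ ch (cW _ (cw _ Ust)).
  have c2 := @continuous_mulmx _ 1 m 1 _ _ 0 0 _ cq (cW _ (Dw h _ Ust)).
  by apply: cvgD; [exact: c1|apply: cvgM; [exact: cvg_snd|exact: c2]].
have cg (s t : R) : - e <= s <= e -> 0 <= t <= 1 -> {for t, continuous (g s)}.
  move=> se t01; have Ust := Uq s t se t01.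
  apply: continuous_mulmx; first exact: cst_continuous.
  apply: (@continuous_comp _ _ _ (fun t : R => z0 + t *: q s) w); last exact: cw.
  by apply: cvgD; [exact: cvg_cst|apply: cvgZ; [exact: cvg_id|exact: cvg_cst]].
have D := integral01_derive_param e0 dgE cdg cg.
have e00 : - e <= 0 <= e by rewrite oppr_le0 ltW.
have q0 : q 0 = y - z0 by rewrite /q scale0r addr0.
have E : integral01 (dg 0) = (h *m w y) 0 0.
  have -> : (h *m w y) 0 0 =
      1 * (h *m w (z0 + 1 *: q 0)) 0 0 - 0 * (h *m w (z0 + 0 *: q 0)) 0 0.
    by rewrite mul1r mul0r subr0 scale1r q0 addrCA subrr addr0.
  (* Closedness exchanges h and q in the derivative of w, which makes [dg 0] the t-derivative of t
     w(h); the integral is then the boundary value w(h) at y. *)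
  apply: (@integral01_derive R (fun t => t * (h *m w (z0 + t *: q 0)) 0 0)) => t t01.
    have Ut := Uq 0 t e00 t01.
    have dwt : is_derive t 1 (fun t => w (z0 + t *: q 0)) ('D_(q 0) w (z0 + t *: q 0)).
      by apply: is_derive_line; apply/derivableP/diff_derivable/dw.
    have := is_derive_entry 0 0 (is_derive_mulmx (is_derive_cst h t 1) dwt).
    rewrite mul0mx add0r (closed_sym _ _ (dw _ Ut) (w0 _ Ut)) => dK.
    by apply: (is_derive_eq (is_deriveM (is_derive_id t 1) dK)); rewrite /dg addrC ![_ *: _]mulr1.
  have cdt := cdg 0 t e00 t01.
  apply: (@continuous_comp _ _ _ (fun t : R => (0, t)) (fun p : R * R => dg p.1 p.2)) => //.
  exact: (cvg_pair (cvg_cst _) cvg_id).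
rewrite E in D.
have fE : (fun s : R => f (s *: h + y)) = (fun s => integral01 (g s)).
  apply/funext => s; rewrite /f /g /q; congr integral01; apply/funext => t.
  by rewrite -!addrA [s *: h + _]addrC -!addrA.
by rewrite -fE in D; exact: is_derive_of_line D.
Qed.

End Poincare.

(** * Smooth maps and derivatives along vector fields *)

Section SmoothFunctions.
Context {R : realType} {m : nat} {U : set 'rV[R]_m}.
Hypothesis oU : open U.

Lemma smooth_ext (W : normedModType R) (f g : 'rV[R]_m -> W) :
  (forall z, U z -> f z = g z) -> smooth U f -> smooth U g.
Proof. by move=> fg sf k; apply: Ck_ext oU fg (sf k). Qed.

Lemma smooth_cst (W : normedModType R) (c : W) : smooth U (fun=> c).
Proof. by move=> k; exact: Ck_cst. Qed.

Lemma smooth_id : smooth U (fun z => z).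
Proof. by move=> k; exact: Ck_id. Qed.

Lemma smoothD (W : normedModType R) (f g : 'rV[R]_m -> W) :
  smooth U f -> smooth U g -> smooth U (fun z => f z + g z).
Proof. by move=> sf sg k; apply: CkD. Qed.

Lemma smooth_sum (W : normedModType R) (I : Type) (r : seq I) (P : pred I)
    (f : I -> 'rV[R]_m -> W) :
  (forall i, P i -> smooth U (f i)) -> smooth U (fun z => \sum_(i <- r | P i) f i z).
Proof. by move=> sf k; apply: Ck_sum => // i /sf; apply. Qed.

Lemma smoothM (f g : 'rV[R]_m -> R) :
  smooth U f -> smooth U g -> smooth U (fun z => f z * g z).
Proof. by move=> sf sg k; apply: CkM. Qed.

Lemma smooth_mxP p q (f : 'rV[R]_m -> 'M[R]_(p, q)) :
  smooth U f <-> forall i j, smooth U (fun z => f z i j).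
Proof.
split=> [sf i j k|sf k]; first exact: ((Ck_mxP _ _ oU).1 (sf k)).
by apply/(Ck_mxP _ _ oU) => i j; apply: sf.
Qed.

Lemma smooth_entry p q (f : 'rV[R]_m -> 'M[R]_(p, q)) i j :
  smooth U f -> smooth U (fun z => f z i j).
Proof. by move/smooth_mxP; apply. Qed.

Lemma smoothZ p q (c : 'rV[R]_m -> R) (f : 'rV[R]_m -> 'M[R]_(p, q)) :
  smooth U c -> smooth U f -> smooth U (fun z => c z *: f z).
Proof.
move=> sc /smooth_mxP sf; apply/smooth_mxP => i j.
have -> : (fun z => (c z *: f z) i j) = (fun z => c z * f z i j).
  by apply/funext => z; rewrite mxE.
exact: smoothM.
Qed.

Lemma smoothN p q (f : 'rV[R]_m -> 'M[R]_(p, q)) :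
  smooth U f -> smooth U (fun z => - f z).
Proof.
move=> sf; have -> : (fun z => - f z) = (fun z => -1 *: f z).
  by apply/funext => z; rewrite scaleN1r.
by apply: smoothZ; first exact: smooth_cst.
Qed.

Lemma smooth_mulmx p q r (f : 'rV[R]_m -> 'M[R]_(p, q)) (g : 'rV[R]_m -> 'M[R]_(q, r)) :
  smooth U f -> smooth U g -> smooth U (fun z => f z *m g z).
Proof. by move=> sf sg k; apply: Ck_mulmx. Qed.

Lemma smoothV (f : 'rV[R]_m -> R) : (forall z, U z -> f z != 0) ->
  smooth U f -> smooth U (fun z => (f z)^-1).
Proof. by move=> f0 sf k; apply: CkV. Qed.

Lemma smooth_comp p q r (O : set 'rV[R]_p) (g : 'rV[R]_m -> 'rV[R]_p)
    (f : 'rV[R]_p -> 'M[R]_(q, r)) :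
  open O -> (forall z, U z -> O (g z)) -> smooth U g -> smooth O f ->
  smooth U (fun z => f (g z)).
Proof.
move=> oO gO sg sf; apply/smooth_mxP => i j k.
apply: (Ck_comp oU oO gO (sg k) (f := fun z => f z i j)).
exact: ((Ck_mxP _ _ oO).1 (sf k)).
Qed.

Lemma smooth_differentiable (W : normedModType R) (f : 'rV[R]_m -> W) z :
  smooth U f -> U z -> differentiable f z.
Proof. by move=> /(_ 1%N)[df _]; apply: df. Qed.

Lemma smooth_derive (W : normedModType R) (f : 'rV[R]_m -> W) v :
  smooth U f -> smooth U (fun z => 'D_v f z).
Proof. by move=> sf k; have [_ +] := sf k.+1; apply. Qed.

Lemma smooth_of_derive (W : normedModType R) (f : 'rV[R]_m -> W) :
  (forall z, U z -> differentiable f z) ->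
  (forall v, smooth U (fun z => 'D_v f z)) -> smooth U f.
Proof.
move=> df sf [|k]; first by move=> z Uz; apply/differentiable_continuous/df.
by split=> // v; apply: sf.
Qed.

(** Expands a derivative in a direction that may vary with z into fixed directions, the only ones
    that smoothness controls. *)
Lemma derive_field_sum p q (f : 'rV[R]_m -> 'M[R]_(p, q)) v z : differentiable f z ->
  'D_v f z = \sum_i v 0 i *: 'D_(delta_mx 0 i) f z.
Proof.
move=> df; rewrite (deriveE v df) {1}(row_sum_delta v) linear_sum.
by apply: eq_bigr => i _; rewrite linearZ /= (deriveE _ df).
Qed.

Lemma smooth_derive_field p q (f : 'rV[R]_m -> 'M[R]_(p, q)) (X : 'rV[R]_m -> 'rV[R]_m) :
  smooth U X -> smooth U f -> smooth U (fun z => 'D_(X z) f z).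
Proof.
move=> sX sf.
have sS : smooth U (fun z => \sum_i X z 0 i *: 'D_(delta_mx 0 i) f z).
  by apply: smooth_sum => i _; apply: smoothZ; [exact: smooth_entry|exact: smooth_derive].
by apply: smooth_ext sS => z Uz; rewrite derive_field_sum//; apply: smooth_differentiable sf Uz.
Qed.

Lemma derive_expR_comp (f : 'rV[R]_m -> R) v z : differentiable f z ->
  'D_v (fun x => expR (f x)) z = expR (f z) * 'D_v f z.
Proof.
move=> df; have dexp : differentiable (@expR R) (f z).
  by apply/derivable1_diffP; exact: derivable_expR.
rewrite (derive_comp v df dexp).
have -> : 'D_v f z = 'D_v f z *: (1 : R) by rewrite [_ *: _]mulr1.
rewrite (deriveE _ dexp) linearZ /= -(deriveE _ dexp).
rewrite (@derive_val _ _ _ _ _ _ _ (is_derive_expR _)).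
by rewrite [_ *: (1 : R)]mulr1 mulrC.
Qed.

Lemma smooth_expR (f : 'rV[R]_m -> R) : smooth U f -> smooth U (fun z => expR (f z)).
Proof.
move=> sf; elim=> [|k IH].
  by move=> z Uz; apply: continuous_comp (sf 0%N z Uz) (@continuous_expR _ _).
have dexp x : differentiable (@expR R) x.
  by apply/derivable1_diffP; exact: derivable_expR.
split=> [z Uz|v].
  exact: (differentiable_comp (smooth_differentiable sf Uz) (dexp _)).
apply: Ck_ext oU _ (CkM oU IH (smooth_derive v sf k)) => z Uz.
by rewrite derive_expR_comp//; apply: smooth_differentiable sf Uz.
Qed.

Lemma derive_symmetric (f : 'rV[R]_m -> R) u v z : smooth U f -> U z ->
  'D_u (fun x => 'D_v f x) z = 'D_v (fun x => 'D_u f x) z.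
Proof. by move=> sf Uz; apply: derive_sym oU (sf 2) Uz. Qed.

Lemma derive_mx_symmetric p q (f : 'rV[R]_m -> 'M[R]_(p, q)) u v z : smooth U f -> U z ->
  'D_u (fun x => 'D_v f x) z = 'D_v (fun x => 'D_u f x) z.
Proof.
move=> sf Uz; apply/matrixP => i j.
have C a b : ('D_a (fun x => 'D_b f x) z) i j = 'D_a (fun x => 'D_b (fun y => f y i j) x) z.
  have dDf := smooth_differentiable (smooth_derive b sf) Uz.
  apply: etrans (derive_coord a i j dDf) _.
  apply: derive_ext oU Uz _ => x Ux; apply: derive_coord.
  exact: smooth_differentiable sf Ux.
apply: etrans (C u v) (etrans _ (esym (C v u))).
exact: derive_symmetric (smooth_entry i j sf) Uz.
Qed.

(** The product rule for a moving direction: differentiating the components of X gives the first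
    term, and Schwarz's theorem reorders the second. *)
Lemma derive_derive_field p q (f : 'rV[R]_m -> 'M[R]_(p, q)) (X : 'rV[R]_m -> 'rV[R]_m) v z :
  smooth U X -> smooth U f -> U z ->
  'D_v (fun x => 'D_(X x) f x) z = 'D_('D_v X z) f z + 'D_(X z) (fun x => 'D_v f x) z.
Proof.
move=> sX sf Uz.
have dX := smooth_differentiable sX Uz; have df := smooth_differentiable sf Uz.
have sD i : smooth U (fun x => X x 0 i *: 'D_(delta_mx 0 i) f x).
  by apply: smoothZ; [exact: smooth_entry|exact: smooth_derive].
apply: etrans (derive_ext (g := \sum_i (fun x => X x 0 i *: 'D_(delta_mx 0 i) f x))
  v oU Uz _) _.
  move=> x Ux; rewrite fct_sumE derive_field_sum//.
  exact: smooth_differentiable sf Ux.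
rewrite derive_sum; last by move=> i; apply/diff_derivable; apply: smooth_differentiable Uz.
have dDvf := smooth_differentiable (smooth_derive v sf) Uz.
rewrite (derive_field_sum ('D_v X z) df) (derive_field_sum (X z) dDvf).
rewrite -big_split; apply: eq_bigr => i _ /=.
rewrite (derive_mx_symmetric (delta_mx 0 i) v sf Uz).
have dXi := differentiable_entry 0 i dX.
have dDf := smooth_differentiable (smooth_derive (delta_mx 0 i) sf) Uz.
apply/matrixP => a b; rewrite (derive_coord _ a b (smooth_differentiable (sD i) Uz)).
have -> : (fun x => (X x 0 i *: 'D_(delta_mx 0 i) f x) a b) =
    (fun x => X x 0 i) * (fun x => ('D_(delta_mx 0 i) f x) a b).
  by apply/funext => x; rewrite mxE.
rewrite deriveM; [|exact: diff_derivable|exact/diff_derivable/differentiable_entry].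
rewrite -(derive_coord v 0 i dX) -(derive_coord v a b dDf).
rewrite [RHS]mxE [X in _ = X + _]mxE [X in _ = _ + X]mxE addrC; congr (_ + _).
exact: mulrC.
Qed.

(** The pure second derivatives cancel by symmetry, leaving the derivatives of the two fields, that
    is, their bracket. *)
Lemma derive_commutator p q (f : 'rV[R]_m -> 'M[R]_(p, q)) (X Y : 'rV[R]_m -> 'rV[R]_m) z :
  smooth U X -> smooth U Y -> smooth U f -> U z ->
  'D_(X z) (fun x => 'D_(Y x) f x) z - 'D_(Y z) (fun x => 'D_(X x) f x) z =
  'D_(bracket X Y z) f z.
Proof.
move=> sX sY sf Uz; have df := smooth_differentiable sf Uz.
have A := derive_derive_field (X z) sY sf Uz.
have B := derive_derive_field (Y z) sX sf Uz.
have C := derive_mx_symmetric (Y z) (X z) sf Uz.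
have E : 'D_('D_(X z) Y z) f z - 'D_('D_(Y z) X z) f z = 'D_(bracket X Y z) f z.
  by apply/esym; rewrite /bracket (deriveE _ df) linearB -!(deriveE _ df).
have aux (T : zmodType) (a b c d e a1 b1 : T) :
    a1 = c + a -> b1 = d + b -> a = b -> c - d = e -> a1 - b1 = e.
  by move=> -> -> -> <-; rewrite opprD addrACA subrr addr0.
exact: aux A B C E.
Qed.

End SmoothFunctions.

Lemma eq_mulmx_row (R : realType) p q (A B : 'M[R]_(p, q)) :
  (forall u : 'rV[R]_p, u *m A = u *m B) -> A = B.
Proof. by move=> AB; apply/row_matrixP => i; rewrite !rowE. Qed.

Lemma bilinear_eq0 (R : realType) p q (A : 'M[R]_(p, q)) :
  (forall (u : 'rV[R]_p) (v : 'rV[R]_q), u *m A *m v^T = 0) -> A = 0.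
Proof.
move=> A0; apply: eq_mulmx_row => u; apply: trmx_inj; apply: eq_mulmx_row => v.
by apply: trmx_inj; rewrite trmx_mul trmxK A0 mulmx0 trmx0 mulmx0 trmx0.
Qed.

(** * Jacobians and differentials as matrices *)

Section Gradients.
Context {R : realType} {m : nat} {U : set 'rV[R]_m}.
Hypothesis oU : open U.

Lemma is_derive_smooth (W : normedModType R) (f : 'rV[R]_m -> W) z v :
  smooth U f -> U z -> is_derive z v f ('D_v f z).
Proof. by move=> sf Uz; apply/derivableP/diff_derivable/(smooth_differentiable sf). Qed.

Lemma is_derive_jacobian p (f : 'rV[R]_m -> 'rV[R]_p) z v :
  smooth U f -> U z -> is_derive z v f (v *m 'J f z).
Proof.
move=> sf Uz; have df := smooth_differentiable sf Uz.
by rewrite -deriveEjacobian//; apply/derivableP/diff_derivable.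
Qed.

Lemma jacobian_entry p (f : 'rV[R]_m -> 'rV[R]_p) z i j :
  smooth U f -> U z -> ('J f z) i j = 'D_(delta_mx 0 i) f z 0 j.
Proof.
move=> sf Uz; rewrite deriveEjacobian ?rowE -?rowE ?mxE//.
exact: smooth_differentiable sf Uz.
Qed.

Lemma smooth_jacobian p (f : 'rV[R]_m -> 'rV[R]_p) : smooth U f -> smooth U (jacobian f).
Proof.
move=> sf; apply/(smooth_mxP oU) => i j.
have sD := smooth_entry oU 0 j (smooth_derive (delta_mx 0 i) sf).
by apply: (smooth_ext oU _ sD) => z Uz; rewrite jacobian_entry.
Qed.

Lemma is_derive_d0 (f : 'rV[R]_m -> R) z v :
  smooth U f -> U z -> is_derive z v f ((v *m d0 f z) 0 0).
Proof.
move=> sf Uz; have df := smooth_differentiable sf Uz.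
apply: is_derive_eq (is_derive_smooth v sf Uz) _.
rewrite (deriveE _ df) {1}(row_sum_delta v) linear_sum mxE.
by apply: eq_bigr => i _; rewrite linearZ /= mxE -deriveE.
Qed.

Lemma smooth_d0 (f : 'rV[R]_m -> R) : smooth U f -> smooth U (d0 f).
Proof.
move=> sf; apply/(smooth_mxP oU) => i j.
by apply: (smooth_ext oU _ (smooth_derive (delta_mx 0 i) sf)) => z Uz; rewrite mxE.
Qed.

Definition gradmx q (c : 'rV[R]_m -> 'cV[R]_q) z : 'M[R]_(m, q) :=
  \matrix_(i, j) 'D_(delta_mx 0 i) c z j 0.

Lemma is_derive_gradmx q (c : 'rV[R]_m -> 'cV[R]_q) z v :
  smooth U c -> U z -> is_derive z v c (v *m gradmx c z)^T.
Proof.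
move=> sc Uz; have dc := smooth_differentiable sc Uz.
by rewrite -derive_rows//; apply/derivableP/diff_derivable.
Qed.

Lemma gradmxP q (c : 'rV[R]_m -> 'cV[R]_q) z G :
  (forall v, is_derive z v c (v *m G)^T) -> gradmx c z = G.
Proof.
move=> cG; apply/matrixP => i j; rewrite mxE.
by rewrite (@derive_val _ _ _ _ _ _ _ (cG _)) mxE -rowE mxE.
Qed.

Lemma d1_gradmx (w : 'rV[R]_m -> 'cV[R]_m) z : d1 w z = gradmx w z - (gradmx w z)^T.
Proof. by apply/matrixP => i j; rewrite !mxE. Qed.

(** Both sides are mixed second derivatives of f, since [u *m 'J f] is the derivative of f along the
    constant vector u. *)
Lemma jacobian_symmetric p (f : 'rV[R]_m -> 'rV[R]_p) (z u v : 'rV[R]_m) :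
  smooth U f -> U z -> u *m 'D_v (jacobian f) z = v *m 'D_u (jacobian f) z.
Proof.
move=> sf Uz; have sJ := smooth_jacobian sf.
have E a b : is_derive z b (fun x => 'D_a f x) (a *m 'D_b (jacobian f) z).
  apply: (is_derive_ext oU Uz (f := fun x => a *m jacobian f x)).
    by move=> x Ux; rewrite deriveEjacobian//; apply: smooth_differentiable sf Ux.
  exact/is_derive_mulmxl/is_derive_smooth.
apply: etrans (esym (@derive_val _ _ _ _ _ _ _ (E u v))) (etrans _ (@derive_val _ _ _ _ _ _ _ (E v u))).
exact: derive_mx_symmetric sf Uz.
Qed.

Lemma d0_symmetric (f : 'rV[R]_m -> R) (z u v : 'rV[R]_m) :
  smooth U f -> U z -> u *m 'D_v (d0 f) z = v *m 'D_u (d0 f) z.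
Proof.
move=> sf Uz; have sd := smooth_d0 sf.
have E a b : is_derive z b (fun x => 'D_a f x) ((a *m 'D_b (d0 f) z) 0 0).
  apply: (is_derive_ext oU Uz (f := fun x => (a *m d0 f x) 0 0)).
    by move=> x Ux; rewrite (@derive_val _ _ _ _ _ _ _ (is_derive_d0 a sf Ux)).
  exact/is_derive_entry/is_derive_mulmxl/is_derive_smooth.
apply/matrixP => i j; rewrite !ord1.
apply: etrans (esym (@derive_val _ _ _ _ _ _ _ (E u v))) (etrans _ (@derive_val _ _ _ _ _ _ _ (E v u))).
exact: derive_symmetric sf Uz.
Qed.

End Gradients.

(** * Sprays in coordinates *)

Section Frames.
Context {R : realType} {n : nat}.
Local Notation V := 'rV[R]_(n + n).

Definition ddx : 'M[R]_(n, n + n) := row_mx 1%:M 0.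
(** As z is the row (x, y), [z *m dx] is x and [z *m dy] is y. Taking blocks thus becomes
    multiplication by constant matrices, through which derivatives pass. *)
Definition dy : 'M[R]_(n + n, n) := col_mx 0 1%:M.

Lemma ddx_dx : ddx *m (dx : 'M[R]_(n + n, n)) = 1%:M.
Proof. by rewrite mul_row_col mul1mx mul0mx addr0. Qed.

Lemma ddx_dy : ddx *m dy = 0.
Proof. by rewrite mul_row_col mulmx0 mul0mx addr0. Qed.

Lemma ddy_dx : (ddy : 'M[R]_(n, n + n)) *m dx = 0.
Proof. by rewrite mul_row_col mulmx0 mul0mx addr0. Qed.

Lemma ddy_dy : (ddy : 'M[R]_(n, n + n)) *m dy = 1%:M.
Proof. by rewrite mul_row_col mulmx1 mul0mx add0r. Qed.

Lemma dx_ddxD : dx *m ddx + dy *m ddy = 1%:M.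
Proof.
rewrite mul_col_row mul_col_row !(mul1mx, mulmx1, mul0mx, mulmx0).
by rewrite add_block_mx !addr0 add0r -scalar_mx_block.
Qed.

Definition frameE := (ddx_dx, ddx_dy, ddy_dx, ddy_dy).

Lemma lsubmxE p (A : 'M[R]_(p, n + n)) : lsubmx A = A *m dx.
Proof. by rewrite -[in RHS](hsubmxK A) mul_row_col mulmx1 mulmx0 addr0. Qed.

Lemma rsubmxE p (A : 'M[R]_(p, n + n)) : rsubmx A = A *m dy.
Proof. by rewrite -[in RHS](hsubmxK A) mul_row_col mulmx1 mulmx0 add0r. Qed.

Lemma liouvilleE (z : V) : liouville z = z *m (dy *m ddy).
Proof. by rewrite /liouville rsubmxE mulmxA. Qed.

Lemma eq_frame p (A B : 'M[R]_(p, n + n)) :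
  A *m dx = B *m dx -> A *m dy = B *m dy -> A = B.
Proof.
by move=> Ax Ay; rewrite -[A]mulmx1 -[B]mulmx1 -dx_ddxD !mulmxDr !mulmxA Ax Ay.
Qed.

End Frames.

(** * Invertibility and rank of block matrices *)

Section RankLemmas.
Context {R : realType} {n : nat}.

Lemma unitmx_ker (A : 'M[R]_n) :
  reflect (forall v : 'cV[R]_n, A *m v = 0 -> v = 0) (A \in unitmx).
Proof.
apply: (iffP idP) => [Au v Av|kA]; first by rewrite -(mulKmx Au v) Av mulmx0.
rewrite -unitmx_tr -row_free_unit -kermx_eq0; apply/eqP/row_matrixP => i.
rewrite row0; apply: trmx_inj; rewrite trmx0; apply: kA.
apply: trmx_inj; rewrite trmx_mul trmxK trmx0.
by apply/eqP; rewrite -sub_kermx row_sub.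
Qed.

(* If (M + k b b^T) v = 0, multiplying by y on the left gives b^T v = 0, so v is
   also in the kernel of M and of f M + s b^T. *)
Lemma unitmx_add_rank1 (M : 'M[R]_n) (b s : 'cV[R]_n) (y : 'rV[R]_n) (f k : R) :
  k != 0 -> y *m M = 0 -> y *m b = 1%:M ->
  f *: M + s *m b^T \in unitmx -> M + k *: (b *m b^T) \in unitmx.
Proof.
move=> k0 yM yb /unitmx_ker kQ; apply/unitmx_ker => v Mv.
have bv : b^T *m v = 0.
  have /eqP := congr1 (mulmx y) Mv.
  rewrite mulmx0 mulmxDl mulmxDr mulmxA yM mul0mx add0r -scalemxAl -scalemxAr.
  by rewrite !mulmxA yb mul1mx scaler_eq0 (negPf k0) => /eqP.
apply: kQ; rewrite mulmxDl -mulmxA bv mulmx0 addr0 -scalemxAl.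
by move: Mv; rewrite mulmxDl -scalemxAl -mulmxA bv mulmx0 scaler0 addr0 => ->; rewrite scaler0.
Qed.

Lemma rank_semibasic (A : 'M[R]_(n + n, n)) :
  (\rank (A *m dx^T - dx *m A^T)%R == (n + n)%N) = (ddy *m A \in unitmx).
Proof.
have -> : A *m dx^T - dx *m A^T =
    block_mx (usubmx A - (usubmx A)^T) (- (dsubmx A)^T) (dsubmx A) 0.
  rewrite -{1 2}[A]vsubmxK tr_col_mx /dx tr_col_mx trmx1 trmx0 !mul_col_row.
  rewrite !(mulmx1, mul1mx, mulmx0, mul0mx) opp_block_mx add_block_mx.
  by rewrite !(oppr0, addr0, add0r).
have -> : ddy *m A = dsubmx A.
  by rewrite -{1}[A]vsubmxK mul_row_col mul0mx mul1mx add0r.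
set P := _ - _; set Q := dsubmx A.
rewrite -/(row_free _) row_free_unit.
(* W swaps the two column blocks and makes the matrix block triangular, with diagonal blocks - Q^T
   and Q. *)
pose W : 'M[R]_(n + n) := block_mx 0 1%:M 1%:M 0.
have WW : W *m W = 1%:M.
  by rewrite mulmx_block !(mulmx1, mul1mx, mulmx0, mul0mx, addr0, add0r) -scalar_mx_block.
have uW : W \in unitmx by case: (mulmx1_unit WW).
have -> : (block_mx P (- Q^T) Q 0 \in unitmx) = (block_mx P (- Q^T) Q 0 *m W \in unitmx).
  by rewrite unitmx_mul uW andbT.
rewrite mulmx_block !(mulmx1, mul1mx, mulmx0, mul0mx, addr0, add0r).
rewrite unitmxE det_ublock unitrM -!unitmxE.
by rewrite -scaleN1r unitmxZ ?unitrN1// unitmx_tr andbb.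
Qed.

End RankLemmas.

(** * Homogeneity and curvature of a spray *)

Section LocalSpray.
Context {R : realType} {n : nat} {U : set 'rV[R]_(n + n)}
  {S : 'rV[R]_(n + n) -> 'rV[R]_(n + n)}.
Local Notation V := 'rV[R]_(n + n).
Local Notation dx := (dx : 'M[R]_(n + n, n)).
Local Notation dy := (dy : 'M[R]_(n + n, n)).
Local Notation ddy := (ddy : 'M[R]_(n, n + n)).
Local Notation N := (Nmx S).

Hypothesis oU : open U.
Hypothesis sS : smooth U S.
Hypothesis S_J : forall z, U z -> S z *m J = liouville z.
Hypothesis S_homogeneous : forall z, U z -> bracket liouville S z = S z.

Lemma deltaxE z : deltax S z = ddx - N z *m ddy.
Proof. by rewrite /deltax /ddx mul_mx_row mulmx0 mulmx1 opp_row_mx add_row_mx oppr0 addr0 add0r. Qed.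

Lemma deltayE z : deltay S z = dx *m N z + dy.
Proof. by rewrite /deltay mul_col_mx mul1mx mul0mx add_col_mx addr0 add0r. Qed.

Lemma deltax_dx z : deltax S z *m dx = 1%:M.
Proof. by rewrite deltaxE mulmxBl -mulmxA !frameE mulmx0 subr0. Qed.

Lemma deltax_dy z : deltax S z *m dy = - N z.
Proof. by rewrite deltaxE mulmxBl -mulmxA !frameE mulmx1 sub0r. Qed.

Lemma deltax_deltay z : deltax S z *m deltay S z = 0.
Proof. by rewrite deltayE mulmxDr mulmxA deltax_dx deltax_dy mul1mx subrr. Qed.

Lemma ddy_deltay z : ddy *m deltay S z = 1%:M.
Proof. by rewrite deltayE mulmxDr mulmxA !frameE mul0mx add0r. Qed.

Lemma hproj_vprojD z : hproj S z + vproj S z = 1%:M.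
Proof.
rewrite /hproj /vproj deltaxE deltayE mulmxBr mulmxDl -!mulmxA -dx_ddxD.
by rewrite addrA subrK.
Qed.

Lemma S_dx z : U z -> S z *m dx = z *m dy.
Proof.
move=> Uz; have /(congr1 (mulmx^~ dy)) := S_J Uz.
by rewrite liouvilleE /J -!mulmxA !frameE !mulmx1.
Qed.

Lemma G_dy z : G S z = - 2^-1 *: (S z *m dy).
Proof. by rewrite /G rsubmxE. Qed.

Lemma S_dy z : S z *m dy = - 2 *: G S z.
Proof. by rewrite G_dy scalerA mulrNN mulfV ?scale1r// pnatr_eq0. Qed.

Lemma is_derive_liouville z v : is_derive z v (liouville : V -> V) (v *m (dy *m ddy)).
Proof.
have -> : (liouville : V -> V) = fun z => z *m (dy *m ddy).
  by apply/funext => x; exact: liouvilleE.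
exact: is_derive_mulmxr (is_derive_id _ _).
Qed.

Lemma smooth_liouville : smooth U (liouville : V -> V).
Proof.
have -> : (liouville : V -> V) = fun z => z *m (dy *m ddy).
  by apply/funext => x; exact: liouvilleE.
by apply: smooth_mulmx => //; [exact: smooth_id|exact: smooth_cst].
Qed.

(** As [dy *m ddy] is the projection on the y components, [C, S] = S gives the x part of S degree 1
    and its y part degree 2. *)
Lemma is_derive_liouville_S z : U z ->
  is_derive z (liouville z) S (S z *m (dy *m ddy + 1%:M)).
Proof.
move=> Uz; apply: is_derive_eq (is_derive_smooth _ sS Uz) _.
have := S_homogeneous Uz; rewrite /bracket.
rewrite (@derive_val _ _ _ _ _ _ _ (is_derive_liouville z (S z))).
by move/eqP; rewrite subr_eq => /eqP ->; rewrite mulmxDr mulmx1 addrC.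
Qed.

(** The bracket of the constant field v with C is the vertical part of v; so a vertical derivative
    lowers the degree by one and one along x keeps it. *)
Lemma is_derive_liouville_derive p q (f : V -> 'M[R]_(p, q)) z v df :
  smooth U f -> U z -> is_derive z v (fun x => 'D_(liouville x) f x) df ->
  is_derive z (liouville z) (fun x => 'D_v f x) (df - 'D_(v *m (dy *m ddy)) f z).
Proof.
move=> sf Uz D; apply: is_derive_eq (is_derive_smooth _ (smooth_derive v sf) Uz) _.
have E := derive_derive_field oU v smooth_liouville sf Uz.
have E1 := @derive_val _ _ _ _ _ _ _ (is_derive_liouville z v).
have E2 := congr1 (fun w => 'D_w f z + 'D_(liouville z) (fun x => 'D_v f x) z) E1.
have aux (T : zmodType) (a b c : T) : a = b + c -> c = a - b.
  by move=> ->; rewrite addrAC subrr add0r.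
exact: aux (etrans (esym (@derive_val _ _ _ _ _ _ _ D)) (etrans E E2)).
Qed.

Lemma smooth_G : smooth U (G S).
Proof.
have -> : G S = fun z => (- 2^-1) *: (S z *m dy) by apply/funext => z; rewrite G_dy.
by apply: smoothZ => //; [exact: smooth_cst|apply: smooth_mulmx => //; exact: smooth_cst].
Qed.

Lemma is_derive_G z v df : is_derive z v S df -> is_derive z v (G S) (- 2^-1 *: (df *m dy)).
Proof.
move=> D; have -> : G S = fun z => S z *m ((- 2^-1) *: dy).
  by apply/funext => x; rewrite G_dy scalemxAr.
by rewrite scalemxAr; apply: is_derive_mulmxr.
Qed.

Lemma derive_vertical_G z u : U z -> is_derive z (u *m ddy) (G S) (u *m N z).
Proof.
move=> Uz; have dG := smooth_differentiable smooth_G Uz.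
apply: is_derive_eq (is_derive_smooth _ smooth_G Uz) _.
rewrite (deriveE _ dG) {1}(row_sum_delta u) mulmx_suml linear_sum mulmx_sum_row.
apply: eq_bigr => i _; rewrite -scalemxAl linearZ /= -(deriveE _ dG).
by congr (_ *: _); apply/rowP => j; rewrite !mxE.
Qed.

Lemma is_derive_liouville_G z : U z -> is_derive z (liouville z) (G S) (2 *: G S z).
Proof.
move=> Uz; apply: is_derive_eq (is_derive_G (is_derive_liouville_S Uz)) _.
rewrite -mulmxA mulmxDl -mulmxA ddy_dy mulmx1 mul1mx.
have -> : dy + dy = 2 *: dy by rewrite scaler_nat mulr2n.
rewrite -scalemxAr.
by rewrite G_dy !scalerA; congr (_ *: _); rewrite mulrC.
Qed.

(** Euler's identity for G, homogeneous of degree 2. *)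
Lemma y_N z : U z -> z *m dy *m N z = 2 *: G S z.
Proof.
move=> Uz; apply: is_derive_unique (is_derive_liouville_G Uz).
by rewrite liouvilleE mulmxA; apply: derive_vertical_G.
Qed.

Lemma smooth_N : smooth U N.
Proof.
apply/(smooth_mxP oU) => i j.
have -> : (fun z => N z i j) = (fun z => 'D_(ey i) (G S) z 0 j).
  by apply/funext => z; rewrite mxE.
exact/smooth_entry/smooth_derive/smooth_G.
Qed.

Lemma is_derive_liouville_N z : U z -> is_derive z (liouville z) N (N z).
Proof.
move=> Uz; apply: is_derive_mxP => i j.
have -> : (fun z => N z i j) = (fun z => 'D_(ey i) (G S) z 0 j).
  by apply/funext => x; rewrite mxE.
have -> : N z i j = ('D_(ey i) (G S) z) 0 j by rewrite mxE.
apply: is_derive_entry.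
have D : is_derive z (ey i) (fun x => 'D_(liouville x) (G S) x) (2 *: 'D_(ey i) (G S) z).
  apply: (is_derive_ext oU Uz (f := fun x => 2 *: G S x)).
    by move=> x Ux; rewrite (@derive_val _ _ _ _ _ _ _ (is_derive_liouville_G Ux)).
  by apply: is_deriveZ; apply: is_derive_smooth smooth_G Uz.
apply: is_derive_eq (is_derive_liouville_derive smooth_G Uz D) _.
by rewrite /ey -!mulmxA [ddy *m (_ *m _)]mulmxA ddy_dy mul1mx scaler_nat mulr2n addrK.
Qed.

Lemma smooth_deltax : smooth U (deltax S).
Proof.
have -> : deltax S = fun z => ddx - N z *m ddy by apply/funext => z; exact: deltaxE.
apply: smoothD => //; first exact: smooth_cst.
by apply/smoothN => //; apply: smooth_mulmx => //; [exact: smooth_N|exact: smooth_cst].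
Qed.

Lemma smooth_deltay : smooth U (deltay S).
Proof.
have -> : deltay S = fun z => dx *m N z + dy by apply/funext => z; exact: deltayE.
apply: smoothD => //; last exact: smooth_cst.
by apply: smooth_mulmx => //; [exact: smooth_cst|exact: smooth_N].
Qed.

Lemma is_derive_deltay z v dN : is_derive z v N dN -> is_derive z v (deltay S) (dx *m dN).
Proof.
move=> D; have -> : deltay S = fun z => dx *m N z + dy by apply/funext => x; exact: deltayE.
by rewrite -[dx *m dN]addr0; apply: is_derive_add; exact: is_derive_mulmxl.
Qed.

Lemma is_derive_liouville_deltax z : U z ->
  is_derive z (liouville z) (deltax S) (deltax S z *m (dy *m ddy)).
Proof.
move=> Uz; have E : deltax S = fun z => ddx - N z *m ddy.
  by apply/funext => x; exact: deltaxE.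
have -> : deltax S z *m (dy *m ddy) = 0 - N z *m ddy.
  by rewrite mulmxA deltax_dy mulNmx sub0r.
rewrite E; apply: is_derive_sub.
exact: is_derive_mulmxr (is_derive_liouville_N Uz).
Qed.

(** By Euler's identity the y part - 2 G of S is - y N: a spray is horizontal for its own
    connection. *)
Lemma S_deltax z : U z -> S z = z *m dy *m deltax S z.
Proof.
move=> Uz; apply: eq_frame; first by rewrite -mulmxA deltax_dx mulmx1 S_dx.
by rewrite -mulmxA deltax_dy mulmxN y_N// S_dy scaleNr.
Qed.

(** The brackets of S with the rows of [deltax], paired with [deltay]: the entry (j, i) is the
    component R^i_j of the Jacobi endomorphism. *)
Definition curvature z : 'M[R]_n :=
  ('D_(S z) (deltax S) z - deltax S z *m 'J S z) *m deltay S z.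

Lemma is_derive_S z v : U z -> is_derive z v S (v *m 'J S z).
Proof. by move=> Uz; apply: is_derive_jacobian sS Uz. Qed.

Lemma is_derive_deltax z v : U z -> is_derive z v (deltax S) ('D_v (deltax S) z).
Proof. by move=> Uz; apply: is_derive_smooth smooth_deltax Uz. Qed.

Lemma jacobiE z : U z -> jacobi S z = dx *m curvature z *m ddy.
Proof.
move=> Uz; apply/row_matrixP => i; rewrite rowK /bracket.
have D : is_derive z (S z) (fun x => row i (hproj S x)) (row i dx *m 'D_(S z) (deltax S) z).
  have -> : (fun x => row i (hproj S x)) = (fun x => row i dx *m deltax S x).
    by apply/funext => x; rewrite row_mul.
  exact/is_derive_mulmxl/is_derive_deltax.
rewrite (@derive_val _ _ _ _ _ _ _ D).
rewrite (@derive_val _ _ _ _ _ _ _ (is_derive_S (row i (hproj S z)) Uz)).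
rewrite /curvature /vproj /hproj !row_mul !mulmxA; congr (_ *m _ *m _).
by rewrite mulmxBr !mulmxA.
Qed.

Lemma is_derive_y z v : is_derive z v (fun x : V => x *m dy) (v *m dy).
Proof. exact: is_derive_mulmxr (is_derive_id _ _). Qed.

(** This is Phi(S) = v [S, S] = 0. Differentiating S = y [deltax] along S shows that y times the
    brackets is a combination of rows of [deltax], which [deltay] kills. *)
Lemma y_curvature z : U z -> z *m dy *m curvature z = 0.
Proof.
move=> Uz.
have D1 := is_derive_mulmx (is_derive_y z (S z)) (is_derive_deltax (S z) Uz).
have D2 : is_derive z (S z) (fun x => x *m dy *m deltax S x) (S z *m 'J S z).
  by apply: is_derive_ext oU Uz _ (is_derive_S _ Uz) => x Ux; rewrite -S_deltax.
have E : S z *m dy *m deltax S z + z *m dy *m 'D_(S z) (deltax S) z = S z *m 'J S z.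
  exact: is_derive_unique D1 D2.
rewrite /curvature mulmxA mulmxBr [_ *m (deltax _ _ *m _)]mulmxA -S_deltax//.
rewrite -E opprD addrCA subrr addr0 mulNmx.
by rewrite -(mulmxA _ (deltax S z)) deltax_deltay mulmx0 oppr0.
Qed.

Lemma is_derive_liouville_jacobian z : U z ->
  is_derive z (liouville z) (jacobian S)
    ('J S z *m (dy *m ddy + 1%:M) - dy *m ddy *m 'J S z).
Proof.
move=> Uz; apply: is_derive_mxP => i j.
apply: (is_derive_ext oU Uz (f := fun x => 'D_(delta_mx 0 i) S x 0 j)).
  by move=> x Ux; rewrite (jacobian_entry _ _ sS Ux).
have -> : ('J S z *m (dy *m ddy + 1%:M) - dy *m ddy *m 'J S z) i j =
  (delta_mx 0 i *m 'J S z *m (dy *m ddy + 1%:M) - 'D_(delta_mx 0 i *m (dy *m ddy)) S z) 0 j.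
  rewrite (@derive_val _ _ _ _ _ _ _ (is_derive_S _ Uz)).
  transitivity (((delta_mx 0 i : V) *m
    ('J S z *m (dy *m ddy + 1%:M) - dy *m ddy *m 'J S z)) 0 j).
    by rewrite -rowE [RHS]mxE.
  by rewrite mulmxBr !mulmxA.
apply/is_derive_entry/is_derive_liouville_derive => //.
apply: (is_derive_ext oU Uz (f := fun x => S x *m (dy *m ddy + 1%:M))).
  by move=> x Ux; rewrite (@derive_val _ _ _ _ _ _ _ (is_derive_liouville_S Ux)).
exact/is_derive_mulmxr/is_derive_S.
Qed.

Lemma smooth_derive_S_deltax : smooth U (fun z => 'D_(S z) (deltax S) z).
Proof. by apply: smooth_derive_field => //; exact: smooth_deltax. Qed.

(** C is moved past S with [C, S] = S; the bracket contributes the summand [1%:M]. *)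
Lemma is_derive_liouville_derive_S_deltax z : U z ->
  is_derive z (liouville z) (fun x => 'D_(S x) (deltax S) x)
    ('D_(S z) (deltax S) z *m (dy *m ddy + 1%:M)).
Proof.
move=> Uz; apply: is_derive_eq (is_derive_smooth _ smooth_derive_S_deltax Uz) _.
have E := derive_commutator oU smooth_liouville sS smooth_deltax Uz.
have D : is_derive z (S z) (fun x => 'D_(liouville x) (deltax S) x)
    ('D_(S z) (deltax S) z *m (dy *m ddy)).
  apply: (is_derive_ext oU Uz (f := fun x => deltax S x *m (dy *m ddy))).
    by move=> x Ux; rewrite (@derive_val _ _ _ _ _ _ _ (is_derive_liouville_deltax Ux)).
  exact/is_derive_mulmxr/is_derive_deltax.
have aux (T : zmodType) (a b c d : T) : a - b = c -> b = d -> a = d + c.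
  by move=> <- ->; rewrite addrC subrK.
apply: etrans (aux _ _ _ _ _ E (@derive_val _ _ _ _ _ _ _ D)) _.
by rewrite mulmxDr mulmx1 (S_homogeneous Uz).
Qed.

Lemma is_derive_liouville_curvature z : U z ->
  is_derive z (liouville z) curvature (2 *: curvature z).
Proof.
move=> Uz.
have DY := is_derive_mulmx (is_derive_sub (is_derive_liouville_derive_S_deltax Uz)
  (is_derive_mulmx (is_derive_liouville_deltax Uz) (is_derive_liouville_jacobian Uz)))
  (is_derive_deltay (is_derive_liouville_N Uz)).
apply: is_derive_eq DY _; rewrite /curvature; set A := 'D_(S z) _ _; set B := 'J S z.
(* The two terms with [dy *m ddy] between [deltax] and B cancel. What remains acts on the right,
   where with the derivative of [deltay] it produces twice [deltay]. *)
have -> : A *m (dy *m ddy + 1%:M) - (deltax S z *m (dy *m ddy) *m B +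
    deltax S z *m (B *m (dy *m ddy + 1%:M) - dy *m ddy *m B)) =
    (A - deltax S z *m B) *m (dy *m ddy + 1%:M).
  by rewrite [in RHS]mulmxBl [deltax S z *m (_ - _)]mulmxBr !mulmxA [X in _ - X]addrC subrK.
rewrite -mulmxA -mulmxDr scalemxAr; congr (_ *m _).
rewrite mulmxDl -mulmxA ddy_deltay mulmx1 mul1mx.
by rewrite [dy + _]addrC -addrA [dy + _]addrC -deltayE scaler_nat mulr2n.
Qed.

Lemma smooth_curvature : smooth U curvature.
Proof.
apply: smooth_mulmx => //; last exact: smooth_deltay.
apply: smoothD => //; first exact: smooth_derive_S_deltax.
apply/smoothN => //; apply: smooth_mulmx => //; first exact: smooth_deltax.
exact: smooth_jacobian.
Qed.

Lemma ricciE z : U z -> ricci S z = \tr (curvature z).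
Proof.
move=> Uz; rewrite /ricci jacobiE// /dx /Defs.ddy mul_col_mx mul1mx mul0mx.
by rewrite mul_col_row block_mxKur mulmx1.
Qed.

Lemma curvatureE z :
  curvature z = ('D_(S z) (deltax S) z - deltax S z *m 'J S z) *m deltay S z.
Proof. by []. Qed.

(** * The form omega of an isotropic spray *)

Section Isotropic.
Context {b : 'rV[R]_(n + n) -> 'cV[R]_n}.
Hypothesis sb : smooth U b.
Hypothesis y_neq0 : forall z, U z -> z *m dy != 0.
Hypothesis ricci_neq0 : forall z, U z -> ricci S z != 0.
Hypothesis curvature_b : forall z, U z ->
  curvature z = ricci S z *: (1%:M - b z *m (z *m dy)).

(** Multiplying the curvature by y gives 0 = rho (y - (y b) y), where neither rho nor y vanishes. *)
Lemma y_b z : U z -> z *m dy *m b z = 1%:M.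
Proof.
move=> Uz; have := y_curvature Uz; rewrite curvature_b// -scalemxAr.
have [c cE] : exists c, z *m dy *m b z = c%:M.
  by exists ((z *m dy *m b z) 0 0); exact: mx11_scalar.
move/eqP; rewrite scaler_eq0 (negPf (ricci_neq0 Uz)) /= mulmxBr mulmx1.
rewrite (mulmxA _ (b z)) cE mul_scalar_mx -{1}[z *m dy]scale1r -scalerBl scaler_eq0.
by rewrite (negPf (y_neq0 Uz)) orbF subr_eq0 => /eqP <-.
Qed.

(* With alpha / rho = dx *m b, this is i_F (alpha / rho): it spans the annihilator
   of the Berwald distribution and takes the value 1 on the Liouville field. *)
Definition omega z : 'cV[R]_(n + n) := deltay S z *m b z.

Lemma smooth_omega : smooth U omega.
Proof. by apply: smooth_mulmx => //; exact: smooth_deltay. Qed.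

Lemma liouville_omega z : U z -> liouville z *m omega z = 1%:M.
Proof.
move=> Uz; rewrite liouvilleE /omega -!mulmxA [ddy *m _]mulmxA ddy_deltay mul1mx.
by rewrite mulmxA y_b.
Qed.

Lemma is_derive_b z v : U z -> is_derive z v b ('D_v b z).
Proof. by move=> Uz; apply: is_derive_smooth sb Uz. Qed.

Lemma is_derive_liouville_ricci z : U z ->
  is_derive z (liouville z) (ricci S) (2 * ricci S z).
Proof.
move=> Uz; rewrite (ricciE Uz) -mxtraceZ.
apply: (is_derive_ext oU Uz (f := fun x => \tr (curvature x))).
  by move=> x Ux; rewrite (ricciE Ux).
exact/is_derive_trace/is_derive_liouville_curvature.
Qed.

(** Curvature and rho both have degree 2, so the quotient 1 - b y has degree 0: (D_C b + b) y = 0,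
    and pairing with b removes y because y b = 1. *)
Lemma is_derive_liouville_b z : U z -> is_derive z (liouville z) b (- b z).
Proof.
move=> Uz; apply: is_derive_eq (is_derive_b _ Uz) _.
have D := is_derive_scale (is_derive_liouville_ricci Uz) (is_derive_sub
  (is_derive_cst (1%:M : 'M[R]_n) z (liouville z))
  (is_derive_mulmx (is_derive_b (liouville z) Uz) (is_derive_y z (liouville z)))).
have D' : is_derive z (liouville z)
    (fun x => ricci S x *: (1%:M - b x *m (x *m dy))) (2 *: curvature z).
  by apply: is_derive_ext oU Uz _ (is_derive_liouville_curvature Uz); exact: curvature_b.
have /eqP := is_derive_unique D D'.
rewrite curvature_b// scalerA -subr_eq0 /cst addrC addrA addNr add0r sub0r scalerN oppr_eq0.
rewrite scaler_eq0 (negPf (ricci_neq0 Uz)) /= liouvilleE -[z *m _ *m dy]mulmxA.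
rewrite -[dy *m ddy *m dy]mulmxA ddy_dy mulmx1 -mulmxDl => /eqP.
move/(congr1 (mulmx^~ (b z))); rewrite -mulmxA y_b// mulmx1 mul0mx => /eqP.
by rewrite addr_eq0 => /eqP.
Qed.

(** This is L_C omega = 0 in components: the remaining part of the Lie derivative, [dy *m ddy]
    applied to [omega], equals [dy *m b]. *)
Lemma is_derive_liouville_omega z : U z ->
  is_derive z (liouville z) omega (- dy *m b z).
Proof.
move=> Uz; apply: is_derive_eq (is_derive_mulmx
  (is_derive_deltay (is_derive_liouville_N Uz)) (is_derive_liouville_b Uz)) _.
by rewrite mulmxN -mulmxBl deltayE opprD addrA subrr sub0r.
Qed.

Lemma S_omega z : U z -> S z *m omega z = 0.
Proof.
move=> Uz; rewrite (S_deltax Uz) /omega -mulmxA (mulmxA (deltax S z)).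
by rewrite deltax_deltay mul0mx mulmx0.
Qed.

Lemma hproj_omega z : hproj S z *m omega z = 0.
Proof. by rewrite /hproj /omega -mulmxA [deltax S z *m _]mulmxA deltax_deltay mul0mx mulmx0. Qed.

Lemma curvature_mul_b z : U z -> curvature z *m b z = 0.
Proof.
by move=> Uz; rewrite curvature_b// -scalemxAl mulmxBl mul1mx -mulmxA y_b// mulmx1 subrr scaler0.
Qed.

Lemma jacobi_omega z : U z -> jacobi S z *m omega z = 0.
Proof.
move=> Uz; rewrite jacobiE// /omega -(mulmxA (dx *m curvature z)) (mulmxA ddy) ddy_deltay mul1mx.
by rewrite -(mulmxA dx) curvature_mul_b// mulmx0.
Qed.

Lemma berwald_omega z : U z -> berwald S z *m omega z = 0.
Proof.
move=> Uz; have /submxP[Z ->] : (berwald S z <= col_mx (hproj S z) (jacobi S z))%MS.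
  by rewrite /berwald addsmxE.
by rewrite -mulmxA mul_col_mx hproj_omega jacobi_omega// col_mx0 mulmx0.
Qed.

Lemma sub_berwald p (X : 'M[R]_(p, n + n)) z : U z ->
  (X <= berwald S z)%MS = (X *m omega z == 0).
Proof.
move=> Uz; apply/idP/eqP => [/submxP[Y ->]|Xw].
  by rewrite -mulmxA berwald_omega// mulmx0.
have XE : X = X *m hproj S z + (X *m deltay S z) *m ddy.
  by rewrite -mulmxA -/(vproj S z) -mulmxDr hproj_vprojD mulmx1.
have u0 : X *m deltay S z *m b z = 0 by rewrite -mulmxA.
rewrite XE; apply: addmx_sub; first by rewrite (submx_trans (submxMl _ _))// addsmxSl.
(* The vertical part u of X satisfies u b = 0, so the curvature acts on it as rho; hence the
   vertical vector u is the image under Phi of a vector with x part u / rho. *)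
have -> : X *m deltay S z *m ddy =
    (ricci S z)^-1 *: (X *m deltay S z) *m ddx *m jacobi S z.
  set u := X *m _ in u0 *.
  rewrite jacobiE// (mulmxA _ (dx *m curvature z)) (mulmxA _ dx) -(mulmxA (_ *: u) ddx dx).
  rewrite ddx_dx mulmx1.
  rewrite curvature_b// -scalemxAl -scalemxAr scalerA mulVf ?ricci_neq0// scale1r.
  by rewrite mulmxBr mulmx1 (mulmxA u) u0 mul0mx subr0.
by rewrite (submx_trans (submxMl _ _))// addsmxSr.
Qed.

(** As w(X) = w(Y) = 0, the product rule moves the derivatives onto w and gives w([X, Y]) = - dw(X,
    Y). The form w is arbitrary so as to cover both [omega] and the form of condition (iii). *)
Lemma involutive_of_closed (w : V -> 'cV[R]_(n + n)) :
  smooth U w -> (forall z, U z -> d1 w z = 0) ->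
  (forall z (X : V), U z -> (X <= berwald S z)%MS = (X *m w z == 0)) ->
  Defs.involutive U (berwald S).
Proof.
move=> sw w0 kerw W X Y oW WU sX sY XD YD z Wz; have Uz := WU z Wz.
rewrite kerw// /bracket mulmxBl.
have E (A B : V -> V) : smooth W A -> smooth W B -> (forall z, W z -> (B z <= berwald S z)%MS) ->
    'D_(A z) B z *m w z = - (B z *m 'D_(A z) w z).
  move=> sA sB BD.
  have D : is_derive z (A z) (fun x => B x *m w x) 0.
    apply: (is_derive_ext oW Wz _ (is_derive_cst 0 z _)) => x Wx; apply/esym/eqP.
    by rewrite -kerw ?BD//; apply: WU.
  have D' := is_derive_mulmx (is_derive_smooth (A z) sB Wz) (is_derive_smooth (A z) sw Uz).
  by apply/eqP; rewrite -addr_eq0; apply/eqP; apply: is_derive_unique D' D.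
rewrite E// [X in _ - X]E// opprK addrC subr_eq0; apply/eqP.
exact: closed_sym (smooth_differentiable sw Uz) (w0 _ Uz).
Qed.

Lemma closed_of_involutive z :
  Defs.involutive U (berwald S) -> U z -> d1 omega z = 0.
Proof.
move=> invD Uz; have dw := smooth_differentiable smooth_omega Uz.
(* The constant field u projected to D along C. These fields are smooth sections over all of U and
   span D, so no local frame of D has to be chosen. *)
pose X (u : V) x : V := u - u *m omega x *m liouville x.
have sX u : smooth U (X u).
  apply: smoothD => //; first exact: smooth_cst.
  apply/smoothN => //; apply: smooth_mulmx => //; last exact: smooth_liouville.
  by apply: smooth_mulmx => //; [exact: smooth_cst|exact: smooth_omega].
have Xw u x : U x -> X u x *m omega x = 0.
  by move=> Ux; rewrite /X mulmxBl -[_ *m liouville x *m _]mulmxA liouville_omega// mulmx1 subrr.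
have XD u x : U x -> (X u x <= berwald S x)%MS by move=> Ux; rewrite sub_berwald// Xw.
have E u v : X v z *m 'D_(X u z) omega z = - ('D_(X u z) (X v) z *m omega z).
  have D : is_derive z (X u z) (fun x => X v x *m omega x) 0.
    by apply: (is_derive_ext oU Uz _ (is_derive_cst 0 z _)) => x Ux; rewrite Xw.
  have D' := is_derive_mulmx (is_derive_smooth (X u z) (sX v) Uz)
    (is_derive_smooth (X u z) smooth_omega Uz).
  by apply/eqP; rewrite -addr_eq0 addrC; apply/eqP; apply: is_derive_unique D' D.
have XX u v : X u z *m d1 omega z *m (X v z)^T = 0.
  rewrite d1E// E (E v u) opprK addrC -mulmxBl; apply/eqP.
  rewrite -oppr_eq0 -mulNmx opprB -sub_berwald//.
  by apply: (invD U (X u) (X v)) => // x Ux; apply: XD.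
have CX (v : V) : liouville z *m d1 omega z *m v^T = 0.
  rewrite d1E// (@derive_val _ _ _ _ _ _ _ (is_derive_liouville_omega Uz)).
  have D : is_derive z v (fun x => liouville x *m omega x) 0.
    by apply: (is_derive_ext oU Uz _ (is_derive_cst 1%:M z _)) => x Ux; rewrite liouville_omega.
  have D' := is_derive_mulmx (is_derive_liouville z v)
    (is_derive_smooth v smooth_omega Uz).
  have E0 : v *m (dy *m ddy) *m omega z + liouville z *m 'D_v omega z = 0.
    exact: is_derive_unique D' D.
  have E1 : v *m (dy *m ddy) *m omega z = v *m (dy *m b z).
    by rewrite -(mulmxA v) -(mulmxA dy) /omega (mulmxA ddy) ddy_deltay mul1mx.
  by rewrite mulNmx mulmxN -opprD -E1 E0 oppr0.
have XC (u : V) : u *m d1 omega z *m (liouville z)^T = 0.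
  apply: trmx_inj; rewrite trmx0 (trmx_mul (u *m _)) (trmx_mul u) trmxK mulmxA.
  have -> : (d1 omega z)^T = - d1 omega z.
    by rewrite d1_gradmx linearB /= trmxK opprB.
  by rewrite mulmxN mulNmx CX oppr0.
have uE (u : V) : u = X u z + u *m omega z *m liouville z by rewrite subrK.
apply: bilinear_eq0 => u v.
rewrite {1}(uE u) mulmxDl (mulmxDl (X u z *m _)).
rewrite -(mulmxA (u *m _) (liouville z)) -(mulmxA (u *m omega z)) CX mulmx0 addr0.
rewrite {1}(uE v) linearD mulmxDr [LHS]addrC /= (trmx_mul (v *m _)) mulmxA XC mul0mx add0r.
exact: XX.
Qed.

Lemma y_gradmx_b z : U z -> z *m dy *m (ddy *m gradmx b z) = - (b z)^T.
Proof.
move=> Uz; apply: trmx_inj; rewrite linearN /= trmxK !mulmxA -(mulmxA z) -liouvilleE.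
exact: (is_derive_unique (is_derive_gradmx (liouville z) sb Uz) (is_derive_liouville_b Uz)).
Qed.

(* The Hessian of F in y, divided by F, when alpha / rho = d_J log F. As b is
   (-1)-homogeneous, y kills it, so the invertibility of hess + k b b^T does not
   depend on k <> 0: k = 1 is the metric, k = -3 the rank condition (iii). *)
Definition hess z : 'M[R]_n := ddy *m gradmx b z + b z *m (b z)^T.

Lemma y_hess z : U z -> z *m dy *m hess z = 0.
Proof. by move=> Uz; rewrite /hess mulmxDr y_gradmx_b// mulmxA y_b// mul1mx addNr. Qed.

Lemma gradmx_dx (c : V -> 'cV[R]_n) z : smooth U c -> U z ->
  gradmx (fun z => dx *m c z) z = gradmx c z *m dx^T.
Proof.
move=> sc Uz; apply: gradmxP => v; rewrite mulmxA trmx_mul trmxK.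
exact/is_derive_mulmxl/is_derive_gradmx.
Qed.

(** Both summands have the shape A dx^T - dx A^T, that of a 2-form vanishing on pairs of vertical
    vectors. It serves with k = 2 for [Omega] and with k = -2 for condition (iii). *)
Lemma rank_semibasic_form (c : V -> 'cV[R]_n) (p q : 'cV[R]_n) k z :
  smooth U c -> U z ->
  (\rank (d1 (fun z => dx *m c z) z + k *: wedge (deltay S z *m p) (dx *m q))%R == (n + n)%N) =
  (ddy *m gradmx c z + k *: (p *m q^T) \in unitmx).
Proof.
move=> sc Uz; pose A := gradmx c z + k *: (deltay S z *m p *m q^T).
have -> : d1 (fun z => dx *m c z) z + k *: wedge (deltay S z *m p) (dx *m q) =
    A *m dx^T - dx *m A^T.
  rewrite d1_gradmx gradmx_dx// /A.
  set B := gradmx c z; set C := _ *m p.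
  have -> : wedge C (dx *m q) = C *m q^T *m dx^T - dx *m (q *m C^T).
    by rewrite /wedge trmx_mul !mulmxA.
  have -> : (B + k *: (C *m q^T))^T = B^T + k *: (q *m C^T).
    by rewrite linearD linearZ /= trmx_mul trmxK.
  rewrite trmx_mul trmxK mulmxDl mulmxDr -scalemxAl -scalemxAr.
  by rewrite scalerBr opprD addrACA.
rewrite rank_semibasic.
suff -> : ddy *m A = ddy *m gradmx c z + k *: (p *m q^T) by [].
by rewrite /A mulmxDr -scalemxAr !mulmxA ddy_deltay mul1mx.
Qed.

Lemma d1_ext (f g : V -> 'cV[R]_(n + n)) z :
  U z -> (forall x, U x -> f x = g x) -> d1 f z = d1 g z.
Proof.
move=> Uz fg; have E v : 'D_v f z = 'D_v g z := derive_ext v oU Uz fg.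
by apply/matrixP => i j; rewrite !mxE !E.
Qed.

Lemma rank_Omega (alpha : V -> 'cV[R]_(n + n)) z :
  (forall z, U z -> (ricci S z)^-1 *: alpha z = dx *m b z) -> U z ->
  (\rank (Omega S alpha z) == (n + n)%N) = (hess z + 1 *: (b z *m (b z)^T) \in unitmx).
Proof.
move=> aE Uz.
have Fb : almost_complex S z *m (dx *m b z) = deltay S z *m b z.
  rewrite /almost_complex mulmxBl -(mulmxA dx ddy) (mulmxA ddy) ddy_dx mul0mx mulmx0 subr0.
  by rewrite -(mulmxA (deltay S z)) (mulmxA (deltax S z)) deltax_dx mul1mx.
have -> : Omega S alpha z = d1 (fun z => dx *m b z) z +
    2 *: wedge (deltay S z *m b z) (dx *m b z).
  apply: congr2 (d1_ext Uz aE) _; congr (2 *: _).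
  by rewrite (aE z Uz) Fb.
rewrite rank_semibasic_form//.
suff -> : ddy *m gradmx b z + 2 *: (b z *m (b z)^T) =
  hess z + 1 *: (b z *m (b z)^T) by [].
by rewrite /hess scale1r -addrA -mulr2n scaler_nat.
Qed.

(** For closed w, d_J w reduces to - d (i_J w); changing the overall sign preserves the rank and
    turns the coefficient 2 into -2. *)
Lemma rank_dJ1 (w : V -> 'cV[R]_(n + n)) (c : V -> 'cV[R]_n) z :
  smooth U c -> (forall z, U z -> w z = deltay S z *m c z) -> d1 w z = 0 -> U z ->
  (\rank (dJ1 w z + 2 *: wedge (w z) (J *m w z))%R == (n + n)%N) =
  (ddy *m gradmx c z + (- 2) *: (c z *m (c z)^T) \in unitmx).
Proof.
move=> sc wE w0 Uz.
have JwE x : U x -> J *m w x = dx *m c x.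
  by move=> Ux; rewrite wE// /J -(mulmxA dx) (mulmxA ddy) ddy_deltay mul1mx.
rewrite /dJ1 w0 /iJ2 mulmx0 mul0mx addr0 sub0r.
rewrite (d1_ext (g := fun z => dx *m c z) Uz JwE) JwE// wE//.
rewrite -rank_semibasic_form// -mxrank_opp opprD opprK; congr (\rank (_ + _)%R == _).
by rewrite scaleNr.
Qed.

Lemma closed_annihilator (w : V -> 'cV[R]_(n + n)) : (1 < n)%N -> smooth U w ->
  (forall z, U z -> berwald S z *m w z = 0) -> (forall z, U z -> d1 w z = 0) ->
  (forall z, U z -> \rank (dJ1 w z + 2 *: wedge (w z) (J *m w z))%R = (n + n)%N) ->
  forall z, U z -> d1 omega z = 0 /\ hess z + 1 *: (b z *m (b z)^T) \in unitmx.
Proof.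
move=> n1 sw Dw w0 rw.
pose c z := ddy *m w z; pose f z := (z *m dy *m c z) 0 0.
have Dh z : U z -> hproj S z *m w z = 0 /\ jacobi S z *m w z = 0.
  move=> Uz; have h1 : (hproj S z <= berwald S z)%MS by exact: addsmxSl.
  have h2 : (jacobi S z <= berwald S z)%MS by exact: addsmxSr.
  by split; [have /submxP[X ->] := h1|have /submxP[X ->] := h2];
    rewrite -mulmxA Dw ?mulmx0.
have wc z : U z -> w z = deltay S z *m c z.
  move=> Uz; rewrite -[LHS]mul1mx -(hproj_vprojD z) mulmxDl (Dh _ Uz).1 add0r.
  by rewrite /vproj -mulmxA.
(* As w kills the image of Phi, the curvature kills c, and rho (c - b (y c)) = 0 gives c = f b with
   f = y c = w(C). *)
have cfb z : U z -> c z = f z *: b z.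
  move=> Uz; have Rc : curvature z *m c z = 0.
    have := (Dh _ Uz).2; rewrite jacobiE// -mulmxA => /(congr1 (mulmx ddx)).
    by rewrite mulmx0 -(mulmxA dx) mulmxA ddx_dx mul1mx.
  move: Rc; rewrite curvature_b// -scalemxAl => /eqP.
  rewrite scaler_eq0 (negPf (ricci_neq0 Uz)) /= mulmxBl mul1mx subr_eq0 => /eqP.
  by rewrite -mulmxA [_ *m c z]mx11_scalar -/(f z) mul_mx_scalar.
have sc : smooth U c by apply: smooth_mulmx => //; exact: smooth_cst.
have sf : smooth U f.
  apply: smooth_entry => //; apply: smooth_mulmx => //.
  by apply: smooth_mulmx => //; [exact: smooth_id|exact: smooth_cst].
(* Everything that multiplies b^T on the left once c = f b is differentiated; the term - f b
   compensates the b b^T contained in [hess]. *)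
pose s z := ddy *m d0 f z + (- f z - 2 * f z ^+ 2) *: b z.
have QE z : U z -> ddy *m gradmx c z + (- 2) *: (c z *m (c z)^T) =
    f z *: hess z + s z *m (b z)^T.
  move=> Uz.
  have -> : gradmx c z = d0 f z *m (b z)^T + f z *: gradmx b z.
    apply: gradmxP => v.
    apply: (is_derive_ext oU Uz (f := fun x => f x *: b x)) => [x Ux|].
      by rewrite cfb.
    apply: is_derive_eq (is_derive_scale (is_derive_d0 v sf Uz)
      (is_derive_gradmx v sb Uz)) _.
    rewrite mulmxDr -scalemxAr linearD linearZ /=; congr (_ + _).
    by rewrite mulmxA [v *m d0 f z]mx11_scalar mul_scalar_mx linearZ /= trmxK mxE eqxx.
  rewrite /s /hess cfb// linearZ /= -scalemxAl -scalemxAr mulmxDr mulmxDl -!scalemxAr.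
  rewrite -scalemxAl scalerDr !scalerA mulmxA.
  rewrite [RHS]addrC -!addrA; congr (_ + _); rewrite [RHS]addrCA; congr (_ + _).
  by rewrite -scalerDl; congr (_ *: _); rewrite expr2; ring.
have Qu z : U z -> f z *: hess z + s z *m (b z)^T \in unitmx.
  by move=> Uz; rewrite -QE// -(rank_dJ1 sc wc (w0 _ Uz) Uz) rw.
have f0 z : U z -> f z != 0.
  (* At a zero of f the invertible matrix would be s b^T, of rank at most 1, while n > 1. *)
  move=> Uz; apply/eqP => fz0; have := Qu _ Uz; rewrite fz0 scale0r add0r.
  rewrite -row_free_unit /row_free => /eqP rn.
  by have := leq_trans (mxrankM_maxr (s z) (b z)^T) (rank_leq_row _); rewrite rn leqNgt n1.
move=> z Uz; split; last first.
  by apply: unitmx_add_rank1 (oner_neq0 _) (y_hess Uz) (y_b Uz) (Qu z Uz).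
(* Closedness does not pass from f omega to omega by division; it goes through the involutivity of
   their common kernel. *)
apply: closed_of_involutive => //; apply: (involutive_of_closed sw w0) => x X Ux.
rewrite sub_berwald// wc// cfb// -scalemxAr -scalemxAr scaler_eq0 (negPf (f0 _ Ux)) /=.
by [].
Qed.

Lemma rank_dJ1_omega z : U z -> d1 omega z = 0 ->
  hess z + 1 *: (b z *m (b z)^T) \in unitmx ->
  \rank (dJ1 omega z + 2 *: wedge (omega z) (J *m omega z))%R = (n + n)%N.
Proof.
move=> Uz w0 hu; apply/eqP; rewrite (rank_dJ1 (c := b))//.
have -> : ddy *m gradmx b z + - 2 *: (b z *m (b z)^T) =
    hess z + (- 3) *: (b z *m (b z)^T).
  rewrite /hess -addrA -[X in _ = _ + (X + _)]scale1r -scalerDl; congr (_ + _ *: _).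
  ring.
have n3 : - 3 != 0 :> R by rewrite oppr_eq0 pnatr_eq0.
apply: (unitmx_add_rank1 (f := 1) (s := b z) n3 (y_hess Uz) (y_b Uz)).
by rewrite scale1r -[b z *m _]scale1r.
Qed.

(** S is (y, - 2 G) in coordinates, and the vertical derivative of G is N. *)
Lemma jacobian_S_vertical z : U z -> ddy *m 'J S z = ddx - 2 *: N z *m ddy.
Proof.
move=> Uz; apply: eq_frame; apply: eq_mulmx_row => u.
  rewrite mulmxBl ddx_dx -(mulmxA _ ddy) ddy_dx mulmx0 subr0 mulmx1 mulmxA (mulmxA u).
  have D : is_derive z (u *m ddy) (fun x => S x *m dx) (u *m ddy *m dy).
    apply: (is_derive_ext oU Uz (f := fun x => x *m dy)); last exact: is_derive_y.
    by move=> x Ux; rewrite S_dx.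
  rewrite -(is_derive_unique D (is_derive_mulmxr dx (is_derive_S _ Uz))).
  by rewrite -mulmxA ddy_dy mulmx1.
rewrite mulmxBl ddx_dy -(mulmxA _ ddy) ddy_dy mulmx1 sub0r mulmxA (mulmxA u).
have E : (fun x => S x *m dy) = (fun x => - 2 *: G S x) by apply/funext => x; rewrite S_dy.
have D : is_derive z (u *m ddy) (fun x => S x *m dy) (- 2 *: (u *m N z)).
  by rewrite E; apply: is_deriveZ; apply: derive_vertical_G.
rewrite -(is_derive_unique D (is_derive_mulmxr dy (is_derive_S _ Uz))).
by rewrite mulmxN -scalemxAr scaleNr.
Qed.

Lemma is_derive_d0_scalar (f : V -> R) z v : smooth U f -> U z ->
  is_derive z v (fun x => (f x)%:M : 'M[R]_1) (v *m d0 f z).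
Proof.
by move=> sf Uz; rewrite [v *m _]mx11_scalar; apply/is_derive_scalar1/is_derive_d0.
Qed.

(** * Finsler functions and the form omega *)

Section Finsler.
Context {F : 'rV[R]_(n + n) -> R}.
Hypothesis sF : smooth U F.
Let L z := F z ^+ 2.

Lemma smooth_sqr : smooth U L.
Proof.
have -> : L = fun z => F z * F z by apply/funext => z; rewrite /L expr2.
exact: smoothM.
Qed.

Lemma d0_sqr z : U z -> d0 L z = (2 * F z) *: d0 F z.
Proof.
move=> Uz; apply: eq_mulmx_row => v; rewrite -scalemxAr.
rewrite [LHS]mx11_scalar [v *m d0 F z]mx11_scalar scale_scalar_mx; congr (_%:M).
apply: is_derive_unique (is_derive_d0 v smooth_sqr Uz) _.
have -> : L = fun z => F z * F z by apply/funext => x; rewrite /L expr2.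
apply: is_derive_eq (is_derive_mul (is_derive_d0 v sF Uz) (is_derive_d0 v sF Uz)) _.
by ring.
Qed.

Let l z := ddy *m d0 L z.

Lemma dJ0_sqr : dJ0 L = fun z => dx *m l z.
Proof. by apply/funext => z; rewrite /dJ0 /J mulmxA. Qed.

Lemma is_derive_d0L z v : U z -> is_derive z v (d0 L) ('D_v (d0 L) z).
Proof. by move=> Uz; apply: is_derive_smooth (smooth_d0 oU smooth_sqr) Uz. Qed.

Lemma is_derive_l z v : U z -> is_derive z v l (ddy *m 'D_v (d0 L) z).
Proof. by move=> Uz; apply/is_derive_mulmxl/is_derive_d0L. Qed.

Lemma S_d1_dJ0 z v : U z ->
  S z *m d1 (dJ0 L) z *m v^T =
  v *m (dx *m (ddy *m 'D_(S z) (d0 L) z)) - z *m dy *m (ddy *m 'D_v (d0 L) z).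
Proof.
move=> Uz; have D u : is_derive z u (dJ0 L) (dx *m (ddy *m 'D_u (d0 L) z)).
  by rewrite dJ0_sqr; apply/is_derive_mulmxl/is_derive_l.
have sd : smooth U (dJ0 L).
  by apply: smooth_mulmx => //; [exact: smooth_cst|exact: smooth_d0 smooth_sqr].
rewrite (d1E _ _ (smooth_differentiable sd Uz)).
rewrite (@derive_val _ _ _ _ _ _ _ (D (S z))) (@derive_val _ _ _ _ _ _ _ (D v)).
by rewrite (mulmxA (S z)) S_dx.
Qed.

Section EulerLagrange.
Hypothesis F_pos : forall z, U z -> 0 < F z.
Hypothesis F_homogeneous : forall z, U z -> is_derive z (liouville z) F (F z).
Hypothesis EL : forall z, U z -> (S z *m d1 (dJ0 L) z)^T = - d0 L z.

Lemma y_l z : U z -> z *m dy *m l z = (2 * L z)%:M.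
Proof.
move=> Uz; rewrite /l mulmxA -(mulmxA z) -liouvilleE [LHS]mx11_scalar; congr (_%:M).
apply: is_derive_unique (is_derive_d0 (liouville z) smooth_sqr Uz) _.
have -> : L = fun z => F z * F z by apply/funext => x; rewrite /L expr2.
apply: is_derive_eq (is_derive_mul (F_homogeneous Uz) (F_homogeneous Uz)) _.
by ring.
Qed.

Lemma derive_y_l z v : U z ->
  v *m dy *m l z + z *m dy *m (ddy *m 'D_v (d0 L) z) = 2 *: (v *m d0 L z).
Proof.
move=> Uz.
have D : is_derive z v (fun x => x *m dy *m l x) (2 *: (v *m d0 L z)).
  apply: (is_derive_ext oU Uz (f := fun x => 2 *: (L x)%:M)).
    by move=> x Ux; rewrite y_l// scale_scalar_mx.
  by apply: is_deriveZ; apply: is_derive_d0_scalar smooth_sqr Uz.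
exact: is_derive_unique (is_derive_mulmx (is_derive_y z v) (is_derive_l v Uz)) D.
Qed.

(** The classical form of the Euler-Lagrange equations, the derivative of dL/dy along S being dL/dx:
    the invariant equation is evaluated on d/dx and Euler's identity, differentiated along x,
    replaces the term in y. *)
Lemma derive_S_l z : U z -> ddy *m 'D_(S z) (d0 L) z = ddx *m d0 L z.
Proof.
move=> Uz; apply: eq_mulmx_row => u.
have := S_d1_dJ0 (u *m ddx) Uz.
have -> : S z *m d1 (dJ0 L) z *m (u *m ddx)^T = - (u *m ddx *m d0 L z).
  by rewrite -[LHS]trmx11 (trmx_mul (S z *m _)) trmxK EL// mulmxN.
have := derive_y_l (u *m ddx) Uz.
rewrite -(mulmxA u ddx dy) ddx_dy mulmx0 mul0mx add0r => ->.
rewrite (mulmxA (u *m ddx)) -(mulmxA u ddx dx) ddx_dx mulmx1 => /esym/eqP.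
rewrite subr_eq scaler_nat mulr2n addKr => /eqP ->.
by rewrite mulmxA.
Qed.

(** Conservation of energy: differentiating Euler's identity along S gives S(L) = 2 S(L). *)
Lemma S_d0L z : U z -> S z *m d0 L z = 0.
Proof.
move=> Uz; have := derive_y_l (S z) Uz; rewrite derive_S_l//.
have -> : S z *m dy *m l z + z *m dy *m (ddx *m d0 L z) = S z *m d0 L z.
  have -> : S z *m dy *m l z = S z *m (dy *m ddy) *m d0 L z.
    by rewrite (mulmxA (S z) dy ddy) -(mulmxA (S z *m dy) ddy).
  have -> : z *m dy *m (ddx *m d0 L z) = S z *m (dx *m ddx) *m d0 L z.
    by rewrite -(S_dx Uz) (mulmxA (S z) dx ddx) -(mulmxA (S z *m dx) ddx).
  by rewrite -mulmxDl -mulmxDr addrC dx_ddxD mulmx1.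
by rewrite scaler_nat mulr2n => /eqP; rewrite -subr_eq subrr eq_sym => /eqP.
Qed.

Lemma derive_S_d0L z : U z -> 'D_(S z) (d0 L) z = - ('J S z *m d0 L z).
Proof.
move=> Uz; apply: eq_mulmx_row => v.
have D : is_derive z v (fun x => S x *m d0 L x) 0.
  by apply: (is_derive_ext oU Uz _ (is_derive_cst 0 z v)) => x Ux; rewrite S_d0L.
have E : v *m 'J S z *m d0 L z + S z *m 'D_v (d0 L) z = 0.
  exact: is_derive_unique (is_derive_mulmx (is_derive_S v Uz) (is_derive_d0L v Uz)) D.
rewrite (d0_symmetric oU v (S z) smooth_sqr Uz) mulmxN mulmxA.
by apply/eqP; rewrite -addr_eq0 addrC E.
Qed.

(** The vertical derivative of S(L) = 0 gives D_S(dL/dy) = - (dL/dx - 2 N dL/dy). By Euler-Lagrange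
    the left side is dL/dx, so twice the horizontal derivative of L vanishes. *)
Lemma deltax_d0L z : U z -> deltax S z *m d0 L z = 0.
Proof.
move=> Uz; have := derive_S_l Uz; rewrite derive_S_d0L// mulmxN mulmxA jacobian_S_vertical//.
rewrite deltaxE !mulmxBl -!scalemxAl => E.
have n2 : 2 != 0 :> R by rewrite pnatr_eq0.
have aux (a c : 'cV[R]_n) : - (a - 2 *: c) = a -> a - c = 0.
  move=> /eqP; rewrite opprB subr_eq -mulr2n -[a *+ 2](scaler_nat 2 a) => /eqP.
  by move/(scalerI n2) => ->; rewrite subrr.
exact: aux.
Qed.

Lemma d0_eq_omega z : U z -> d0 F z = F z *: omega z.
Proof.
move=> Uz.
have dE x : U x -> d0 L x = deltay S x *m l x.
  move=> Ux; rewrite -[LHS]mul1mx -(hproj_vprojD x) mulmxDl /hproj -(mulmxA dx).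
  by rewrite deltax_d0L// mulmx0 add0r /vproj -mulmxA.
have D : is_derive z (S z) (fun x => deltax S x *m d0 L x) 0.
  by apply: (is_derive_ext oU Uz _ (is_derive_cst 0 z _)) => x Ux; rewrite deltax_d0L.
have E : 'D_(S z) (deltax S) z *m d0 L z + deltax S z *m 'D_(S z) (d0 L) z = 0.
  exact: is_derive_unique (is_derive_mulmx (is_derive_deltax _ Uz) (is_derive_d0L _ Uz)) D.
(* Since ['D_(S z) (d0 L) z] is minus ['J S z] applied to [d0 L], the derivative of [deltax_d0L]
   along S is exactly the curvature applied to l. Then l is the multiple (y l) b = 2 L b of b. *)
have Rl : curvature z *m l z = 0.
  rewrite curvatureE -mulmxA -dE// mulmxBl -(mulmxA (deltax S z)) -mulmxN.
  by rewrite -derive_S_d0L.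
move: Rl; rewrite curvature_b// -scalemxAl => /eqP.
rewrite scaler_eq0 (negPf (ricci_neq0 Uz)) /= mulmxBl mul1mx subr_eq0 => /eqP.
rewrite -mulmxA y_l// mul_mx_scalar => lE.
have := dE _ Uz; rewrite lE d0_sqr// -scalemxAr => FE.
have F0 : F z != 0 by rewrite gt_eqF ?F_pos.
have F2 : 2 * F z != 0 by rewrite mulf_neq0// pnatr_eq0.
apply: (scalerI F2); rewrite FE /L scalerA; congr (_ *: _).
by rewrite expr2 mulrA.
Qed.

End EulerLagrange.

Section Exact.
Hypothesis dF : forall z, U z -> d0 F z = F z *: omega z.
Hypothesis F_pos : forall z, U z -> 0 < F z.

Lemma closed_of_exact z : U z -> d1 omega z = 0.
Proof.
move=> Uz; have F0 : F z != 0 by rewrite gt_eqF ?F_pos.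
have D v : is_derive z v (d0 F)
    ((F z * (v *m omega z) 0 0) *: omega z + F z *: 'D_v omega z).
  apply: (is_derive_ext oU Uz (f := fun x => F x *: omega x)) => [x Ux|].
    by rewrite dF.
  have -> : F z * (v *m omega z) 0 0 = (v *m d0 F z) 0 0.
    by rewrite dF// -scalemxAr [RHS]mxE.
  apply: is_derive_scale; first exact: is_derive_d0 sF Uz.
  exact: is_derive_smooth smooth_omega Uz.
apply: bilinear_eq0 => u v; apply: (scalerI F0); rewrite scaler0.
rewrite (d1E _ _ (smooth_differentiable smooth_omega Uz)).
(* In the symmetric second derivative of F the terms F omega(u) omega(v) are symmetric themselves;
   they cancel and leave F d omega = 0. *)
have aux (f : R) (c P Q : 'cV[R]_(n + n)) :
    u *m ((f * (v *m c) 0 0) *: c + f *: P) = v *m ((f * (u *m c) 0 0) *: c + f *: Q) ->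
    f *: (v *m Q - u *m P) = 0.
  have [x ux] : exists x, u *m c = x%:M by exists ((u *m c) 0 0); exact: mx11_scalar.
  have [y vy] : exists y, v *m c = y%:M by exists ((v *m c) 0 0); exact: mx11_scalar.
  rewrite !mulmxDr -!scalemxAr ux vy [x%:M 0 0]mxE [y%:M 0 0]mxE eqxx !mulr1n.
  rewrite !scale_scalar_mx -!mulrA [y * x]mulrC => /addrI E.
  by rewrite scalerBr E subrr.
apply: aux.
apply: etrans (congr1 (mulmx u) (esym (@derive_val _ _ _ _ _ _ _ (D v)))) _.
apply: etrans (d0_symmetric oU u v sF Uz) _.
by have [_ ->] := D u.
Qed.

(** The y derivatives of F^2 are 2 F^2 b; differentiating again and halving gives F^2 (d b / d y + 2
    b b^T), and [hess] already contains one of the two b b^T. *)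
Lemma metric_exact z : U z ->
  metric F z = F z ^+ 2 *: (hess z + 1 *: (b z *m (b z)^T)).
Proof.
move=> Uz; apply/matrixP => i j; rewrite mxE.
have E1 x : U x -> 'D_(ey j) L x = 2 * (F x * F x) * b x j 0.
  move=> Ux; rewrite (@derive_val _ _ _ _ _ _ _ (is_derive_d0 (ey j) smooth_sqr Ux)).
  rewrite d0_sqr// dF// -!scalemxAr scalerA [LHS]mxE /ey /omega mulmxA -(mulmxA _ ddy).
  by rewrite ddy_deltay mulmx1 -rowE mxE mulrA.
have Dey (v : 'rV[R]_n) : (v *m ddy *m d0 F z) 0 0 = F z * (v *m b z) 0 0.
  by rewrite dF// -scalemxAr [LHS]mxE /omega mulmxA -(mulmxA v) ddy_deltay mulmx1.
have DF := is_derive_d0 (ey i) sF Uz; rewrite Dey -rowE mxE in DF.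
have Db := is_derive_entry j 0 (is_derive_gradmx (ey i) sb Uz).
have D : is_derive z (ey i) (fun x => 'D_(ey j) L x)
    (2 * (F z * b z i 0 * F z + F z * (F z * b z i 0)) * b z j 0 +
     2 * (F z * F z) * (ddy *m gradmx b z) i j).
  apply: (is_derive_ext oU Uz (f := fun x => 2 * (F x * F x) * b x j 0)).
    by move=> x Ux; rewrite E1.
  have -> : (ddy *m gradmx b z) i j = (ey i *m gradmx b z)^T j 0.
    by rewrite [RHS]mxE /ey -mulmxA -rowE [RHS]mxE.
  apply: is_derive_mul Db.
  have := is_derive_mul (is_derive_cst (2 : R) z (ey i)) (is_derive_mul DF DF).
  by rewrite mul0r add0r.
rewrite (@derive_val _ _ _ _ _ _ _ D) /hess scale1r !mxE !big_ord_recl !big_ord0 !mxE.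
by field.
Qed.

(** Closedness and omega(S) = 0 give D_S omega = - ['J S] omega. The vertical part of this equation
    is - (N b - 2 N b). *)
Lemma derive_S_b z : U z -> 'D_(S z) b z = N z *m b z.
Proof.
move=> Uz; have w0 := closed_of_exact Uz.
have Dw : 'D_(S z) omega z = - ('J S z *m omega z).
  apply: eq_mulmx_row => v.
  have D : is_derive z v (fun x => S x *m omega x) 0.
    by apply: (is_derive_ext oU Uz _ (is_derive_cst 0 z v)) => x Ux; rewrite S_omega.
  have E : v *m 'J S z *m omega z + S z *m 'D_v omega z = 0.
    exact: is_derive_unique (is_derive_mulmx (is_derive_S v Uz)
      (is_derive_smooth v smooth_omega Uz)) D.
  rewrite (closed_sym v (S z) (smooth_differentiable smooth_omega Uz) w0) in E.
  by apply/eqP; rewrite mulmxN mulmxA -addr_eq0 addrC E.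
have Db : is_derive z (S z) b (ddy *m 'D_(S z) omega z).
  have -> : b = fun x => ddy *m omega x.
    by apply/funext => x; rewrite /omega mulmxA ddy_deltay mul1mx.
  exact/is_derive_mulmxl/(is_derive_smooth (S z) smooth_omega Uz).
rewrite (@derive_val _ _ _ _ _ _ _ Db) Dw mulmxN mulmxA jacobian_S_vertical//.
rewrite mulmxBl -(mulmxA _ ddy) /omega (mulmxA ddy) ddy_deltay mul1mx deltayE.
rewrite (mulmxA ddx) mulmxDr mulmxA ddx_dx ddx_dy mul1mx addr0 -scalemxAl opprB.
by rewrite scaler_nat mulr2n addrK.
Qed.

(** With l = 2 L b and S(L) = 0, the derivative of l along S is 2 L N b by [derive_S_b], and y b = 1
    determines y paired with the derivative of l along v. *)
Lemma EL_of_exact z : U z -> (S z *m d1 (dJ0 L) z)^T = - d0 L z.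
Proof.
move=> Uz; apply: eq_mulmx_row => v; rewrite mulmxN.
rewrite -[LHS]trmx11 trmx_mul trmxK S_d1_dJ0//.
have dL x : U x -> d0 L x = (2 * L x) *: omega x.
  by move=> Ux; rewrite d0_sqr// dF// scalerA /L expr2 mulrA.
have lE x : U x -> l x = (2 * L x) *: b x.
  by move=> Ux; rewrite /l dL// -scalemxAr /omega mulmxA ddy_deltay mul1mx.
have Dl u : ddy *m 'D_u (d0 L) z =
    (2 * (u *m d0 L z) 0 0) *: b z + (2 * L z) *: 'D_u b z.
  apply: is_derive_unique (is_derive_l u Uz) _.
  apply: (is_derive_ext oU Uz (f := fun x => (2 * L x) *: b x)).
    by move=> x Ux; rewrite lE.
  apply: is_derive_scale; last exact: is_derive_b.
  have := is_derive_mul (is_derive_cst (2 : R) z u) (is_derive_d0 u smooth_sqr Uz).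
  by rewrite mul0r add0r.
have Sw : S z *m d0 L z = 0.
  by rewrite dL// -scalemxAr S_omega// scaler0.
have yDb : z *m dy *m 'D_v b z = - (v *m dy *m b z).
  have D : is_derive z v (fun x => x *m dy *m b x) 0.
    by apply: (is_derive_ext oU Uz _ (is_derive_cst 1%:M z v)) => x Ux; rewrite y_b.
  have E : v *m dy *m b z + z *m dy *m 'D_v b z = 0.
    exact: is_derive_unique (is_derive_mulmx (is_derive_y z v) (is_derive_b v Uz)) D.
  by apply/eqP; rewrite -addr_eq0 addrC E.
have T1 : ddy *m 'D_(S z) (d0 L) z = (2 * L z) *: (N z *m b z).
  apply: etrans (Dl (S z)) _.
  by rewrite Sw derive_S_b// [X in 2 * X]mxE mulr0 scale0r add0r.
have T2 : z *m dy *m (ddy *m 'D_v (d0 L) z) =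
    (2 * (v *m d0 L z) 0 0)%:M - (2 * L z) *: (v *m dy *m b z).
  apply: etrans (congr1 (mulmx (z *m dy)) (Dl v)) _.
  by rewrite mulmxDr -!scalemxAr yDb y_b// scalemx1 scalerN.
apply: etrans (congr2 (fun A B => v *m (dx *m A) - B) T1 T2) _.
(* The terms in N b and in b recombine into [omega], so 2 L omega(v) - 2 dL(v) = - dL(v). *)
have T3 : v *m (dx *m (N z *m b z)) + v *m dy *m b z = v *m omega z.
  by rewrite /omega deltayE -(mulmxA v dy) -mulmxDr mulmxDl mulmxA.
rewrite -!scalemxAr opprD opprK addrCA -scalerDr T3 scalemxAr -dL//.
have aux (X : 'M[R]_1) : - (2 * X 0 0)%:M + X = - X.
  rewrite [X in _ + X]mx11_scalar [X in _ = - X]mx11_scalar; move: (X 0 0) => x.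
  by apply/matrixP => i j; rewrite !ord1 !mxE eqxx !mulr1n; ring.
exact: aux.
Qed.

End Exact.
End Finsler.
End Isotropic.
End LocalSpray.

Arguments curvature {R n} S z.
Arguments omega {R n} S b z.
Arguments hess {R n} b z.

(** * Change of coordinates *)

Section Tensoriality.
Context {R : realType} {n : nat} {U U' : set 'rV[R]_(n + n)}
  {S S' T : 'rV[R]_(n + n) -> 'rV[R]_(n + n)} {A : 'rV[R]_(n + n) -> 'M[R]_n}.
Local Notation V := 'rV[R]_(n + n).
Local Notation dx := (dx : 'M[R]_(n + n, n)).
Local Notation dy := (dy : 'M[R]_(n + n, n)).
Local Notation ddy := (ddy : 'M[R]_(n, n + n)).
Local Notation K := (jacobian T).

Hypotheses (oU : open U) (oU' : open U').
Hypotheses (sS : smooth U S) (sS' : smooth U' S').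
Hypothesis S_J : forall z, U z -> S z *m J = liouville z.
Hypothesis S_J' : forall z, U' z -> S' z *m J = liouville z.
Hypothesis S_homogeneous : forall z, U z -> bracket liouville S z = S z.
Hypothesis S_homogeneous' : forall z, U' z -> bracket liouville S' z = S' z.
Hypotheses (sT : smooth U T) (sA : smooth U A).
Hypothesis TU : forall z, U z -> U' (T z).
Hypothesis T_y : forall z, U z -> T z *m dy = z *m dy *m A z.
Hypothesis K_dx : forall z, U z -> K z *m dx = dx *m A z.
Hypothesis S_T : forall z, U z -> S' (T z) = S z *m K z.

Lemma is_derive_T z v : U z -> is_derive z v T (v *m K z).
Proof. by move=> Uz; apply: is_derive_jacobian sT Uz. Qed.

Lemma is_derive_comp_T p q (f : V -> 'M[R]_(p, q)) z v df :
  smooth U' f -> U z -> is_derive (T z) (v *m K z) f df ->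
  is_derive z v (fun x => f (T x)) df.
Proof.
move=> sf Uz [_ <-]; have dT := smooth_differentiable sT Uz.
have df' := smooth_differentiable sf (TU Uz).
split; first exact/diff_derivable/(differentiable_comp dT df').
apply: etrans (derive_comp v dT df') _.
by rewrite deriveEjacobian.
Qed.

Lemma is_derive_K z v : U z -> is_derive z v K ('D_v K z).
Proof. by move=> Uz; apply: is_derive_smooth (smooth_jacobian oU sT) Uz. Qed.

Lemma is_derive_A z v : U z -> is_derive z v A ('D_v A z).
Proof. by move=> Uz; apply: is_derive_smooth sA Uz. Qed.

(** The derivative of S' o T = S K; symmetry of the second derivatives of T turns S applied to D_v K
    into v applied to D_S K. *)
Lemma jacobian_S_T z : U z -> K z *m 'J S' (T z) = 'J S z *m K z + 'D_(S z) K z.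
Proof.
move=> Uz; apply: eq_mulmx_row => v.
have D : is_derive z v (fun x => S x *m K x) (v *m K z *m 'J S' (T z)).
  apply: (is_derive_ext oU Uz (f := fun x => S' (T x))); first exact: S_T.
  exact: (is_derive_comp_T sS' Uz (is_derive_S sS' _ (TU Uz))).
have E : v *m K z *m 'J S' (T z) = v *m 'J S z *m K z + S z *m 'D_v K z.
  exact: is_derive_unique D (is_derive_mulmx (is_derive_S sS v Uz) (is_derive_K v Uz)).
have C : S z *m 'D_v K z = v *m 'D_(S z) K z := jacobian_symmetric oU (S z) v sT Uz.
apply: etrans (mulmxA v (K z) _) (etrans E (etrans _ (esym (mulmxDr v _ _)))).
by rewrite -C; congr (_ + _); exact: esym (mulmxA _ _ _).
Qed.

(** By [K_dx], A is the block of first x derivatives of the x part of T, so its derivatives are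
    second derivatives of T. *)
Lemma derive_A_symmetric (z u v : V) : U z -> u *m dx *m 'D_v A z = v *m dx *m 'D_u A z.
Proof.
move=> Uz; have D w : 'D_w K z *m dx = dx *m 'D_w A z.
  have D1 : is_derive z w (fun x => dx *m A x) ('D_w K z *m dx).
    apply: (is_derive_ext oU Uz (f := fun x => K x *m dx)); first exact: K_dx.
    exact/is_derive_mulmxr/is_derive_K.
  exact: is_derive_unique D1 (is_derive_mulmxl dx (is_derive_A w Uz)).
have Dx (a w : V) : a *m dx *m 'D_w A z = a *m 'D_w K z *m dx.
  apply: etrans (esym (mulmxA a dx _)) (etrans _ (mulmxA a _ dx)).
  by congr (a *m _); exact: esym (D w).
rewrite Dx [RHS]Dx.
exact: (congr1 (fun B : 'M[R]_(1, n + n) => B *m dx) (jacobian_symmetric oU u v sT Uz)).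
Qed.

Lemma T_dy_derive (z v : V) : U z -> v *m K z *m dy = v *m dy *m A z + z *m dy *m 'D_v A z.
Proof.
move=> Uz; have D : is_derive z v (fun x => x *m dy *m A x) (v *m K z *m dy).
  apply: (is_derive_ext oU Uz (f := fun x => T x *m dy)); first exact: T_y.
  exact/is_derive_mulmxr/is_derive_T.
exact: is_derive_unique D (is_derive_mulmx (is_derive_y z v) (is_derive_A v Uz)).
Qed.

(** A does not vary along the fibres: with y = S dx, symmetry turns its derivative along [u *m ddy]
    into one paired with the x part of a vertical vector, which is 0. *)
Lemma ddy_K z : U z -> ddy *m K z = A z *m ddy.
Proof.
move=> Uz; apply: eq_frame.
  by rewrite -mulmxA K_dx// mulmxA -(mulmxA (A z)) ddy_dx mul0mx mulmx0.
rewrite -(mulmxA (A z)) ddy_dy mulmx1; apply: eq_mulmx_row => u.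
rewrite !mulmxA T_dy_derive// -(mulmxA u) ddy_dy mulmx1 -(S_dx S_J Uz).
by rewrite derive_A_symmetric// -(mulmxA u) ddy_dx mulmx0 mul0mx addr0.
Qed.

Lemma derive_S_A z : U z -> 'D_(S z) A z = ddx *m K z *m dy.
Proof.
move=> Uz; apply: eq_mulmx_row => u; rewrite !mulmxA T_dy_derive//.
rewrite -(mulmxA u) ddx_dy mulmx0 mul0mx add0r -(S_dx S_J Uz) derive_A_symmetric//.
by rewrite -(mulmxA u) ddx_dx mulmx1.
Qed.

Lemma K_dy z : U z -> K z *m dy = dx *m 'D_(S z) A z + dy *m A z.
Proof.
move=> Uz; rewrite derive_S_A// -{1}[K z]mul1mx -dx_ddxD mulmxDl mulmxDl.
by rewrite -(mulmxA dy) ddy_K// -!mulmxA ddy_dy mulmx1.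
Qed.

(** The yy block of ['J S] is - 2 N, so the law of N is the yy block of [jacobian_S_T]. The
    derivative of A along S arises twice, once from K and once from D_S K, and the common factor 2
    is cancelled. *)
Lemma N_T z : U z -> A z *m Nmx S' (T z) = Nmx S z *m A z - 'D_(S z) A z.
Proof.
move=> Uz; have n2 : 2 != 0 :> R by rewrite pnatr_eq0.
have E := congr1 (fun B => ddy *m B *m dy) (jacobian_S_T Uz).
have D : ddy *m 'D_(S z) K z *m dy = 'D_(S z) A z.
  have D1 : is_derive z (S z) A (ddy *m 'D_(S z) K z *m dy).
    apply: (is_derive_ext oU Uz (f := fun x => ddy *m K x *m dy)).
      by move=> x Ux; rewrite ddy_K// -mulmxA ddy_dy mulmx1.
    exact/is_derive_mulmxr/is_derive_mulmxl/is_derive_K.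
  by have [_ <-] := D1.
have E1 : ddy *m (K z *m 'J S' (T z)) *m dy = - 2 *: (A z *m Nmx S' (T z)).
  rewrite mulmxA ddy_K// -(mulmxA (A z)) (jacobian_S_vertical oU' sS' S_J' (TU Uz)).
  rewrite -(mulmxA (A z)) mulmxBl ddx_dy -(mulmxA _ ddy) ddy_dy mulmx1 sub0r.
  by rewrite mulmxN -scalemxAr scaleNr.
have E2 : ddy *m ('J S z *m K z) *m dy = 'D_(S z) A z - 2 *: (Nmx S z *m A z).
  rewrite mulmxA (jacobian_S_vertical oU sS S_J Uz) derive_S_A// !mulmxBl.
  by rewrite -(mulmxA _ ddy) ddy_K// -!mulmxA ddy_dy mulmx1 -scalemxAl.
have aux (a c d : 'M[R]_n) : - 2 *: a = d - 2 *: c + d -> a = c - d.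
  rewrite addrAC -mulr2n -[d *+ 2](scaler_nat 2 d) -scalerBr scaleNr => /eqP.
  by rewrite eqr_oppLR -scalerN opprB => /eqP/(scalerI n2).
by apply: aux; rewrite -E1 E mulmxDr mulmxDl E2 D.
Qed.

Lemma deltax_T z : U z -> A z *m deltax S' (T z) = deltax S z *m K z.
Proof.
move=> Uz; apply: eq_frame.
  rewrite -(mulmxA (A z)) deltax_dx -(mulmxA (deltax S z)) K_dx//.
  by rewrite (mulmxA (deltax S z) dx) deltax_dx mulmx1 mul1mx.
rewrite -(mulmxA (A z)) deltax_dy -(mulmxA (deltax S z)) K_dy// (mulmxDr (deltax S z)).
rewrite (mulmxA _ dx) (mulmxA _ dy) deltax_dx deltax_dy mul1mx.
by rewrite mulmxN N_T// opprB mulNmx.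
Qed.

Lemma deltay_T z : U z -> K z *m deltay S' (T z) = deltay S z *m A z.
Proof.
move=> Uz; rewrite !deltayE (mulmxDr (K z)) (mulmxA (K z) dx) K_dx// K_dy// -(mulmxA dx) N_T//.
by rewrite (mulmxBr dx) (mulmxDl _ _ (A z)) addrA subrK mulmxA.
Qed.

(** In the derivative of [deltax_T] along S the second derivatives of T cancel against those of
    [jacobian_S_T]. The leftover term is a combination of rows of [deltax S'], killed by
    [deltay S']. *)
Lemma curvature_T z : U z -> A z *m curvature S' (T z) = curvature S z *m A z.
Proof.
move=> Uz; have U'z := TU Uz.
have D' : is_derive (T z) (S z *m K z) (deltax S') ('D_(S' (T z)) (deltax S') (T z)).
  by rewrite -S_T//; exact: (is_derive_deltax oU' sS' (S' (T z)) U'z).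
have D1 : is_derive z (S z) (fun x => A x *m deltax S' (T x))
    ('D_(S z) A z *m deltax S' (T z) + A z *m 'D_(S' (T z)) (deltax S') (T z)).
  apply: is_derive_mulmx; first exact: is_derive_A.
  exact: is_derive_comp_T (smooth_deltax oU' sS') Uz D'.
have D2 : is_derive z (S z) (fun x => A x *m deltax S' (T x))
    ('D_(S z) (deltax S) z *m K z + deltax S z *m 'D_(S z) K z).
  apply: (is_derive_ext oU Uz (f := fun x => deltax S x *m K x)).
    by move=> x Ux; rewrite deltax_T.
  by apply: is_derive_mulmx; [exact: (is_derive_deltax oU sS)|exact: is_derive_K].
have E := is_derive_unique D1 D2.
have E' : A z *m ('D_(S' (T z)) (deltax S') (T z) - deltax S' (T z) *m 'J S' (T z)) =
    ('D_(S z) (deltax S) z - deltax S z *m 'J S z) *m K z -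
    'D_(S z) A z *m deltax S' (T z).
  rewrite mulmxBr (mulmxA _ (deltax _ _)) deltax_T// -(mulmxA (deltax S z)) jacobian_S_T//.
  rewrite mulmxBl mulmxDr (mulmxA (deltax S z) ('J S z)).
  have aux (a b c d e : 'M[R]_(n, n + n)) : a + b = c + d -> b - (e + d) = c - e - a.
    move=> E0; have -> : b = c + d - a by rewrite -E0 addrAC subrr add0r.
    by rewrite [e + d]addrC opprD addrA [c + d - a]addrAC addrK addrAC.
  exact: aux.
rewrite !curvatureE mulmxA E' mulmxBl -(mulmxA _ (deltax S' _)) deltax_deltay mulmx0 subr0.
by rewrite -(mulmxA _ (K z)) deltay_T// mulmxA.
Qed.

Lemma ricci_T z : U z -> A z \in unitmx -> ricci S' (T z) = ricci S z.
Proof.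
move=> Uz uA; rewrite (ricciE oU' sS' (TU Uz)) (ricciE oU sS Uz).
by rewrite -[curvature S z](mulmxK uA) -curvature_T// [RHS]mxtrace_mulC mulKmx.
Qed.

Lemma semibasic_T (c : 'cV[R]_n) z : U z -> K z *m (dx *m c) = dx *m (A z *m c).
Proof. by move=> Uz; rewrite (mulmxA (K z)) K_dx// -(mulmxA dx). Qed.

End Tensoriality.

(** * Isotropy in dimension two *)

Lemma sqr_norm_neq0 (R : realType) p (y : 'rV[R]_p) : y != 0 -> (y *m y^T) 0 0 != 0.
Proof.
apply: contra; rewrite mxE => /eqP/psumr_eq0P h; apply/eqP/rowP => j.
have := h _ j isT; rewrite !mxE => /(_ _)/eqP; rewrite -expr2 sqrf_eq0 => yj.
by apply/eqP/yj => i _; rewrite !mxE -expr2 sqr_ge0.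
Qed.

(* In size 2, tr C - C is the adjugate of the singular matrix C, so that its rows
   are multiples of y; this is why every spray on a surface is isotropic. *)
Lemma adjugate_factor (R : realType) (C : 'M[R]_2) (y : 'rV[R]_2) :
  y *m C = 0 -> y != 0 ->
  (((y *m y^T) 0 0)^-1 *: (((\tr C)%:M - C) *m y^T)) *m y = (\tr C)%:M - C.
Proof.
move=> yC y0; have yy0 := sqr_norm_neq0 y0.
suff E : (\tr C)%:M - C = ((y *m y^T) 0 0)^-1 *: (((\tr C)%:M - C) *m y^T *m y).
  by rewrite -scalemxAl -E.
apply: (scalerI yy0); rewrite scalerA mulfV// scale1r.
have e0 := congr1 (fun D : 'rV_2 => D 0 0) yC.
have e1 := congr1 (fun D : 'rV_2 => D 0 1) yC.
apply/matrixP => i j; move: e0 e1.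
rewrite !mxE /mxtrace !big_ord_recl !big_ord0 !mxE !big_ord_recl !big_ord0 !mxE.
have -> : lift ord0 ord0 = 1 :> 'I_2 by apply/val_inj.
have -> : ord0 = 0 :> 'I_2 by apply/val_inj.
rewrite !addr0 => e0 e1.
(* In each entry the two sides differ by a multiple c of one component e of y C = 0; the factor c
   is, up to sign, a component of y. *)
have aux (a b c e : R) : e = 0 -> a - b = c * e -> a = b.
  by move=> ->; rewrite mulr0 => /eqP; rewrite subr_eq0 => /eqP.
have [-> | ->] : i = 0 \/ i = 1 by case: i => [[|[|]]] // ?; [left|right]; apply/val_inj.
  have [-> | ->] : j = 0 \/ j = 1 by case: j => [[|[|]]] // ?; [left|right]; apply/val_inj.
    by apply: (aux _ _ (y 0 1) _ e1); rewrite /= ?mulr0n ?mulr1n; ring.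
  by apply: (aux _ _ (- y 0 0) _ e1); rewrite /= ?mulr0n ?mulr1n; ring.
have [-> | ->] : j = 0 \/ j = 1 by case: j => [[|[|]]] // ?; [left|right]; apply/val_inj.
  by apply: (aux _ _ (- y 0 1) _ e0); rewrite /= ?mulr0n ?mulr1n; ring.
by apply: (aux _ _ (y 0 0) _ e0); rewrite /= ?mulr0n ?mulr1n; ring.
Qed.

Section IsotropyForm.
Context {R : realType} {U : set 'rV[R]_(2 + 2)} {S : 'rV[R]_(2 + 2) -> 'rV[R]_(2 + 2)}.
Local Notation V := 'rV[R]_(2 + 2).
Local Notation dx := (dx : 'M[R]_(2 + 2, 2)).
Local Notation dy := (dy : 'M[R]_(2 + 2, 2)).
Local Notation ddy := (ddy : 'M[R]_(2, 2 + 2)).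

(** The components of alpha: the column a with a y = rho 1 - R, solved by multiplying with y^T and
    dividing by the Euclidean |y|^2 of the chart. The explicit formula shows smoothness; the result
    does not depend on that norm. *)
Definition isotropy_coef (S : V -> V) (z : V) : 'cV[R]_2 :=
  ((z *m dy *m (z *m dy)^T) 0 0)^-1 *:
  (((\tr (curvature S z))%:M - curvature S z) *m (z *m dy)^T).

Definition log_coef (S : V -> V) (z : V) : 'cV[R]_2 :=
  (ricci S z)^-1 *: isotropy_coef S z.

Hypothesis oU : open U.
Hypothesis sS : smooth U S.
Hypothesis S_J : forall z, U z -> S z *m J = liouville z.
Hypothesis S_homogeneous : forall z, U z -> bracket liouville S z = S z.
Hypothesis y_neq0 : forall z, U z -> z *m dy != 0.

Lemma isotropy_coef_y z : U z ->
  isotropy_coef S z *m (z *m dy) = (ricci S z)%:M - curvature S z.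
Proof.
move=> Uz; rewrite (ricciE oU sS Uz); apply: adjugate_factor (y_neq0 Uz).
exact: y_curvature oU sS S_J S_homogeneous _ Uz.
Qed.

Lemma curvature_isotropy z : U z ->
  curvature S z = (ricci S z)%:M - isotropy_coef S z *m (z *m dy).
Proof. by move=> Uz; rewrite isotropy_coef_y// opprB addrC subrK. Qed.

Lemma smooth_ricci : smooth U (ricci S).
Proof.
have sC := smooth_curvature oU sS.
apply: (smooth_ext oU (f := fun z => \sum_i curvature S z i i)).
  by move=> z Uz; rewrite (ricciE oU sS Uz).
by apply: smooth_sum => // i _; apply: smooth_entry.
Qed.

Lemma smooth_isotropy_coef : smooth U (isotropy_coef S).
Proof.
have sy : smooth U (fun z : V => z *m dy).
  by apply: smooth_mulmx => //; [exact: smooth_id|exact: smooth_cst].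
have syT : smooth U (fun z : V => (z *m dy)^T).
  apply/(smooth_mxP oU) => i j.
  have -> : (fun z : V => (z *m dy)^T i j) = (fun z : V => (z *m dy) j i).
    by apply/funext => z; rewrite mxE.
  exact: smooth_entry.
apply: smoothZ => //.
  apply: smoothV => //; last by apply: smooth_entry => //; exact: smooth_mulmx.
  by move=> z Uz; apply: sqr_norm_neq0; exact: y_neq0.
apply: smooth_mulmx => //; apply: smoothD => //; last first.
  exact/(smoothN oU)/(smooth_curvature oU sS).
apply/(smooth_mxP oU) => i j.
have sR : smooth U (fun z : V => \sum_i curvature S z i i).
  by apply: smooth_sum => // k _; apply: smooth_entry => //; exact: smooth_curvature oU sS.
have -> : (fun z => (\tr (curvature S z))%:M i j) =
    (fun z => \tr (curvature S z) * (i == j)%:R :> R).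
  by apply/funext => z; rewrite mxE mulr_natr.
by apply: smoothM => //; exact: smooth_cst.
Qed.

Lemma isotropy_coef_S z : U z ->
  (S z *m (dx *m isotropy_coef S z)) 0 0 = ricci S z.
Proof.
move=> Uz; rewrite (mulmxA (S z)) (S_dx S_J Uz).
have /(congr1 (mulmx (z *m dy))) := isotropy_coef_y Uz.
rewrite mulmxBr (y_curvature oU sS S_J S_homogeneous Uz) subr0 mulmxA.
have [k ->] : exists k, z *m dy *m isotropy_coef S z = k%:M.
  by exists ((z *m dy *m isotropy_coef S z) 0 0); exact: mx11_scalar.
rewrite mul_mx_scalar mul_scalar_mx mxE eqxx mulr1n => /eqP.
by rewrite -subr_eq0 -scalerBl scaler_eq0 (negPf (y_neq0 Uz)) orbF subr_eq0 => /eqP.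
Qed.

Lemma jacobi_isotropy z : U z ->
  jacobi S z = ricci S z *: J - dx *m isotropy_coef S z *m liouville z.
Proof.
move=> Uz; rewrite (jacobiE oU sS Uz) curvature_isotropy// mulmxBr mulmxBl.
rewrite mul_mx_scalar -scalemxAl /liouville rsubmxE; congr (_ - _).
by rewrite !mulmxA.
Qed.

(** A semi-basic alpha is determined by alpha (x) C, as y does not vanish. This replaces the form
    hidden in the existential of [regular] by the explicit one. *)
Lemma isotropy_coef_unique z (alpha : 'cV[R]_(2 + 2)) : U z ->
  J *m alpha = 0 -> jacobi S z = ricci S z *: J - alpha *m liouville z ->
  alpha = dx *m isotropy_coef S z.
Proof.
move=> Uz Ja; rewrite jacobi_isotropy// => /addrI/oppr_inj E.
have da : ddy *m alpha = 0.
  have := congr1 (mulmx ddx) Ja; rewrite mulmx0 /J -(mulmxA dx) mulmxA ddx_dx.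
  by rewrite mul1mx.
have aE : alpha = dx *m (ddx *m alpha).
  by rewrite -[LHS]mul1mx -dx_ddxD mulmxDl -(mulmxA dy) da mulmx0 addr0 mulmxA.
rewrite [LHS]aE; congr (dx *m _).
have := congr1 (fun B => ddx *m B *m dy) E.
rewrite /liouville rsubmxE !mulmxA ddx_dx mul1mx -!(mulmxA _ ddy) ddy_dy !mulmx1.
move/eqP; rewrite eq_sym -subr_eq0 -!(mulmxA _ z) -mulmxBl => /eqP yE.
have [j yj] : exists j, (z *m dy) 0 j != 0.
  by have /rV0Pn := y_neq0 Uz.
apply/eqP; rewrite -subr_eq0; apply/eqP/matrixP => i k; rewrite ord1 [RHS]mxE.
have := congr1 (fun B : 'M[R]_2 => B i j) yE; rewrite /= [LHS]mxE big_ord1 [RHS]mxE => /eqP.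
by rewrite mulf_eq0 (negPf yj) orbF => /eqP.
Qed.

Hypothesis ricci_neq0 : forall z, U z -> ricci S z != 0.

Lemma smooth_log_coef : smooth U (log_coef S).
Proof.
apply: smoothZ => //; last exact: smooth_isotropy_coef.
by apply: smoothV => //; exact: smooth_ricci.
Qed.

Lemma curvature_log_coef z : U z ->
  curvature S z = ricci S z *: (1%:M - log_coef S z *m (z *m dy)).
Proof.
move=> Uz; rewrite curvature_isotropy// scalerBr scalemx1 /log_coef.
by rewrite -(scalemxAl (ricci S z)^-1) (scalerA (ricci S z)) mulfV ?ricci_neq0// scale1r.
Qed.

End IsotropyForm.

(** * The tangent bundle *)

(** [xget] picks an unspecified value, so f has to agree on all points of the chart with the same
    coordinates. *)
Lemma local_exprE (R : realType) (m : nat) (N : atlas R m) (W : choiceType) (w0 : W)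
    (f : N -> W) (a : chart N) p :
  dom a p -> (forall q, dom a q -> Defs.coord a q = Defs.coord a p -> f q = f p) ->
  local_expr w0 f a (Defs.coord a p) = f p.
Proof.
move=> ap fp; rewrite /local_expr; set P := (X in xget _ X).
have /xgetPex : exists y, P y by exists (f p); exists p.
by move=> /(_ w0)[q [aq qp] <-]; apply: fp.
Qed.

Section Charts.
Context {R : realType} {n : nat} {M : atlas R n}.
Hypothesis HM : manifold M.
Local Notation coord := Defs.coord.
Local Notation comp := Defs.comp.
Local Notation dx := (dx : 'M[R]_(n + n, n)).
Local Notation dy := (dy : 'M[R]_(n + n, n)).

Lemma coord_inj (a : chart M) (p q : M) :
  dom a p -> dom a q -> coord a p = coord a q -> p = q.
Proof. by have [_ inj _ _ _] := HM; apply: inj. Qed.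

Lemma dom_cover (p : M) : exists a : chart M, dom a p.
Proof.
have [cov _ _ _ _] := HM.
by have : setT p by []; rewrite -cov => -[a _ ap]; exists a.
Qed.

Lemma transitionE (a b : chart M) (p : M) :
  dom a p -> transition a b (coord a p) = coord b p.
Proof. by move=> ap; apply: local_exprE => // q aq /(coord_inj aq ap) ->. Qed.

Lemma open_overlap (a b : chart M) : open (chart_image (dom b : set M) a).
Proof. by have [_ _ tr _ _] := HM; have [] := tr a b. Qed.

Lemma smooth_transition (a b : chart M) :
  smooth (chart_image (dom b : set M) a) (transition a b).
Proof. by have [_ _ tr _ _] := HM; have [] := tr a b. Qed.

Lemma jacobian_transition_inv (a b : chart M) (p : M) : dom a p -> dom b p ->
  'J (transition a b) (coord a p) *m 'J (transition b a) (coord b p) = 1%:M.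
Proof.
move=> ap bp.
have Oz : chart_image (dom b : set M) a (coord a p) by exists p.
have Oz' : chart_image (dom a : set M) b (coord b p) by exists p.
apply: eq_mulmx_row => v; rewrite mulmx1 mulmxA.
have d1 := smooth_differentiable (@smooth_transition a b) Oz.
have d2 := smooth_differentiable (@smooth_transition b a) Oz'.
rewrite -(transitionE b ap) in d2 *.
have D : is_derive (coord a p) v (transition b a \o transition a b)
    (v *m 'J (transition a b) (coord a p) *m
     'J (transition b a) (transition a b (coord a p))).
  split; first exact/diff_derivable/differentiable_comp.
  by rewrite (derive_comp _ d1 d2) !deriveEjacobian.
apply: is_derive_unique D _.
apply: (is_derive_ext (@open_overlap a b) Oz _ (is_derive_id _ _)) => _ [q [bq aq] <-] /=.
by rewrite !transitionE.
Qed.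

Lemma tangent_eq (p : M) (v w : tangent_space p) : comp v = comp w -> v = w.
Proof.
case: v w => [v v1 v2] [w w1 w2] /= vw; move: v1 v2; rewrite vw => v1 v2.
by rewrite (Prop_irrelevance v1 w1) (Prop_irrelevance v2 w2).
Qed.

(** A tangent vector is a family over all charts; one component determines the others by the
    transition law, and those of charts away from p are 0. *)
Lemma TM_coord_inj (a : chart (TM M)) (v w : TM M) :
  dom a v -> dom a w -> coord a v = coord a w -> v = w.
Proof.
case: v w => [p v] [q w] /= ap aq /eq_row_mx[/(coord_inj ap aq) pq].
move: w aq; rewrite -{q}pq => w _ vw; congr existT; apply: tangent_eq.
apply/funext => b; have [bp|bp] := pselect (dom b p); last by rewrite !comp_out.
by rewrite !(comp_transition _ ap bp) vw.
Qed.

Lemma TM_local_exprE (W : choiceType) (w0 : W) (f : TM M -> W) (a : chart (TM M)) v :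
  dom a v -> local_expr w0 f a (coord a v) = f v.
Proof. by move=> av; apply: local_exprE => // w aw /(TM_coord_inj aw av) ->. Qed.

Lemma TM_transitionE (a b : chart (TM M)) v :
  dom a v -> transition a b (coord a v) = coord b v.
Proof. exact: TM_local_exprE. Qed.

Lemma coord_dx (a : chart (TM M)) v : coord a v *m dx = coord (a : chart M) (projT1 v).
Proof. by rewrite -lsubmxE row_mxKl. Qed.

Lemma coord_dy (a : chart (TM M)) v : coord a v *m dy = comp (projT2 v) a.
Proof. by rewrite -rsubmxE row_mxKr. Qed.

Section Overlap.
Variables (A : set (TM M)) (a b : chart (TM M)).
Hypothesis HA : nopen A.

Definition overlap : set 'rV[R]_(n + n) := chart_image (A `&` dom b) a.

(** Splits an overlap into a condition on z and one on its x part, from which its openness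
    follows. *)
Lemma overlapP z : overlap z <->
  chart_image A a z /\ chart_image (dom (b : chart M)) (a : chart M) (z *m dx).
Proof.
split=> [[v [[Av bv] av] <-]|[[v [Av av] <-]]].
  by split; [exists v|rewrite coord_dx; exists (projT1 v)].
rewrite coord_dx => -[p [bp ap] /(coord_inj ap av) pv]; exists v => //.
by split=> //; split=> //; rewrite /= -pv.
Qed.

Lemma continuous_mulmxr p (B : 'M[R]_(n + n, p)) :
  continuous (fun z : 'rV[R]_(n + n) => z *m B).
Proof.
move=> z; have s : smooth setT (fun z : 'rV[R]_(n + n) => z *m B).
  by apply: smooth_mulmx; [exact: openT|exact: smooth_id|exact: smooth_cst].
exact/differentiable_continuous/(smooth_differentiable s).
Qed.

Lemma open_TM_overlap : open overlap.
Proof.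
have -> : overlap = chart_image A a `&`
    [set z | chart_image (dom (b : chart M)) (a : chart M) (z *m dx)].
  by apply/seteqP; split=> z; rewrite overlapP.
apply: openI; first exact: HA.
apply: (@open_comp _ _ (fun z : 'rV[R]_(n + n) => z *m dx)); last exact: open_overlap.
by move=> z _; exact: continuous_mulmxr.
Qed.

Definition base_jacobian (z : 'rV[R]_(n + n)) : 'M[R]_n :=
  'J (@transition R n M a b) (z *m dx).

Lemma smooth_mulmxr p (B : 'M[R]_(n + n, p)) U : open U ->
  smooth U (fun z : 'rV[R]_(n + n) => z *m B).
Proof. by move=> oU; apply: smooth_mulmx => //; [exact: smooth_id|exact: smooth_cst]. Qed.

Lemma smooth_base_jacobian : smooth overlap base_jacobian.
Proof.
apply: (smooth_comp open_TM_overlap (@open_overlap a b) _ (smooth_mulmxr dx open_TM_overlap)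
  (smooth_jacobian (@open_overlap a b) (@smooth_transition a b))).
by move=> z /overlapP[].
Qed.

Lemma TM_transition_formula z : overlap z ->
  transition a b z = @transition R n M a b (z *m dx) *m ddx +
    z *m dy *m base_jacobian z *m ddy.
Proof.
move=> [v [[Av bv] av] <-]; rewrite TM_transitionE// coord_dy /base_jacobian coord_dx.
rewrite transitionE// -comp_transition//.
by apply: eq_frame; rewrite mulmxDl -!mulmxA !frameE !(mulmx0, mulmx1) ?addr0 ?add0r
  ?coord_dx ?coord_dy.
Qed.

Lemma smooth_TM_transition : smooth overlap (transition a b).
Proof.
have oO := open_TM_overlap.
apply: (smooth_ext oO (fun z zO => esym (TM_transition_formula zO))).
apply: smoothD => //; (apply: smooth_mulmx => //; last exact: smooth_cst).
  apply: (smooth_comp oO (@open_overlap a b) _ (smooth_mulmxr dx oO) (@smooth_transition a b)).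
  by move=> z /overlapP[].
by apply: smooth_mulmx => //; [exact: smooth_mulmxr|exact: smooth_base_jacobian].
Qed.

Lemma TM_transition_dy z : overlap z ->
  transition a b z *m dy = z *m dy *m base_jacobian z.
Proof.
move=> zO; rewrite TM_transition_formula// mulmxDl -!(mulmxA _ ddx) -!(mulmxA _ ddy).
by rewrite !frameE mulmx0 add0r mulmx1.
Qed.

Lemma jacobian_TM_dx z : overlap z ->
  'J (transition a b) z *m dx = dx *m base_jacobian z.
Proof.
move=> zO; have oO := open_TM_overlap; apply: eq_mulmx_row => v; rewrite !mulmxA.
have Oz : chart_image (dom (b : chart M)) (a : chart M) (z *m dx) by case/overlapP: zO.
have D1 := is_derive_mulmxr dx (is_derive_jacobian v smooth_TM_transition zO).
have d1 : differentiable (fun z : 'rV[R]_(n + n) => z *m dx) z.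
  exact: smooth_differentiable (smooth_mulmxr _ oO) zO.
have d2 := smooth_differentiable (@smooth_transition a b) Oz.
have D2 : is_derive z v (@transition R n M a b \o (fun z => z *m dx))
    (v *m dx *m base_jacobian z).
  split; first exact/diff_derivable/(differentiable_comp d1 d2).
  apply: etrans (derive_comp v d1 d2) _.
  have [_ ->] := is_derive_mulmxr dx (is_derive_id z v).
  exact: deriveEjacobian.
apply: is_derive_unique D1 (is_derive_ext oO zO _ D2) => x xO /=.
rewrite TM_transition_formula// mulmxDl -!(mulmxA _ ddx) -!(mulmxA _ ddy) !frameE.
by rewrite mulmx0 addr0 mulmx1.
Qed.

Lemma base_jacobian_unit z : overlap z -> base_jacobian z \in unitmx.
Proof.
move=> [v [[Av bv] av] <-]; rewrite /base_jacobian coord_dx.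
have av' : dom (a : chart M) (projT1 v) := av.
have bv' : dom (b : chart M) (projT1 v) := bv.
have [u _] := mulmx1_unit (jacobian_transition_inv av' bv'); exact: u.
Qed.

End Overlap.

Lemma T0M_dy (a : chart (TM M)) v : T0M v -> dom a v -> coord a v *m dy != 0.
Proof.
move=> [c cv c0] av; rewrite coord_dy; apply: contra c0 => /eqP a0.
have av' : dom (a : chart M) (projT1 v) := av.
by rewrite (comp_transition (projT2 v) av' cv) a0 mul0mx.
Qed.

(** Dilations of the fibre are written as displacements along C, so that derivatives along C apply
    to homogeneous functions. *)
Lemma coord_dilate (a : chart (TM M)) v c :
  coord a (dilate c v) = coord a v + (c - 1) *: liouville (coord a v).
Proof.
rewrite liouvilleE; apply: eq_frame.
  by rewrite mulmxDl -scalemxAl -!mulmxA ddy_dx !mulmx0 scaler0 addr0 !coord_dx.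
rewrite mulmxDl -scalemxAl -!mulmxA ddy_dy mulmx1 !coord_dy /=.
by rewrite -[X in _ = X + _]scale1r -scalerDl addrC subrK.
Qed.

End Charts.

Lemma smooth_subset (R : realType) (m : nat) (W : normedModType R)
    (U U' : set 'rV[R]_m) (f : 'rV[R]_m -> W) :
  U' `<=` U -> smooth U f -> smooth U' f.
Proof.
move=> sU sf k; move: (sf k); elim: k f {sf} => [|k IH] f.
  by move=> cf z /sU; apply: cf.
by move=> [df Df]; split=> [z /sU|v]; [exact: df|exact: IH (Df v)].
Qed.

(** * Convex conic neighbourhoods *)

Section ConvexCone.
Context {R : realType} {n : nat}.
Local Notation V := 'rV[R]_(n + n).
Local Notation dx := (dx : 'M[R]_(n + n, n)).
Local Notation dy := (dy : 'M[R]_(n + n, n)).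

Lemma mx_norm_entry p q (u : 'M[R]_(p, q)) i j : `|u i j| <= `|u|.
Proof. by rewrite [leRHS]mx_normrE; apply: (le_bigmax _ _ (i, j)). Qed.

Lemma norm_frame (u : V) (r : R) :
  0 < r -> `|u *m dx| < r -> `|u *m dy| < r -> `|u| < r.
Proof.
move=> r0 ux uy; rewrite [ltLHS]mx_normrE; apply: bigmax_lt => // -[i j] _ /=.
rewrite -(hsubmxK u) lsubmxE rsubmxE mxE.
by case: splitP => k _; [apply: le_lt_trans ux|apply: le_lt_trans uy]; exact: mx_norm_entry.
Qed.

Lemma scale_liouville_dx (z : V) k : (z + k *: liouville z) *m dx = z *m dx.
Proof. by rewrite liouvilleE mulmxDl -scalemxAl -!mulmxA ddy_dx !mulmx0 scaler0 addr0. Qed.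

Lemma scale_liouville_dy (z : V) k : (z + (k - 1) *: liouville z) *m dy = k *: (z *m dy).
Proof.
rewrite liouvilleE mulmxDl -scalemxAl -!mulmxA ddy_dy mulmx1.
by rewrite -[X in X + _]scale1r -scalerDl addrC subrK.
Qed.

Lemma scale_liouvilleK (z : V) k : k != 0 ->
  z + (k - 1) *: liouville z + (k^-1 - 1) *: liouville (z + (k - 1) *: liouville z) = z.
Proof.
move=> k0; apply: eq_frame; first by rewrite !scale_liouville_dx.
by rewrite !scale_liouville_dy scalerA mulVf// scale1r.
Qed.

(* W is a ball in x times the open cone over a ball in y. *)
Lemma convex_cone_neighborhood (U : set V) z0 : open U -> U z0 ->
  (forall z k, U z -> 0 < k -> U (z + (k - 1) *: liouville z)) ->
  exists W : set V, [/\ open W, W z0, W `<=` U,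
    forall z k, W z -> 0 < k -> W (z + (k - 1) *: liouville z) &
    forall x y (t : R), W x -> W y -> 0 <= t <= 1 -> W (x + t *: (y - x))].
Proof.
move=> oU Uz0 cU.
have Fz := nbhs_filter z0.
have [r /= r0 rU] := (nbhs_ballP z0 _).1 (open_nbhs_nbhs (conj oU Uz0)).
(* The union over k > 0 of these sets is the cone over the ball: y belongs to it once some positive
   multiple of y lies in the ball. *)
pose Wk k : set V := [set z | `|k *: (z *m dy) - z0 *m dy| < r].
pose W := [set z : V | `|(z - z0) *m dx| < r] `&` \bigcup_(k in [set k : R | 0 < k]) Wk k.
have ball_open p (f : V -> 'rV[R]_p) : smooth setT f -> open [set z : V | `|f z| < r].
  move=> sf; apply: (@open_comp _ _ (fun z => `|f z|) [set x : R | x < r]); last exact: open_lt.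
  move=> z _; have df : differentiable f z by exact: smooth_differentiable sf I.
  have cf := differentiable_continuous df; exact: (cvg_norm cf).
have oT : open [set: V] by exact: openT.
exists W; split.
- apply: openI.
    apply: ball_open; apply: smooth_mulmx => //; last exact: smooth_cst.
    by apply: smoothD => //; [exact: smooth_id|exact: smooth_cst].
  apply: bigcup_open => k _; apply: ball_open; apply: smoothD => //; last exact: smooth_cst.
  by apply: smoothZ => //; [exact: smooth_cst|exact: smooth_mulmxr].
- split; first by rewrite /= subrr mul0mx normr0.
  by exists 1; rewrite /= ?ltr01// /Wk /= scale1r subrr normr0.
- move=> z [zx [k /= k0 zy]].
  rewrite -[z](scale_liouvilleK z (lt0r_neq0 k0)); apply: cU; last by rewrite invr_gt0.
  apply: rU; rewrite -ball_normE /= -normrN opprB; apply: norm_frame => //.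
    by rewrite mulmxBl scale_liouville_dx -mulmxBl.
  by rewrite mulmxBl scale_liouville_dy.
- move=> z k [zx [l /= l0 zy]] k0; split; first by rewrite /= mulmxBl scale_liouville_dx -mulmxBl.
  exists (l / k); first by rewrite /= divr_gt0.
  by rewrite /Wk /= scale_liouville_dy scalerA divfK// gt_eqF.
move=> x y t [xx [k /= k0 xy]] [yx [l /= l0 yy]] /andP[t0 t1].
have conv p (u v : 'rV[R]_p) (s : R) : 0 <= s <= 1 -> `|u| < r -> `|v| < r ->
    `|(1 - s) *: u + s *: v| < r.
  move=> /andP[s0 s1] ur vr; apply: le_lt_trans (ler_normD _ _) _.
  rewrite !normrZ (ger0_norm s0) ger0_norm ?subr_ge0//.
  pose M := Num.max `|u| `|v|.
  have Mr : M < r by rewrite gt_max ur vr.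
  have uM : `|u| <= M by rewrite le_max lexx.
  have vM : `|v| <= M by rewrite le_max lexx orbT.
  have ME : (1 - s) * M + s * M = M by rewrite -mulrDl subrK mul1r.
  apply: le_lt_trans Mr; rewrite -ME; apply: lerD; last exact: ler_wpM2l.
  by apply: ler_wpM2l => //; rewrite subr_ge0.
split.
  rewrite /=; have -> : (x + t *: (y - x) - z0) *m dx =
      (1 - t) *: ((x - z0) *m dx) + t *: ((y - z0) *m dx).
    rewrite !scalemxAl -mulmxDl; congr (_ *m dx).
    by apply/rowP => i; rewrite !mxE; ring.
  by apply: conv => //; rewrite t0.
(* If k y1 and l y2 lie in the ball, (1 - t) y1 + t y2 is d times their convex combination with
   weights (1 - t) / (k d) and t / (l d); so 1 / d brings it back into the ball. *)
pose d := (1 - t) / k + t / l.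
have d0 : 0 < d.
  rewrite /d; have [->|tn0] := eqVneq t 0.
    by rewrite subr0 mul0r addr0 divr_gt0.
  have t_gt0 : 0 < t by rewrite lt_neqAle eq_sym tn0.
  by apply: ltr_wpDl; [rewrite divr_ge0 ?subr_ge0 ?(ltW k0)|rewrite divr_gt0].
exists d^-1; first by rewrite /= invr_gt0.
rewrite /Wk /=.
have -> : d^-1 *: ((x + t *: (y - x)) *m dy) - z0 *m dy =
    (1 - t / l / d) *: (k *: (x *m dy) - z0 *m dy) +
    (t / l / d) *: (l *: (y *m dy) - z0 *m dy).
  have -> : 1 - t / l / d = (1 - t) / k / d.
    apply: (mulIf (lt0r_neq0 d0)); rewrite mulrBl !divfK ?gt_eqF// mul1r /d.
    by rewrite addrK.
  have cE : (1 - t) / k / d + t / l / d = 1 by rewrite -mulrDl divff// gt_eqF.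
  rewrite mulmxDl -scalemxAl mulmxBl.
  move: (x *m dy) (y *m dy) (z0 *m dy) => p' q' s'.
  apply/rowP => i; rewrite !mxE; move: (p' 0 i) (q' 0 i) (s' 0 i) => p q s.
  have k0' := lt0r_neq0 k0; have l0' := lt0r_neq0 l0.
  transitivity ((1 - t) / k / d * (k * p) + t / l / d * (l * q) -
    ((1 - t) / k / d + t / l / d) * s); last by ring.
  rewrite cE; have d0' := lt0r_neq0 d0; move: d0'; generalize d => e e0.
  by field; rewrite k0' l0' e0.
have tl : 0 <= t / l by rewrite divr_ge0// ltW.
apply: conv => //; apply/andP; split; first by rewrite divr_ge0// ltW.
by rewrite ler_pdivrMr// mul1r /d lerDr divr_ge0 ?subr_ge0// ltW.
Qed.

End ConvexCone.

(** * Sprays on the tangent bundle and the three conditions *)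

Section SprayTM.
Context {R : realType} {M : atlas R 2} {A : set (TM M)}
  {S : chart (TM M) -> 'rV[R]_(2 + 2) -> 'rV[R]_(2 + 2)}.
Hypotheses (HM : manifold M) (HA : open_cone A) (HS : spray A S) (HSnf : non_flat A S).
Local Notation coord := Defs.coord.
Local Notation V := 'rV[R]_(2 + 2).
Local Notation dx := (dx : 'M[R]_(2 + 2, 2)).
Local Notation dy := (dy : 'M[R]_(2 + 2, 2)).
Local Notation U := (chart_image A).
Implicit Types (a c : chart (TM M)) (z : V).

Lemma open_U a : open (U a).
Proof. by have [_ + _] := HA; apply. Qed.

Lemma smooth_S a : smooth (U a) (S a).
Proof. by have [[+ _] _] := HS; apply. Qed.

Lemma U_S_J a z : U a z -> S a z *m J = liouville z.
Proof. by move=> Uz; have [_ +] := HS; move=> /(_ a z Uz)[]. Qed.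

Lemma U_S_homogeneous a z : U a z -> bracket liouville (S a) z = S a z.
Proof. by move=> Uz; have [_ +] := HS; move=> /(_ a z Uz)[]. Qed.

Lemma U_y_neq0 a z : U a z -> z *m dy != 0.
Proof. by move=> [v [Av av] <-]; have [AT _ _] := HA; apply: T0M_dy => //; apply: AT. Qed.

Lemma U_ricci_neq0 a z : U a z -> ricci (S a) z != 0.
Proof. by move=> Uz; have [] := HSnf Uz. Qed.

Lemma smooth_U_log_coef a : smooth (U a) (log_coef (S a)).
Proof.
exact: (smooth_log_coef (@open_U a) (@smooth_S a) (@U_y_neq0 a) (@U_ricci_neq0 a)).
Qed.

Lemma U_curvature a z : U a z ->
  curvature (S a) z = ricci (S a) z *: (1%:M - log_coef (S a) z *m (z *m dy)).
Proof.
exact: (curvature_log_coef (@open_U a) (@smooth_S a) (@U_S_J a)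
  (@U_S_homogeneous a) (@U_y_neq0 a) (@U_ricci_neq0 a)).
Qed.

Definition log_form a z : 'cV[R]_(2 + 2) := omega (S a) (log_coef (S a)) z.

Section Transition.
Variables a c : chart (TM M).
Local Notation O := (overlap A a c).
Local Notation T := (transition a c).
Local Notation B := (@base_jacobian R 2 M a c).

Lemma open_O : open O.
Proof. by have [_ nA _] := HA; exact: open_TM_overlap. Qed.

Lemma O_U : O `<=` U a.
Proof. by move=> z [v [[Av cv] av] <-]; exists v. Qed.

Lemma T_O z : O z -> U c (T z).
Proof. by move=> [v [[Av cv] av] <-]; rewrite (TM_transitionE HM)//; exists v. Qed.

Lemma S_transition z : O z -> S c (T z) = S a z *m 'J T z.
Proof.
move=> [v [[Av cv] av] <-]; rewrite (TM_transitionE HM)//.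
by have [[_ +] _] := HS; apply.
Qed.

Let sO : smooth O (S a) := smooth_subset O_U (@smooth_S a).
Let O_S_J z (zO : O z) := U_S_J (O_U zO).
Let nA : nopen A.
Proof. by have [] := HA. Qed.
Let sT := @smooth_TM_transition R 2 M HM A a c nA.
Let sB := @smooth_base_jacobian R 2 M HM A a c nA.
Let Tdy := @TM_transition_dy R 2 M HM A a c.
Let Kdx := @jacobian_TM_dx R 2 M HM A a c nA.

Lemma curvature_transition z : O z ->
  B z *m curvature (S c) (T z) = curvature (S a) z *m B z.
Proof.
exact: (curvature_T open_O (@open_U c) sO (@smooth_S c) O_S_J (@U_S_J c) sT sB T_O
  Tdy Kdx S_transition).
Qed.

Lemma ricci_transition z : O z -> ricci (S c) (T z) = ricci (S a) z.
Proof.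
move=> zO; apply: (ricci_T open_O (@open_U c) sO (@smooth_S c) O_S_J (@U_S_J c) sT sB T_O
  Tdy Kdx S_transition) => //.
exact: (base_jacobian_unit HM zO).
Qed.

(** Multiplied by y, both sides are determined by rho and the curvature, whose transition laws are
    known; a nonzero entry of y allows cancellation. *)
Lemma isotropy_coef_transition z : O z ->
  isotropy_coef (S a) z = B z *m isotropy_coef (S c) (T z).
Proof.
move=> zO; have uB := base_jacobian_unit HM zO; have Uz := O_U zO; have Uc := T_O zO.
have Ea := isotropy_coef_y (@open_U a) (@smooth_S a) (@U_S_J a) (@U_S_homogeneous a)
  (@U_y_neq0 a) Uz.
have Ec := isotropy_coef_y (@open_U c) (@smooth_S c) (@U_S_J c) (@U_S_homogeneous c)
  (@U_y_neq0 c) Uc.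
have E : (isotropy_coef (S a) z - B z *m isotropy_coef (S c) (T z)) *m (z *m dy) = 0.
  apply: (can_inj (mulmxK uB)); rewrite mul0mx !mulmxBl Ea.
  rewrite -(mulmxA (B z)) -(mulmxA (B z)) -(mulmxA _ (z *m dy)) -(Tdy zO) Ec.
  rewrite mulmxBl mulmxBr curvature_transition// ricci_transition//.
  by rewrite mul_scalar_mx mul_mx_scalar subrr.
have [j yj] : exists j, (z *m dy) 0 j != 0 by have /rV0Pn := U_y_neq0 Uz.
apply/eqP; rewrite -subr_eq0; apply/eqP/matrixP => i k; rewrite ord1 [RHS]mxE.
have := congr1 (fun C : 'M[R]_2 => C i j) E; rewrite /= [LHS]mxE big_ord1 [RHS]mxE => /eqP.
by rewrite mulf_eq0 (negPf yj) orbF => /eqP.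
Qed.

Lemma log_coef_transition z : O z ->
  log_coef (S a) z = B z *m log_coef (S c) (T z).
Proof.
by move=> zO; rewrite /log_coef isotropy_coef_transition// -ricci_transition// scalemxAr.
Qed.

Lemma log_form_transition z : O z -> log_form a z = 'J T z *m log_form c (T z).
Proof.
move=> zO; rewrite /log_form /omega log_coef_transition// (mulmxA (jacobian T z)).
rewrite (deltay_T open_O (@open_U c) sO (@smooth_S c) O_S_J (@U_S_J c) sT sB T_O
  Tdy Kdx S_transition)//.
by rewrite mulmxA.
Qed.

Lemma isotropy_form_transition z : O z ->
  dx *m isotropy_coef (S a) z = 'J T z *m (dx *m isotropy_coef (S c) (T z)).
Proof.
by move=> zO; rewrite (semibasic_T Kdx)// isotropy_coef_transition.
Qed.

End Transition.

Lemma one_form_log_form : one_form A log_form.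
Proof.
split=> [a|a c p Ap ap cp].
  exact: (smooth_omega (@open_U a) (@smooth_S a) (@smooth_U_log_coef a)).
have pO : overlap A a c (coord a p) by exists p.
by rewrite (log_form_transition pO) (TM_transitionE HM).
Qed.

Lemma isotropy_form_canonical :
  isotropy_form A S (fun a z => dx *m isotropy_coef (S a) z).
Proof.
split; first split=> [a|a c p Ap ap cp].
- apply: smooth_mulmx; [exact: open_U|exact: smooth_cst|].
  exact: smooth_isotropy_coef (@open_U a) (@smooth_S a) (@U_y_neq0 a).
- have pO : overlap A a c (coord a p) by exists p.
  by rewrite (isotropy_form_transition pO) (TM_transitionE HM).
move=> a z Uz; split.
- by rewrite /J -(mulmxA dx) (mulmxA ddy) ddy_dx mul0mx mulmx0.
- exact: jacobi_isotropy (@open_U a) (@smooth_S a) (@U_S_J a) (@U_S_homogeneous a)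
    (@U_y_neq0 a) _ Uz.
- exact: isotropy_coef_S (@open_U a) (@smooth_S a) (@U_S_J a) (@U_S_homogeneous a)
    (@U_y_neq0 a) _ Uz.
Qed.

(** The hub of the equivalences. The factor [1 *:] keeps the shape M + k b b^T of
    [unitmx_add_rank1]. *)
Definition log_integrable : Prop := forall a z, U a z ->
  d1 (log_form a) z = 0 /\
  hess (log_coef (S a)) z + 1 *: (log_coef (S a) z *m (log_coef (S a) z)^T) \in unitmx.

Lemma log_coef_isotropy alpha a z : isotropy_form A S alpha -> U a z ->
  (ricci (S a) z)^-1 *: alpha a z = dx *m log_coef (S a) z.
Proof.
move=> [_ ia] Uz; have [Ja jE _] := ia a z Uz.
rewrite (isotropy_coef_unique (@open_U a) (@smooth_S a) (@U_S_J a) (@U_S_homogeneous a)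
  (@U_y_neq0 a) Uz Ja jE).
by rewrite /log_coef scalemxAr.
Qed.

Lemma regular_integrableP :
  (Defs.regular A S /\ berwald_integrable A S) <-> log_integrable.
Proof.
split=> [[[alpha ia ra] invD] a z Uz|LI].
  split.
    exact: (closed_of_involutive (@open_U a) (@smooth_S a) (@U_S_J a) (@U_S_homogeneous a)
      (@smooth_U_log_coef a) (@U_y_neq0 a) (@U_ricci_neq0 a) (@U_curvature a) (invD a) Uz).
  rewrite -(rank_Omega (@open_U a) (@smooth_U_log_coef a) (S := S a) (alpha := alpha a)) ?ra//.
  by move=> x Ux; apply: log_coef_isotropy.
split.
  exists (fun a z => dx *m isotropy_coef (S a) z); first exact: isotropy_form_canonical.
  move=> a z Uz; apply/eqP; rewrite (rank_Omega (@open_U a) (@smooth_U_log_coef a))//.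
    by have [] := LI a z Uz.
  by move=> x Ux; rewrite /log_coef scalemxAr.
move=> a; apply: (involutive_of_closed (w := log_form a)).
- exact: (smooth_omega (@open_U a) (@smooth_S a) (@smooth_U_log_coef a)).
- by move=> z Uz; have [] := LI a z Uz.
- move=> z X Uz.
  exact: (sub_berwald (@open_U a) (@smooth_S a) (@U_S_J a) (@U_S_homogeneous a)
    (@U_y_neq0 a) (@U_ricci_neq0 a) (@U_curvature a)).
Qed.

Lemma closed_annihilatorP :
  log_integrable <-> exists w : chart (TM M) -> V -> 'cV[R]_(2 + 2),
     [/\ in_berwald_annihilator A S w, closed_form A w &
         forall a z, U a z ->
           \rank (dJ1 (w a) z + 2 *: wedge (w a z) (J *m w a z))%R = 4%N].
Proof.
split=> [LI|[w [[[sw _] Dw] cw rw]] a z Uz].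
  exists log_form; split.
  - split; first exact: one_form_log_form.
    move=> a z Uz.
    exact: (berwald_omega (@open_U a) (@smooth_S a) (@U_S_J a) (@U_S_homogeneous a)
      (@U_y_neq0 a) (@U_ricci_neq0 a) (@U_curvature a) Uz).
  - by move=> a z Uz; have [] := LI a z Uz.
  - move=> a z Uz; have [w0 hu] := LI a z Uz.
    exact: (rank_dJ1_omega (@open_U a) (@smooth_S a) (@U_S_J a) (@U_S_homogeneous a)
      (@smooth_U_log_coef a) (@U_y_neq0 a) (@U_ricci_neq0 a) (@U_curvature a) Uz w0 hu).
exact: (closed_annihilator (@open_U a) (@smooth_S a) (@U_S_J a) (@U_S_homogeneous a)
  (@smooth_U_log_coef a) (@U_y_neq0 a) (@U_ricci_neq0 a) (@U_curvature a) (isT : (1 < 2)%N)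
  (sw a) (Dw a) (cw a) (rw a) Uz).
Qed.

Lemma is_derive_finsler (B : set (TM M)) (F : TM M -> R) a z :
  (forall v (k : R), B v -> 0 < k -> F (dilate k v) = k * F v) -> chart_image B a z ->
  is_derive z (liouville z) (local_expr 0 F a) (local_expr 0 F a z).
Proof.
move=> Fh [v [Bv av] <-]; apply: is_derive_of_line.
rewrite (TM_local_exprE HM)//.
have D := is_derive_add (is_derive_cst (1 : R) (0 : R) (1 : R)) (is_derive_id (0 : R) (1 : R)).
have D1 : is_derive (0 : R) (1 : R) (fun t : R => (1 + t) * F v) (F v).
  apply: is_derive_eq (is_derive_mul D (is_derive_cst (F v) (0 : R) (1 : R))) _.
  by rewrite /cst add0r mul1r mulr0 addr0.
(* Moving by t along C is the dilation by 1 + t, and homogeneity applies only while this factor is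
   positive. *)
have I0 : [set t : R | -1 < t] 0 by rewrite /= ltrN10.
have oI : open [set t : R | -1 < t] by exact: open_gt.
refine (is_derive_ext oI I0 _ D1) => t; rewrite /= => t1.
have c0 : 0 < 1 + t by rewrite -ltrBlDl sub0r.
rewrite -(Fh v (1 + t) Bv c0).
have -> : t *: liouville (coord a v) + coord a v = coord a (dilate (1 + t) v).
  by rewrite coord_dilate addrC [1 + t]addrC addrK.
by rewrite (TM_local_exprE HM).
Qed.

(** The conclusion is pointwise and [log_form] depends on S alone, so a Finsler function on a conic
    neighbourhood of each direction suffices. *)
Lemma log_integrable_of_metrizable : finsler_metrizable A S -> log_integrable.
Proof.
move=> FM a z [v [Av av] <-].
have [B [[BT nB Bd] Bv BA [F [sF F0 Fh rF] gF]]] := FM v Av.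
have oB := nB a.
have BU : chart_image B a `<=` U a by move=> _ [u [Bu au] <-]; exists u => //; split=> //; apply: BA.
have Bz : chart_image B a (coord a v) by exists v.
have sS' := smooth_subset BU (@smooth_S a).
have sb' := smooth_subset BU (@smooth_U_log_coef a).
have SJ' x (Bx : chart_image B a x) := U_S_J (BU x Bx).
have r0 x (Bx : chart_image B a x) := U_ricci_neq0 (BU x Bx).
have Cb x (Bx : chart_image B a x) := U_curvature (BU x Bx).
have pos x : chart_image B a x -> 0 < local_expr 0 F a x.
  by move=> [u [Bu au] <-]; rewrite (TM_local_exprE HM)//; apply: F0.
have dF : forall x, chart_image B a x ->
    d0 (local_expr 0 F a) x = local_expr 0 F a x *: log_form a x.
  exact: (d0_eq_omega oB sS' SJ' r0 Cb (sF a) pos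
    (fun x => @is_derive_finsler B F a x Fh) (gF a)).
split; first exact: (closed_of_exact oB sS' sb' (sF a) dF pos Bz).
have := rF a _ Bz; rewrite (metric_exact oB sb' (sF a) dF Bz) => rk.
have F20 : local_expr 0 F a (coord a v) ^+ 2 != 0 by rewrite expf_neq0// gt_eqF// pos.
by rewrite -row_free_unit /row_free -(mxrank_scale_nz _ F20) rk.
Qed.

Lemma is_derive1_ln_shift (s : R) : 0 <= s -> is_derive s (1 : R) (fun t : R => ln (1 + t)) (1 + s)^-1.
Proof.
move=> s0; have -> : (fun t : R => ln (1 + t)) = (fun t : R => ln (1 + t *: (1 : R))).
  by apply/funext => t; rewrite [t *: _]mulr1.
apply: (is_derive_line (f := @ln R) (x := 1) (u := 1)).
by rewrite [s *: _]mulr1; apply: is_derive1_ln; rewrite ltr_wpDr.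
Qed.

(** Along t |-> z + t C(z) the derivative of f is 1 / (1 + t), that of ln (1 + t); this makes exp f
    homogeneous of degree 1. *)
Lemma homogeneous_potential (W : set V) (f : V -> R) (w : V -> 'cV[R]_(2 + 2)) z k :
  (forall z v, W z -> is_derive z v f ((v *m w z) 0 0)) ->
  (forall z, W z -> liouville z *m w z = 1%:M) ->
  (forall z k, W z -> 0 < k -> W (z + (k - 1) *: liouville z)) ->
  W z -> 0 < k -> f (z + (k - 1) *: liouville z) = f z + ln k.
Proof.
move=> fw lw cW.
have le1 x h : W x -> 0 < h -> f (x + h *: liouville x) = f x + ln (1 + h).
  move=> Wx h0.
  have [|c _] := @is_derive_MVT R (fun t => f (x + t *: liouville x) - ln (1 + t))
    (fun=> 0) h h0.
    move=> s /andP[s0 _]; have s1 : 0 < 1 + s by rewrite ltr_wpDr.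
    have Ws : W (x + s *: liouville x).
      by have := cW x (1 + s) Wx s1; rewrite [1 + s]addrC addrK.
    have E : ((liouville x) *m w (x + s *: liouville x)) 0 0 = (1 + s)^-1.
      (* C at the displaced point is (1 + s) C(x), and w takes the value 1 on it. *)
      have lE : liouville (x + s *: liouville x) = (1 + s) *: liouville x.
        have lK : liouville (liouville x) = liouville x.
          by rewrite !liouvilleE -!(mulmxA x) -(mulmxA dy) (mulmxA ddy) ddy_dy mul1mx.
        by rewrite [LHS]liouvilleE mulmxDl -scalemxAl -!liouvilleE lK scalerDl scale1r.
      apply: (mulfI (lt0r_neq0 s1)); rewrite mulfV ?gt_eqF//.
      have := congr1 (fun C : 'M[R]_1 => C 0 0) (lw _ Ws).
      by rewrite /= lE -scalemxAl [LHS]mxE [RHS]mxE eqxx => ->.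
    apply: (is_derive_eq (is_derive_sub (is_derive_line (fw _ (liouville x) Ws))
      (is_derive1_ln_shift s0))).
    by rewrite E subrr.
  rewrite mulr0 scale0r !addr0 ln1 subr0 => /eqP.
  by rewrite subr_eq0 subr_eq => /eqP ->.
move=> Wz k0; have [k1|k1|->] := ltgtP k 1; last by rewrite subrr scale0r addr0 ln1 addr0.
  (* For k < 1 the case of a positive displacement is applied at the dilated point, with the factor
     1 / k > 1 leading back to z. *)
  have Wz' := cW z k Wz k0.
  have h0 : 0 < k^-1 - 1 by rewrite subr_gt0 invf_gt1.
  have := le1 _ _ Wz' h0; rewrite scale_liouvilleK ?gt_eqF//.
  by rewrite [1 + _]addrC subrK lnV ?posrE// => ->; rewrite subrK.
by rewrite (le1 _ _ Wz) ?subr_gt0// [1 + _]addrC subrK.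
Qed.

Lemma metrizable_of_log_integrable : log_integrable -> finsler_metrizable A S.
Proof.
move=> LI v0 Av0; have [a av0] : exists a : chart (TM M), dom a v0 := dom_cover HM (projT1 v0).
have [AT nA cA] := HA.
have Uz0 : U a (coord a v0) by exists v0.
have cU z (k : R) : U a z -> 0 < k -> U a (z + (k - 1) *: liouville z).
  move=> [v [Av av] <-] k0; rewrite -coord_dilate; exists (dilate k v) => //.
  by split=> //; exact: cA.
have [W [oW Wz0 WU cW convW]] := convex_cone_neighborhood (@open_U a) Uz0 cU.
have sw : smooth W (log_form a).
  exact: smooth_subset WU (smooth_omega (@open_U a) (@smooth_S a) (@smooth_U_log_coef a)).
have [f fw] := poincare oW Wz0 convW (sw 1%N) (fun z Wz => (LI a z (WU z Wz)).1).
have df : forall z, W z -> differentiable f z.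
  apply: (is_diff_gradient oW fw) => z Wz.
  exact: differentiable_continuous (smooth_differentiable sw Wz).
have sf : smooth W f.
  apply: smooth_of_derive df _ => v.
  apply: (smooth_ext oW (f := fun z => (v *m log_form a z) 0 0)).
    by move=> z Wz; have [_ ->] := fw z v Wz.
  by apply: smooth_entry => //; apply: smooth_mulmx => //; exact: smooth_cst.
have fh z (k : R) : W z -> 0 < k -> f (z + (k - 1) *: liouville z) = f z + ln k.
  apply: (homogeneous_potential fw _ cW) => x Wx; have Ux := WU x Wx.
  exact: (liouville_omega (@open_U a) (@smooth_S a) (@U_S_J a) (@U_S_homogeneous a)
    (@U_y_neq0 a) (@U_ricci_neq0 a) (@U_curvature a) Ux).
(* Everything is read in the single chart a. Off B the values of F are junk; in another chart c the
   expression of F on B is exp f composed with the transition map to a. *)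
pose F (v : TM M) : R := expR (f (coord a v)).
pose B : set (TM M) := [set v | [/\ A v, dom a v & W (coord a v)]].
have BO c : chart_image B c = overlap A c a `&` [set z | W (transition c a z)].
  apply/seteqP; split=> [_ [v [[Av av Wv] cv] <-]|_ [[v [[Av av] cv] <-]]].
    by split; [exists v|rewrite /= (TM_transitionE HM)].
  by rewrite /= (TM_transitionE HM)// => Wv; exists v.
have BA : B `<=` A by move=> v [].
have oB c : open (chart_image B c).
  rewrite BO; have oO := @open_O c a; have sT := smooth_TM_transition HM c a nA.
  rewrite openE => z [Oz Wz]; apply: filterI; first exact: open_nbhs_nbhs.
  have cT := differentiable_continuous (smooth_differentiable sT Oz).
  exact: cT (open_nbhs_nbhs (conj oW Wz)).
have FE c z : chart_image B c z -> expR (f (transition c a z)) = local_expr 0 F c z.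
  by move=> [v [[Av av Wv] cv] <-]; rewrite (TM_transitionE HM)// (TM_local_exprE HM).
have BOs c : chart_image B c `<=` overlap A c a by rewrite BO => z [].
have sT c : smooth (chart_image B c) (transition c a).
  exact: smooth_subset (@BOs c) (smooth_TM_transition HM c a nA).
have BW c z : chart_image B c z -> W (transition c a z) by rewrite BO => -[].
have sfT c : smooth (chart_image B c) (fun z => f (transition c a z)).
  by move=> k; apply: (Ck_comp (oB c) oW (@BW c) (sT c k) (sf k)).
have sF c : smooth (chart_image B c) (local_expr 0 F c).
  exact (smooth_ext (oB c) (@FE c) (smooth_expR (oB c) (sfT c))).
(* Here the tensoriality of omega is used: the chain rule through the transition to a turns
   [log_form a] into [log_form c], so the equation holds in every chart. *)
have dF c z : chart_image B c z ->
    d0 (local_expr 0 F c) z = local_expr 0 F c z *: log_form c z.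
  move=> Bz; apply: eq_mulmx_row => v; rewrite -scalemxAr.
  rewrite [LHS]mx11_scalar [X in _ = _ *: X]mx11_scalar scale_scalar_mx; congr (_%:M).
  apply: is_derive_unique (is_derive_d0 v (sF c) Bz) _.
  apply: (is_derive_ext (oB c) Bz (@FE c)).
  have dT := smooth_differentiable (sT c) Bz.
  have dfT := smooth_differentiable (sfT c) Bz.
  apply: is_derive_eq (is_derive_smooth v (smooth_expR (oB c) (sfT c)) Bz) _.
  rewrite (derive_expR_comp v dfT) FE//; congr (_ * _).
  rewrite (log_form_transition (BOs _ _ Bz)) mulmxA.
  rewrite (derive_comp _ dT (df _ (BW _ _ Bz))) deriveEjacobian//.
  by have [_ ->] := fw _ (v *m 'J (transition c a) z) (BW _ _ Bz).
have pos c z : chart_image B c z -> 0 < local_expr 0 F c z.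
  by move=> Bz; rewrite -FE// expR_gt0.
have BU c : chart_image B c `<=` U c.
  by move=> _ [u [Bu cu] <-]; exists u => //; split=> //; apply: BA.
exists B; split => //.
- split=> //; first by move=> v /BA /AT.
  move=> v k [Av av Wv] k0; split=> //; first exact: cA.
  by rewrite coord_dilate; exact: cW.
exists F.
  split=> //.
  - by move=> v _; exact: expR_gt0.
  - move=> v k [Av av Wv] k0; rewrite /F coord_dilate fh// expRD lnK ?posrE//.
    by rewrite mulrC.
  - move=> c z Bz.
    rewrite (metric_exact (oB c) (smooth_subset (@BU c) (@smooth_U_log_coef c)) (sF c) (@dF c) Bz).
    have F20 : local_expr 0 F c z ^+ 2 != 0 by rewrite expf_neq0// gt_eqF// pos.
    rewrite (mxrank_scale_nz _ F20); apply/eqP.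
    by rewrite -/(row_free _) row_free_unit; have [_] := LI c z (BU c z Bz).
move=> c z Bz.
exact: (EL_of_exact (oB c) (smooth_subset (@BU c) (@smooth_S c))
  (fun x Bx => U_S_J (BU c x Bx)) (fun x Bx => U_S_homogeneous (BU c x Bx))
  (smooth_subset (@BU c) (@smooth_U_log_coef c)) (fun x Bx => U_y_neq0 (BU c x Bx))
  (fun x Bx => U_ricci_neq0 (BU c x Bx)) (fun x Bx => U_curvature (BU c x Bx))
  (sF c) (@dF c) (@pos c) Bz).
Qed.

End SprayTM.

Theorem theorem4p1 (R : realType) (M : atlas R 2)
    (HM : manifold M) (HMo : orientable M)
    (A : set (TM M)) (HA : open_cone A)
    (S : chart (TM M) -> 'rV[R]_(2 + 2) -> 'rV[R]_(2 + 2))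
    (HS : spray A S) (HSnf : non_flat A S) :
  (finsler_metrizable A S <-> (regular A S /\ berwald_integrable A S)) /\
  ((regular A S /\ berwald_integrable A S) <->
   exists w : chart (TM M) -> 'rV[R]_(2 + 2) -> 'cV[R]_(2 + 2),
     [/\ in_berwald_annihilator A S w,
         closed_form A w &
         forall a z, chart_image A a z ->
           \rank (dJ1 (w a) z + 2 *: wedge (w a z) (J *m w a z))%R = 4%N]).
Proof.
split.
  split=> [FM|].
    by apply/(regular_integrableP HM HA HS HSnf)/log_integrable_of_metrizable.
  move/(regular_integrableP HM HA HS HSnf); exact: metrizable_of_log_integrable.
apply: iff_trans (regular_integrableP HM HA HS HSnf) _.
exact: closed_annihilatorP.
Qed.
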